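(* Let $p,q\ge2$ be integers, suppose $(\beta,h)\in\Theta$ is critical and let $\boldsymbol m_1,\dots,\boldsymbol m_K$ denote the $K$ global maximizers of $H_{\beta,h}$, where $\boldsymbol m_i$ is a permutation of $\boldsymbol x_{s_i}$. Then, for $\boldsymbol X\sim\mathbb P_{\beta,h,N}$, as $N\to\infty$, $\bar{\boldsymbol X}_N$ converges in distribution to the mixture $$\sum_{k=1}^K p_k\,\delta_{\boldsymbol m_k},\qquad p_k:=\frac{\tau(\boldsymbol m_k)}{\sum_{i=1}^K\tau(\boldsymbol m_i)},\qquad \tau(\boldsymbol m_i):=\sqrt{\frac{-f''_{\beta,h}(s_i)^{-1}\left(-k''\left(\frac{1-s_i}{q}\right)\right)^{2-q}}{\prod_{r=1}^q m_{i,r}}}.$$ Moreover, if $(\beta_N,h_N)=\left(\beta+\frac{\bar\beta}{\sqrt N},h+\frac{\bar h}{\sqrt N}\right)$ for some $\bar\beta,\bar h\in\mathbb R$, then for every $\varepsilon>0$ smaller than the minimum distance between any two global maximizers of $H_{\beta,h}$ and every $i\in\{1,\dots,K\}$, under the conditional law $\mathbb P_{\beta_N,h_N,N}\left(\cdot\mid\bar{\boldsymbol X}_N\in B(\boldsymbol m_i,\varepsilon)\right)$, $$\sqrt N\left(\bar{\boldsymbol X}_N-\boldsymbol m_i\right)\xrightarrow{D}\mathcal N_q\left(P\Sigma P^\top(\bar\beta p\,\boldsymbol m_i^{p-1}+\bar h\boldsymbol e_1),\,P\Sigma P^\top\right),$$ where $P$ is a permutation matrix with $\boldsymbol m_i=P\boldsymbol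 x_{s_i}$ and $\Sigma=\Sigma(s_i)$ is the matrix defined in the context evaluated at $s=s_i$.
   Context: For real $\beta,h$ and $N\ge1$, $\mathbb P_{\beta,h,N}$ is the probability measure on $\{1,\dots,q\}^N$ with $\mathbb P_{\beta,h,N}(\boldsymbol X)\propto\exp\left(\beta N\sum_{r=1}^q\bar X_{\cdot r}^p+Nh\bar X_{\cdot1}\right)$, where $\bar X_{\cdot r}=N^{-1}\#\{i:X_i=r\}$; $\bar{\boldsymbol X}_N=(\bar X_{\cdot1},\dots,\bar X_{\cdot q})^\top$. $\Theta=(0,\infty)\times[0,\infty)$. On the set $\mathcal P_q$ of probability vectors in $\mathbb R^q$, $H_{\beta,h}(\boldsymbol t)=\beta\sum_r t_r^p+ht_1-\sum_r t_r\log t_r$. For $s\in[0,1]$, $\boldsymbol x_s=\left(\frac{1+(q-1)s}{q},\frac{1-s}{q},\dots,\frac{1-s}{q}\right)$, $f_{\beta,h}(s)=H_{\beta,h}(\boldsymbol x_s)$, $k(x)=\beta x^p-x\log x$. Every global maximizer of $H_{\beta,h}$ is a permutation of $\boldsymbol x_s$ for a unique $s\in[0,1)$. For $\boldsymbol v\in\mathcal P_q$ with positive entries, $\boldsymbol Q_{\boldsymbol v,\beta}(\boldsymbol t)=\sum_{r=1}^q\left(\beta p(p-1)v_r^{p-2}-\frac1{v_r}\right)t_r^2$, and $\mathcal H_q=\{\boldsymbol t\in\mathbb R^q:\sum_r t_r=0\}$. The point $(\beta,h)$ is critical if $H_{\beta,h}$ has more than one global maximizer and for each global maximizer $\boldsymbol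 m$ the form $\boldsymbol Q_{\boldsymbol m,\beta}$ is negative definite on $\mathcal H_q$. For $s$ with $\boldsymbol x_s$ (up to permutation) a global maximizer, put $\rho=k''\left(\frac{1+(q-1)s}{q}\right)/k''\left(\frac{1-s}{q}\right)$ and let $\Sigma(s)$ be $\left(-\frac{q^2}{q-1}f''_{\beta,h}(s)\right)^{-1}$ times the $q\times q$ matrix whose $(1,1)$ entry is $q-1$, whose other first-row and first-column entries are $-1$, whose remaining diagonal entries are $1+(q-2)\rho$ and whose remaining off-diagonal entries are $-\rho$. Powers of vectors are coordinatewise, $\boldsymbol e_1=(1,0,\dots,0)$, and $B(\boldsymbol m,\varepsilon)$ is the Euclidean ball of radius $\varepsilon$ around $\boldsymbol m$. *)

(* Defs.v *)
From HB Require Import structures.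
From mathcomp Require Import all_boot all_order all_algebra all_fingroup.
From mathcomp Require Import all_classical all_reals all_analysis.

Set Implicit Arguments.
Unset Strict Implicit.
Unset Printing Implicit Defensive.

Import Order.TTheory GRing.Theory Num.Theory.
Import numFieldNormedType.Exports.

Local Open Scope classical_set_scope.
Local Open Scope ring_scope.

(* Vectors of R^q are columns 'cV[R]_q, and the colours 1, ..., q are the
   elements 0, ..., q-1 of 'I_q: the distinguished first coordinate is the
   one of index 0. *)

Section vectors.
Variables (R : realType) (q : nat).
Implicit Types u v : 'cV[R]_q.

Definition e1 : 'cV[R]_q := \col_r ((r == 0 :> nat)%:R).

Definition dot u v : R := \sum_(r < q) u r ord0 * v r ord0.

(* The library norm on matrices is the sup norm, hence this definition. *)
Definition eucl_dist u v : R :=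
  Num.sqrt (\sum_(r < q) (u r ord0 - v r ord0) ^+ 2).

Definition simplex : set 'cV[R]_q :=
  [set t | (forall r, 0 <= t r ord0) /\ \sum_(r < q) t r ord0 = 1].

Definition zero_sum : set 'cV[R]_q :=
  [set t | \sum_(r < q) t r ord0 = 0].

(* R^q with its Borel sigma-algebra *)
Definition borelV := g_sigma_algebraType (@open 'cV[R]_q).

End vectors.

Arguments e1 {R q}.

Section free_energy.
Variables (R : realType) (p q : nat) (beta h : R).

(* ln 0 = 0 in the library, so that t ln t = 0 at t = 0. *)
Definition energy (t : 'cV[R]_q) : R :=
  beta * \sum_(r < q) t r ord0 ^+ p + h * dot e1 t
  - \sum_(r < q) t r ord0 * ln (t r ord0).

Definition global_max (t : 'cV[R]_q) : Prop :=
  simplex t /\ forall u, simplex u -> energy u <= energy t.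

Definition xs (s : R) : 'cV[R]_q :=
  \col_r (if r == 0 :> nat then (1 + (q%:R - 1) * s) / q%:R
          else (1 - s) / q%:R).

Definition fline (s : R) : R := energy (xs s).

Definition kfun (x : R) : R := beta * x ^+ p - x * ln x.

Definition f'' : R -> R := (fline^`(2))%classic.

Definition k'' : R -> R := (kfun^`(2))%classic.

Definition Qform (v t : 'cV[R]_q) : R :=
  \sum_(r < q) (beta * p%:R * (p%:R - 1) * v r ord0 ^+ (p - 2)
                - 1 / v r ord0) * t r ord0 ^+ 2.

Definition critical : Prop :=
  (exists m1 m2, [/\ global_max m1, global_max m2 & m1 <> m2]) /\
  (forall m, global_max m ->
     forall t, zero_sum t -> t != 0 -> Qform m t < 0).

Definition rho (s : R) : R :=
  k'' ((1 + (q%:R - 1) * s) / q%:R) / k'' ((1 - s) / q%:R).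

Definition Sigma (s : R) : 'M[R]_q :=
  (- (q%:R ^+ 2 / (q%:R - 1)) * f'' s)^-1 *:
  \matrix_(i, j)
    (if (i == 0 :> nat) && (j == 0 :> nat) then q%:R - 1
     else if (i == 0 :> nat) || (j == 0 :> nat) then - 1
     else if i == j then 1 + (q%:R - 2) * rho s
     else - rho s).

(* tau m s is the (unnormalised) weight of a maximizer m that is a permutation
   of xs s; the exponent 2 - q is an integer. *)
Definition tau (m : 'cV[R]_q) (s : R) : R :=
  Num.sqrt (- (f'' s)^-1 * (- k'' ((1 - s) / q%:R)) ^ (2%:Z - q%:Z)
            / \prod_(r < q) m r ord0).

End free_energy.

(* Random vectors on finite probability spaces: I is the sample space and
   w : I -> R its probability mass function. *)
Section finite_probability.
Variables (R : realType) (I : finType) (w : I -> R).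

Definition expect (Y : I -> R) : R := \sum_i w i * Y i.

Definition cond (A : pred I) (i : I) : R :=
  if A i then w i / \sum_(j | A j) w j else 0.

End finite_probability.

Section gibbs_measure.
Variables (R : realType) (p q : nat).

Definition config N := {ffun 'I_N -> 'I_q}.

Definition xbar N (X : config N) : 'cV[R]_q :=
  \col_r (#|[pred i | X i == r]|%:R / N%:R).

Definition gibbs_weight (beta h : R) N (X : config N) : R :=
  expR (beta * N%:R * \sum_(r < q) xbar X r ord0 ^+ p
        + N%:R * h * dot e1 (xbar X)).

Definition gibbs (beta h : R) N (X : config N) : R :=
  gibbs_weight beta h X / \sum_(Y : config N) gibbs_weight beta h Y.

End gibbs_measure.

Arguments xbar R {q N} X.
Arguments gibbs {R} p {q} beta h {N} X.

Section convergence.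
Variables (R : realType) (q : nat).

(* Y N, a random vector on the finite probability space (I N, w N), converges
   in distribution to the probability measure mu. *)
Definition cvg_dist (I : nat -> finType) (w : forall N, I N -> R)
    (Y : forall N, I N -> 'cV[R]_q) (mu : probability (borelV R q) R) : Prop :=
  forall g : 'cV[R]_q -> R,
    continuous g -> (exists M, forall x, `|g x| <= M) ->
    ((expect (w N) (fun i => g (Y N i)))%:E @[N --> \oo]
       --> \int[mu]_x (g x)%:E)%E.

Definition is_mixture K (w : 'I_K -> R) (m : 'I_K -> 'cV[R]_q)
    (mu : probability (borelV R q) R) : Prop :=
  forall A : set (borelV R q), measurable A ->
    mu A = (\sum_(k < K) (w k)%:E * \d_(m k : borelV R q) A)%E.

(* N(mean, var) on the real line; the library's normal_prob m s, where s is
   the standard deviation, is not the Dirac mass when s = 0. *)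
Definition normal1 (mean var : R) (A : set R) : \bar R :=
  if var == 0 then \d_mean A else normal_prob mean (Num.sqrt var) A.

(* nu is the law N_q(mu, S), for a possibly singular S: under nu, the linear
   form <a, .> has law N(<a, mu>, a^T S a) for every a. *)
Definition is_normal (mu : 'cV[R]_q) (S : 'M[R]_q)
    (nu : probability (borelV R q) R) : Prop :=
  forall a : 'cV[R]_q, 0 <= dot a (S *m a) /\
    forall A : set R, measurable A ->
      nu [set x | A (dot a x)] = normal1 (dot a mu) (dot a (S *m a)) A.

End convergence.

(* Main.v *)
Require Import Defs.
From HB Require Import structures.
From mathcomp Require Import all_boot all_order all_algebra all_fingroup.
From mathcomp Require Import all_classical all_reals all_analysis.
From mathcomp Require Import measurable_realfun zify ring lra.

Set Implicit Arguments.
Unset Strict Implicit.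
Unset Printing Implicit Defensive.

Import Order.TTheory GRing.Theory Num.Theory.
Import numFieldNormedType.Exports.

Local Open Scope classical_set_scope.
Local Open Scope ring_scope.

(** The probability of a configuration depends on its composition
[xbar] only, and a composition t is realised by about exp(- N sum t ln t)
configurations, so that it has total weight exp(N energy t) up to the
polynomial factor given by Stirling's formula ([type_sizeE], [type_size_le]).
Away from the maximizers the energy has a gap ([energy_gap]) while there are
polynomially many compositions, hence the weight found there is negligible
([outer_negligible]).

Near a maximizer m put x = sqrt N (t - m), a vector of sum 0. The energy has
no first order term in these directions ([denergy0]), so the weight of t,
relative to that of m, tends to exp(Q x / 2 + <slope, x>), where Q is the
Hessian form and the slope is the gradient of the terms that multiply the
perturbations betabar / sqrt N and hbar / sqrt N ([local_exponent_cvg]). The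
sum over compositions is a Riemann sum of mesh 1 / sqrt N in n = q - 1 free
coordinates; written as the integral of a step function, it converges by
dominated convergence ([inner_laplace]), the domination coming from the
negative definiteness of Q ([domination]).

The limit is an explicit Gaussian integral. Since m is a permutation of xs s,
the form - Q is, in the free coordinates, a (sum x)^2 + b sum x^2 with two
constants a, b; a change of one variable at a time computes its Gaussian
integrals ([lebesgue_space]). The total mass at m is tau up to a factor common
to all maximizers ([tau_mass]), the covariance is P Sigma P^T
([dot_permSigma]), and completing the square turns the slope into the mean
([limit_law]).

Both assertions are quotients of such limits. The ball around m contains no
other maximizer, so conditioning on it leaves one Gaussian contribution
([conditional_limit]). Without conditioning and perturbation, the maximizers
contribute in proportion to their masses tau, and the fluctuation of order
1 / sqrt N around each of them is invisible in the limit ([mixture_limit]). *)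

(** * Gaussian integrals on the line *)

Section gauss_line.
Variable R : realType.
Notation lam := (@lebesgue_measure R).
Implicit Types (F : R -> \bar R).

(** Lebesgue measure is determined by the intervals ]a, b], and the multiple
|s| of its image measure gives them the right length. For s < 0 the preimage
of ]a, b] is closed on the other side. *)
Lemma lebesgue_affine (m s : R) F : s != 0 ->
  measurable_fun [set: R] F -> (forall x, 0 <= F x)%E ->
  (\int[lam]_x F x = `|s|%:E * \int[lam]_x F (m + s * x)%R)%E.
Proof.
move=> s0 mF F0.
pose phi (x : measurableTypeR R) : measurableTypeR R := m + s * x.
have mphi : measurable_fun [set: measurableTypeR R] phi.
  apply: measurable_funD => //; exact: measurable_funM.
pose nu' := mscale (NngNum (normr_ge0 s)) (pushforward lam phi)
  : {measure set (measurableTypeR R) -> \bar R}.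
pose nu := nu' mphi.
have nuE A : measurable A -> lam A = nu A.
  apply: lebesgue_measure_unique => _ [[a b]] _ <-.
  rewrite /nu /nu' /= /mscale /= /pushforward.
  have [sp|sn|/eqP] := ltgtP s 0; last by rewrite (negbTE s0).
  - have -> : phi @^-1` `]a, b]%classic = `[(b - m) / s, (a - m) / s[%classic.
      apply/seteqP; split => x /=;
      rewrite !in_itv /= /phi ler_ndivrMr// ltr_ndivlMr//;
      by rewrite lerBrDl ltrBlDl ![x * s]mulrC andbC.
    rewrite !lebesgue_measure_itv /= !lte_fin ltr_nM2r ?invr_lt0// ltrD2r.
    case: ifPn => _; last by rewrite mule0.
    by rewrite -!EFinD -EFinM ltr0_norm//; congr EFin; field; exact: ltr0_neq0.
  - have -> : phi @^-1` `]a, b]%classic = `](a - m) / s, (b - m) / s]%classic.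
      apply/seteqP; split => x /=;
      rewrite !in_itv /= /phi ltr_pdivrMr// ler_pdivlMr//;
      by rewrite ltrBlDl lerBrDl ![x * s]mulrC.
    rewrite !lebesgue_measure_itv /= !lte_fin ltr_pM2r ?invr_gt0// ltrD2r.
    case: ifPn => _; last by rewrite mule0.
    by rewrite -!EFinD -EFinM gtr0_norm//; congr EFin; field; exact: lt0r_neq0.
rewrite (eq_measure_integral nu); last by move=> A mA _; exact: nuE.
by rewrite ge0_integral_mscale//= ge0_integral_pushforward.
Qed.

Definition bell (x : R) : R := expR (- x ^+ 2 / 2).

(** The expectation of F(Z) for a standard normal Z. *)
Definition gauss_expect F : \bar R := (\int[lam]_z (F z * (normal_pdf 0 1 z)%:E))%E.

Let kappa : R := (Num.sqrt (pi *+ 2))^-1.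

Lemma normal01E z : normal_pdf 0 1 z = kappa * bell z.
Proof.
rewrite normal_pdfE ?oner_eq0// /normal_peak /normal_fun expr1n mul1r subr0.
by rewrite /kappa /bell mulr2n.
Qed.

Lemma kappa_gt0 : 0 < kappa.
Proof. by rewrite invr_gt0 sqrtr_gt0 mulrn_wgt0// pi_gt0. Qed.

Lemma bell_ge0 x : 0 <= bell x. Proof. exact: expR_ge0. Qed.

Lemma bellN x : bell (- x) = bell x.
Proof. by rewrite /bell sqrrN. Qed.

Lemma measurable_bell : measurable_fun [set: R] bell.
Proof.
apply: measurableT_comp => //; apply: measurable_funM => //.
by apply: measurableT_comp => //; exact: measurable_funX.
Qed.

Lemma measurable_bell_aff (m s : R) :
  measurable_fun [set: R] (fun x => bell ((x - m) / s)).
Proof.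
apply: (measurableT_comp measurable_bell); apply: measurable_funM => //.
exact: measurable_funB.
Qed.

Lemma gauss_expect1 : gauss_expect (fun=> 1%E) = 1%E.
Proof.
rewrite -[RHS](integral_normal_pdf (0 : R) 1).
by apply: eq_integral => z _; rewrite mul1e.
Qed.

Lemma gauss_expect_cst (c : \bar R) : (0 <= c)%E -> gauss_expect (fun=> c) = c.
Proof.
move=> c0; rewrite /gauss_expect ge0_integralZl//=.
- by rewrite integral_normal_pdf mule1.
- by apply/measurable_EFinP; exact: measurable_normal_pdf.
- by move=> x _; rewrite lee_fin normal_pdf_ge0.
Qed.

(** Substitution of m + s z for x. *)
Lemma integral_bell (m s : R) F : 0 < s ->
  measurable_fun [set: R] F -> (forall x, 0 <= F x)%E ->
  (\int[lam]_x (F x * (bell ((x - m) / s))%:E)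
   = (s / kappa)%:E * gauss_expect (fun z => F (m + s * z)%R))%E.
Proof.
move=> s0 mF F0.
have mphi : measurable_fun [set: R] (fun x : R => m + s * x).
  apply: measurable_funD => //; exact: measurable_funM.
rewrite (@lebesgue_affine m s); last 3 first.
- by rewrite gt_eqF.
- apply: emeasurable_funM => //; apply/measurable_EFinP.
  exact: measurable_bell_aff.
- by move=> x; rewrite mule_ge0// lee_fin bell_ge0.
rewrite gtr0_norm// EFinM -muleA; congr (_ * _)%E.
rewrite /gauss_expect -ge0_integralZl//=.
- apply: eq_integral => z _; rewrite normal01E muleCA -EFinM.
  congr (_ * (_ )%:E)%E; rewrite mulKf ?gt_eqF ?kappa_gt0//.
  by congr bell; field; rewrite gt_eqF.
- apply: emeasurable_funM => //; first exact: (measurableT_comp mF).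
  by apply/measurable_EFinP; exact: measurable_normal_pdf.
- by move=> x _; rewrite mule_ge0// lee_fin normal_pdf_ge0.
- by rewrite lee_fin invr_ge0 ltW// kappa_gt0.
Qed.

Lemma measurable_gauss_expect d (T : measurableType d) (G : T * R -> \bar R) :
  measurable_fun setT G -> (forall x, 0 <= G x)%E ->
  measurable_fun [set: T] (fun t => gauss_expect (fun z => G (t, z))).
Proof.
move=> mG G0.
pose H (tz : T * R) := (G tz * (normal_pdf 0 1 tz.2)%:E)%E.
apply: (@measurable_fun_fubini_tonelli_F _ _ T (measurableTypeR R) R lam H) => //.
- apply: emeasurable_funM => //; apply/measurable_EFinP.
  by apply: measurableT_comp => //; exact: measurable_normal_pdf.
- by move=> x; rewrite mule_ge0// lee_fin normal_pdf_ge0.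
Qed.

Lemma gauss_expect_ge0 F : (forall x, 0 <= F x)%E -> (0 <= gauss_expect F)%E.
Proof.
by move=> F0; apply: integral_ge0 => x _; rewrite mule_ge0// lee_fin normal_pdf_ge0.
Qed.

Lemma gauss_expect_opp F :
  measurable_fun [set: R] F -> (forall x, 0 <= F x)%E ->
  gauss_expect (fun z => F (- z)%R) = gauss_expect F.
Proof.
move=> mF F0; rewrite /gauss_expect [RHS](@lebesgue_affine 0 (-1)).
- rewrite normrN normr1 mul1e; apply: eq_integral => z _.
  by rewrite add0r mulN1r !normal01E bellN.
- by rewrite oppr_eq0 oner_eq0.
- by apply: emeasurable_funM => //; apply/measurable_EFinP; exact: measurable_normal_pdf.
- by move=> x; rewrite mule_ge0// lee_fin normal_pdf_ge0.
Qed.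

(** The sum of independent centred normal variables is normal. In the
variables z and y = s1 z + s2 z', completing the square in z splits the joint
density into a bell in z, which integrates to a constant, and a bell in y of
width sqrt (s1^2 + s2^2). This change of variables degenerates for s2 = 0,
where only the sign of s1 has to be absorbed. *)
Lemma gauss_expect_conv (m s1 s2 : R) F :
  measurable_fun [set: R] F -> (forall x, 0 <= F x)%E ->
  gauss_expect (fun z1 => gauss_expect (fun z2 => F (m + s1 * z1 + s2 * z2)%R))
  = gauss_expect (fun z => F (m + Num.sqrt (s1 ^+ 2 + s2 ^+ 2) * z)%R).
Proof.
move=> mF F0.
have k0 : kappa != 0 by rewrite gt_eqF// kappa_gt0.
have maff (u v : R) : measurable_fun [set: R] (fun x : R => u + v * x).
  apply: measurable_funD => //; exact: measurable_funM.
have [->|s20] := eqVneq s2 0.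
  transitivity (gauss_expect (fun z => F (m + s1 * z)%R)).
    apply: eq_integral => z _; congr (_ * _)%E.
    rewrite -[RHS]gauss_expect_cst//.
    by apply: eq_integral => z2 _; rewrite mul0r addr0.
  rewrite expr0n addr0 sqrtr_sqr.
  have [s10|s10] := leP 0 s1; first by rewrite ger0_norm.
  rewrite ltr0_norm// -(@gauss_expect_opp (fun z => F (m + s1 * z)%R))//; last first.
    exact: (measurableT_comp mF).
  by congr gauss_expect; apply/funext => z; rewrite mulNr mulrN.
pose s := Num.sqrt (s1 ^+ 2 + s2 ^+ 2).
have s_gt0 : 0 < s by rewrite sqrtr_gt0 ltr_wpDl ?sqr_ge0// exprn_even_gt0.
have ssE : s ^+ 2 = s1 ^+ 2 + s2 ^+ 2 by rewrite sqr_sqrtr// addr_ge0// sqr_ge0.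
have s2n0 : `|s2| != 0 by rewrite normr_eq0.
have k2_ge0 : 0 <= kappa ^+ 2 / `|s2| by rewrite divr_ge0 ?sqr_ge0.
pose H (zy : R * R) : \bar R := (F (m + zy.2)%R *
  (kappa ^+ 2 / `|s2| * (bell zy.1 * bell ((zy.2 - s1 * zy.1) / s2)))%:E)%E.
have mH : measurable_fun setT H.
  apply: emeasurable_funM.
    apply: (measurableT_comp mF); exact: measurable_funD.
  apply/measurable_EFinP; apply: measurable_funM => //.
  apply: measurable_funM; apply: (measurableT_comp measurable_bell) => //.
  apply: measurable_funM => //; apply: measurable_funB => //.
  exact: measurable_funM.
have H0 zy : (0 <= H zy)%E.
  rewrite mule_ge0// lee_fin; apply: mulr_ge0 => //.
  by apply: mulr_ge0; exact: bell_ge0.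
transitivity (\int[lam]_z \int[lam]_y H (z, y))%E.
  apply: eq_integral => z _.
  rewrite -ge0_integralZr/=; first last.
  - by rewrite lee_fin normal_pdf_ge0.
  - by move=> x _; rewrite mule_ge0// lee_fin normal_pdf_ge0.
  - apply: emeasurable_funM; first exact: (measurableT_comp mF (maff _ _)).
    by apply/measurable_EFinP; exact: measurable_normal_pdf.
  - exact: measurableT.
  rewrite [RHS](@lebesgue_affine (s1 * z) s2)//; last first.
    exact: measurable_fun_pair2.
  rewrite -ge0_integralZl//=; last first.
    exact: (measurableT_comp (measurable_fun_pair2 z mH) (maff _ _)).
  apply: eq_integral => y _; rewrite /H /= addrA !normal01E.
  rewrite muleCA -muleA -!EFinM; congr (_ * (_)%:E)%E.
  have -> : (s1 * z + s2 * y - s1 * z) / s2 = y by field.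
  by field.
rewrite (@fubini_tonelli _ _ (measurableTypeR R) (measurableTypeR R) R lam lam H)//.
transitivity (\int[lam]_y (F (m + y)%R * (kappa / s * bell (y / s))%:E))%E.
  apply: eq_integral => y _ /=.
  pose c := kappa ^+ 2 / `|s2| * bell (y / s).
  have c0 : 0 <= c.
    apply: mulr_ge0 => //; exact: bell_ge0.
  transitivity (\int[lam]_z (F (m + y)%R * (c%:E *
      (bell ((z - y * s1 / s ^+ 2) / (`|s2| / s)))%:E)))%E.
    apply: eq_integral => z _; rewrite /H /= -EFinM; congr (_ * (_)%:E)%E.
    rewrite /c -[RHS]mulrA; congr (_ * _); rewrite /bell -!expRD.
    have S0 : s1 ^+ 2 + s2 ^+ 2 != 0 by rewrite -ssE expf_neq0// gt_eqF.
    have -> : (y / s) ^+ 2 = y ^+ 2 / (s1 ^+ 2 + s2 ^+ 2).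
      by rewrite expr_div_n ssE.
    have -> : ((z - y * s1 / s ^+ 2) / (`|s2| / s)) ^+ 2 =
        (z - y * s1 / (s1 ^+ 2 + s2 ^+ 2)) ^+ 2 * (s1 ^+ 2 + s2 ^+ 2) / s2 ^+ 2.
      rewrite ssE !expr_div_n real_normK ?num_real// ssE.
      by field; rewrite s20 S0.
    by congr expR; field; rewrite s20 S0.
  rewrite ge0_integralZl//=; first last.
  - by move=> x _; rewrite mule_ge0// lee_fin ?bell_ge0.
  - apply: emeasurable_funM => //; apply/measurable_EFinP.
    exact: measurable_bell_aff.
  rewrite ge0_integralZl//=; first last.
  - by move=> x _; rewrite lee_fin ?bell_ge0.
  - apply/measurable_EFinP; exact: measurable_bell_aff.
  have := @integral_bell (y * s1 / s ^+ 2) (`|s2| / s) (fun=> 1%E).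
  under eq_integral do rewrite mul1e.
  move=> ->//; last by rewrite divr_gt0// lt_def s2n0 normr_ge0.
  rewrite gauss_expect1 mule1 -EFinM; congr (_ * (_)%:E)%E.
  by rewrite /c; field; rewrite k0 s2n0 gt_eqF.
have mF0 : measurable_fun [set: R] (fun y => F (m + y)%R).
  by apply: (measurableT_comp mF); exact: measurable_funD.
have mG : measurable_fun [set: R]
    (fun y => F (m + y)%R * (kappa / s * bell (y / s))%:E)%E.
  apply: emeasurable_funM => //; apply/measurable_EFinP.
  apply: measurable_funM => //; apply: (measurableT_comp measurable_bell).
  exact: measurable_funM.
have G0 y : (0 <= F (m + y)%R * (kappa / s * bell (y / s))%:E)%E.
  rewrite mule_ge0// lee_fin; apply: mulr_ge0; last exact: bell_ge0.
  by rewrite divr_ge0 ?ltW// kappa_gt0.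
rewrite [LHS](@lebesgue_affine 0 s)// ?gt_eqF//.
rewrite /gauss_expect -ge0_integralZl//=.
- apply: eq_integral => z _; rewrite normal01E add0r muleCA -EFinM.
  congr (_ * (_)%:E)%E; rewrite gtr0_norm//.
  rewrite [s * z / s]mulrAC divff ?gt_eqF// mul1r; field; exact: lt0r_neq0.
- exact: (measurableT_comp mG (maff _ _)).
Qed.

End gauss_line.

(** * Gaussian integrals in several variables *)

Section gauss_space.
Variable R : realType.
Notation lam := (@lebesgue_measure R).

Definition quad n (a b : R) (x : 'I_n -> R) : R :=
  a * (\sum_i x i) ^+ 2 + b * \sum_i x i ^+ 2.

(** The variance of the linear form c under the density proportional to
exp (- quad a b x / 2). With J the all-ones matrix, the inverse of a J + b I
is (I - a / (n a + b) J) / b. *)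
Definition gauss_var n (a b : R) (c : 'I_n -> R) : R :=
  (\sum_i c i ^+ 2 + a / b * (n%:R * \sum_i c i ^+ 2 - (\sum_i c i) ^+ 2))
  / (n%:R * a + b).

(** The integral of exp (- quad a b x / 2): the determinant of a J + b I is
b^n (1 + n a / b). *)
Definition gauss_mass n (a b : R) : R :=
  Num.sqrt ((pi *+ 2) ^+ n / (b ^+ n * (1 + n%:R * a / b))).

(** A model of Lebesgue measure on R^n, given by its coordinate functions, its
values on products of functions of one variable, and the Gaussian integral of
a function of one linear form. The last property is part of the record because
it is proved by induction on n together with the construction. *)
Record lebesgue_space (n : nat) := LebesgueSpace {
  ls_disp : measure_display;
  ls_sort : measurableType ls_disp;
  ls_mu : {sigma_finite_measure set ls_sort -> \bar R};
  ls_co : ls_sort -> 'I_n -> R;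
  ls_meas : forall i, measurable_fun [set: ls_sort] (fun t => ls_co t i);
  ls_prod : forall g : 'I_n -> R -> R, (forall i x, 0 <= g i x) ->
    (forall i, measurable_fun [set: R] (g i)) ->
    (\int[ls_mu]_t (\prod_i g i (ls_co t i))%:E
     = \prod_i \int[lam]_x (g i x)%:E)%E;
  ls_gauss : forall (a b : R) (c w : 'I_n -> R) (F : R -> \bar R),
    0 < b -> 0 < n%:R * a + b ->
    measurable_fun [set: R] F -> (forall x, 0 <= F x)%E ->
    (\int[ls_mu]_t (F (\sum_i c i * ls_co t i)%R
        * (expR (- quad a b (fun i => ls_co t i - w i) / 2))%:E)
     = (gauss_mass n a b)%:E
       * gauss_expect (fun z => F (\sum_i c i * w i
                            + Num.sqrt (gauss_var a b c) * z)%R))%E }.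

(** Integrating out the first variable leaves a form of the same kind, in which
a is replaced by the Schur complement a b / (a + b). *)
Lemma gauss_massS n (a b : R) : 0 < b -> 0 < n.+1%:R * a + b -> 0 < a + b ->
  gauss_mass n.+1 a b =
  Num.sqrt (pi *+ 2) / Num.sqrt (a + b) * gauss_mass n (a * b / (a + b)) b.
Proof.
move=> b0 nab ab0.
have pi2 : 0 < pi *+ 2 :> R by rewrite mulrn_wgt0// pi_gt0.
rewrite -sqrtrV ?ltW// -sqrtrM; last exact: ltW.
rewrite -sqrtrM; last by rewrite divr_ge0 ?ltW.
congr Num.sqrt; rewrite !exprS.
have ab0' : a + b != 0 by rewrite gt_eqF.
have b0' : b != 0 by rewrite gt_eqF.
have N1 : b + (n%:R + 1) * a != 0 by rewrite natr1 addrC gt_eqF.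
have := expf_neq0 n b0'; set bn := b ^+ n => bn0.
have N2 : a + b + n%:R * a != 0.
  by rewrite (_ : _ + _ = b + (n%:R + 1) * a)//; ring.
by rewrite -natr1; field; rewrite b0' ab0' N2.
Qed.

(** The first variable is a normal variable of variance 1 / (a + b) minus
a / (a + b) times the sum of the others, hence the modified form on them and
the extra square. *)
Lemma gauss_varS n (a b : R) (c : 'I_n.+1 -> R) :
  0 < b -> 0 < n.+1%:R * a + b -> 0 < a + b ->
  gauss_var a b c =
  gauss_var (a * b / (a + b)) b
    (fun j => c (lift ord0 j) - c ord0 * (a / (a + b)))
  + (c ord0 / Num.sqrt (a + b)) ^+ 2.
Proof.
move=> b0 nab ab0; rewrite /gauss_var !big_ord_recl /=.
set q2 := \sum_(i < n) _ ^+ 2; set s1 := \sum_(i < n) _.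
set al := a / (a + b).
have -> : \sum_(i < n) (c (lift ord0 i) - c ord0 * al) = s1 - n%:R * (c ord0 * al).
  by rewrite big_split /= sumr_const card_ord mulNrn [n%:R * _]mulr_natl.
have -> : \sum_(i < n) (c (lift ord0 i) - c ord0 * al) ^+ 2 =
    q2 - 2 * (c ord0 * al) * s1 + n%:R * (c ord0 * al) ^+ 2.
  under eq_bigr => i _ do rewrite sqrrB.
  rewrite big_split /= sumr_const card_ord [n%:R * _]mulr_natl; congr (_ + _).
  rewrite big_split /=; congr (_ + _).
  rewrite sumrN mulr_sumr; congr (- _); apply: eq_bigr => i _; rewrite -mulr_natl; ring.
rewrite expr_div_n sqr_sqrtr ?ltW//.
have ab0' : a + b != 0 by rewrite gt_eqF.
have b0' : b != 0 by rewrite gt_eqF.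
have N1 : (n%:R + 1) * a + b != 0 by rewrite natr1 gt_eqF.
have N0 : n%:R * (a * b) + b * (a + b) != 0.
  rewrite (_ : _ + _ = b * (b + (n%:R + 1) * a)); last by ring.
  by rewrite mulf_neq0// addrC.
rewrite -natr1 /al; field.
by rewrite ab0' b0' N0 N1.
Qed.

Lemma pivot_gt0 n (a b : R) : 0 < b -> 0 < n.+1%:R * a + b -> 0 < a + b.
Proof.
move=> b0 nab; have [a0|a0] := leP 0 a; first by rewrite ltr_wpDl.
rewrite (lt_le_trans nab)// lerD2r -natr1 mulrDl mul1r gerDr.
by rewrite mulr_ge0_le0// ltW.
Qed.

Lemma schur_gt0 n (a b : R) : 0 < b -> 0 < n.+1%:R * a + b ->
  0 < n%:R * (a * b / (a + b)) + b.
Proof.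
move=> b0 nab; have ab0 := pivot_gt0 b0 nab.
have -> : n%:R * (a * b / (a + b)) + b = b * (n.+1%:R * a + b) / (a + b).
  by rewrite -natr1; field; rewrite gt_eqF.
by rewrite divr_gt0// mulr_gt0.
Qed.

Lemma gauss_var_ge0 n (a b : R) (c : 'I_n -> R) :
  0 < b -> 0 < n%:R * a + b -> 0 <= gauss_var a b c.
Proof.
elim: n a c => [|n IH] a c b0 nab.
  by rewrite /gauss_var !big_ord0 mul0r expr0n /= subr0 mulr0 addr0 mul0r.
have ab0 := pivot_gt0 b0 nab.
rewrite gauss_varS// addr_ge0 ?sqr_ge0// IH//.
exact: schur_gt0.
Qed.

(** Completing the square in the first variable. *)
Lemma quadS n (a b : R) (x : 'I_n.+1 -> R) : 0 < a + b ->
  quad a b x = (a + b) * (x ord0 + a / (a + b) * \sum_(i < n) x (lift ord0 i)) ^+ 2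
    + quad (a * b / (a + b)) b (fun i => x (lift ord0 i)).
Proof.
move=> ab0; rewrite /quad !big_ord_recl /=; field.
by rewrite gt_eqF.
Qed.

Lemma lebesgue_space0 : lebesgue_space 0.
Proof.
have un (i : 'I_0) : False by case: i.
apply: (@LebesgueSpace 0 _ unit \d_tt (fun _ _ => 0)).
- by move=> i; have := un i.
- move=> g _ _; rewrite !big_ord0.
  by rewrite integral_dirac// diracT mul1e.
- move=> a b c w F b0 nab mF F0.
  rewrite /quad /gauss_var !big_ord0 /gauss_mass !expr0 !mul0r addr0 mul1r.
  rewrite mulr1 invr1 sqrtr1 mul1e expr0n /= subr0 !mulr0 !addr0 !mul0r sqrtr0.
  rewrite oppr0 mul0r expR0 mule1 integral_dirac// diracT mul1e.
  by rewrite -[LHS]gauss_expect_cst//; apply: eq_integral => z _; rewrite mul0r addr0.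
Qed.

Lemma sigma_finite_prod d1 d2 (T1 : measurableType d1) (T2 : measurableType d2)
    (m1 : {sigma_finite_measure set T1 -> \bar R})
    (m2 : {sigma_finite_measure set T2 -> \bar R}) :
  sigma_finite setT (m1 \x m2)%E.
Proof.
have /sigma_finiteP[F [TF ndF Foo]] := sigma_finiteT m1.
have /sigma_finiteP[G [TG ndG Goo]] := sigma_finiteT m2.
exists (fun i => F i `*` G i).
  apply/seteqP; split => // -[x y] _.
  have [i _ Fix] : (\bigcup_i F i) x by rewrite -TF.
  have [j _ Gjy] : (\bigcup_j G j) y by rewrite -TG.
  exists (maxn i j) => //; split => /=.
  - exact: (subsetPset _ _ (ndF _ _ (leq_maxl i j))).
  - exact: (subsetPset _ _ (ndG _ _ (leq_maxr i j))).
move=> i; have [mFi Fi] := Foo i; have [mGi Gi] := Goo i.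
split; first exact: measurableX.
by rewrite /= product_measure1E// lte_mul_pinfty// ge0_fin_numE.
Qed.

(** Given the other coordinates, the first one is normal with mean mut and
variance 1 / (a + b). Integrating it first replaces F by its average G over
this variable, and the integral that remains is the one of the hypothesis on
R^n for the form with parameter a b / (a + b). The two normal variables are
merged by gauss_expect_conv. *)
Lemma lebesgue_spaceS n : lebesgue_space n -> lebesgue_space n.+1.
Proof.
case=> d T mu co mco prodE gaussE.
pose co' (xt : measurableTypeR R * T) (i : 'I_n.+1) : R :=
  oapp (co xt.2) xt.1 (unlift ord0 i).
have co0 xt : co' xt ord0 = xt.1 by rewrite /co' unlift_none.
have coS xt j : co' xt (lift ord0 j) = co xt.2 j by rewrite /co' liftK.
have mco' i : measurable_fun [set: measurableTypeR R * T] (fun xt => co' xt i).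
  rewrite /co'; case: (unlift ord0 i) => [j|] /=; last exact: measurable_fst.
  exact: (measurableT_comp (mco j) measurable_snd).
have mlin (c : 'I_n -> R) : measurable_fun [set: T] (fun t => \sum_i c i * co t i).
  by apply: measurable_sum => i; apply: measurable_funM.
pose M : {sigma_finite_measure set (measurableTypeR R * T)%type -> \bar R} :=
  HB.pack (lam \x mu)%E
    (Measure_isSigmaFinite.Build _ _ _ (lam \x mu)%E (sigma_finite_prod lam mu)).
refine (@LebesgueSpace n.+1 _ _ M co' mco' _ _).
- move=> g g0 mg.
  pose f (xt : measurableTypeR R * T) := (g ord0 xt.1 * \prod_(j < n) g (lift ord0 j) (co xt.2 j))%:E.
  have mprod : measurable_fun [set: T] (fun t => \prod_(j < n) g (lift ord0 j) (co t j)).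
    apply: measurable_prod => j _; exact: (measurableT_comp (mg _) (mco j)).
  transitivity (\int[lam \x mu]_xt f xt)%E.
    apply: eq_integral => xt _; rewrite big_ord_recl co0; congr (_ * _)%:E.
    by apply: eq_bigr => j _; rewrite coS.
  rewrite fubini_tonelli1//=; first last.
  + by move=> xt; rewrite lee_fin mulr_ge0// prodr_ge0.
  + apply/measurable_EFinP; apply: measurable_funM.
      exact: (measurableT_comp (mg _) measurable_fst).
    exact: (measurableT_comp mprod measurable_snd).
  rewrite /fubini_F /f /= big_ord_recl.
  under eq_integral => x _.
    under eq_integral do rewrite EFinM.
    rewrite ge0_integralZl//=; first last.
    + by rewrite lee_fin.
    + by move=> t _; rewrite lee_fin prodr_ge0.
    + exact/measurable_EFinP.
    rewrite (prodE (fun j => g (lift ord0 j)))//.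
    over.
  rewrite ge0_integralZr//=.
  + by apply/measurable_EFinP; exact: mg.
  + by move=> x _; rewrite lee_fin.
  + by apply: prode_ge0 => j _; apply: integral_ge0 => x _; rewrite lee_fin.
- move=> a b c w F b0 nab mF F0.
  have ab0 := pivot_gt0 b0 nab.
  have ab0' : a + b != 0 by rewrite gt_eqF.
  pose al := a / (a + b); pose r := Num.sqrt (a + b).
  have r0 : 0 < r by rewrite sqrtr_gt0.
  pose c' (j : 'I_n) := c (lift ord0 j); pose w' (j : 'I_n) := w (lift ord0 j).
  pose mut t := w ord0 - al * \sum_(j < n) (co t j - w' j).
  pose E t := expR (- quad (a * b / (a + b)) b (fun j => co t j - w' j) / 2).
  pose L t := \sum_(j < n) c' j * co t j.
  pose f (xt : measurableTypeR R * T) : \bar R :=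
    (F (c ord0 * xt.1 + L xt.2)%R * (bell ((xt.1 - mut xt.2) / r^-1) * E xt.2)%:E)%E.
  have mmut : measurable_fun [set: T] mut.
    apply: measurable_funB => //; apply: measurable_funM => //.
    by apply: measurable_sum => j; apply: measurable_funB.
  have mE : measurable_fun [set: T] E.
    apply: measurableT_comp => //; apply: measurable_funM => //.
    apply: measurableT_comp => //; apply: measurable_funD.
      apply: measurable_funM => //; apply: measurable_funX => //.
      by apply: measurable_sum => j; apply: measurable_funB.
    apply: measurable_funM => //; apply: measurable_sum => j.
    by apply: measurable_funX; apply: measurable_funB.
  have mf : measurable_fun setT f.
    apply: emeasurable_funM.
      apply: (measurableT_comp mF); apply: measurable_funD.
        exact: measurable_funM.
      exact: (measurableT_comp (mlin c') measurable_snd).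
    apply/measurable_EFinP; apply: measurable_funM.
      apply: (measurableT_comp (@measurable_bell R)); apply: measurable_funM => //.
      apply: measurable_funB => //; exact: (measurableT_comp mmut measurable_snd).
    exact: (measurableT_comp mE measurable_snd).
  have f0 xt : (0 <= f xt)%E.
    by rewrite mule_ge0// lee_fin mulr_ge0 ?expR_ge0.
  transitivity (\int[lam \x mu]_xt f xt)%E.
    apply: eq_integral => xt _; rewrite /f big_ord_recl co0; congr (F (_ + _)%R * _)%E.
      by apply: eq_bigr => j _; rewrite coS.
    congr EFin; rewrite quadS// /bell /E -expRD; congr expR.
    have -> : ((xt.1 - mut xt.2) / r^-1) ^+ 2 =
        (a + b) * (xt.1 - mut xt.2) ^+ 2.
      by rewrite invrK exprMn sqr_sqrtr ?ltW// mulrC.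
    rewrite co0 /mut.
    under eq_bigr do rewrite coS.
    have -> : quad (a * b / (a + b)) b (fun j => co' xt (lift ord0 j) - w (lift ord0 j))
        = quad (a * b / (a + b)) b (fun j => co xt.2 j - w' j).
      by congr quad; apply/funext => j; rewrite coS.
    rewrite /al /w'; set S := \sum_(i < n) _; field.
    by rewrite ab0'.
  rewrite fubini_tonelli2// /fubini_G /f /=.
  pose K := c ord0 * (w ord0 + al * \sum_j w' j).
  pose c2 j := c' j - c ord0 * al.
  pose G y := gauss_expect (fun z => F (y + c ord0 / r * z)).
  have mG : measurable_fun [set: R] G.
    apply: (@measurable_gauss_expect R _ R (fun yz => F (yz.1 + c ord0 / r * yz.2))).
    - apply: (measurableT_comp mF); apply: measurable_funD => //.
      exact: measurable_funM.
    - by move=> x; exact: F0.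
  have G0 y : (0 <= G y)%E by exact: gauss_expect_ge0.
  have kr : 0 <= r^-1 * Num.sqrt (pi *+ 2) :> R.
    by rewrite mulr_ge0 ?invr_ge0 ?sqrtr_ge0.
  have IH := gaussE (a * b / (a + b)) b c2 w' (fun y => G (K + y)) b0
     (schur_gt0 b0 nab).
  transitivity ((r^-1 * Num.sqrt (pi *+ 2))%:E *
     \int[mu]_t (G (K + \sum_j c2 j * co t j)%R * (E t)%:E))%E.
    rewrite -ge0_integralZl//=; last 2 first.
    + apply: emeasurable_funM.
        apply: (measurableT_comp mG); exact: measurable_funD.
      by apply/measurable_EFinP; exact: mE.
    + by move=> t _; rewrite mule_ge0// lee_fin expR_ge0.
    apply: eq_integral => t _.
    transitivity (\int[lam]_x ((F (c ord0 * x + L t)%R *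
        (bell ((x - mut t) / r^-1))%:E) * (E t)%:E))%E.
      by apply: eq_integral => x _; rewrite EFinM muleA.
    have mFt : measurable_fun [set: R] (fun x => F (c ord0 * x + L t)).
      apply: (measurableT_comp mF); apply: measurable_funD => //.
    rewrite ge0_integralZr//=; last 3 first.
    + apply: emeasurable_funM => //; apply/measurable_EFinP.
      exact: measurable_bell_aff.
    + by move=> x _; rewrite mule_ge0// lee_fin bell_ge0.
    + by rewrite lee_fin expR_ge0.
    rewrite (@integral_bell R (mut t) r^-1 (fun x => F (c ord0 * x + L t)))//;
      last by rewrite invr_gt0.
    rewrite invrK -muleA; congr (_ * (_ * _))%E.
    apply: eq_integral => z _; congr (F _ * _)%E.
    rewrite /K /mut /L /c2.
    under [in RHS]eq_bigr do rewrite mulrBl.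
    rewrite !sumrB -mulr_sumr; field.
    by rewrite gt_eqF.
  rewrite IH; last 2 first.
  + by apply: (measurableT_comp mG); exact: measurable_funD.
  + by move=> x; exact: G0.
  rewrite muleA -EFinM; congr (_%:E * _)%E.
    by rewrite (gauss_massS b0 nab ab0) [r^-1 * _]mulrC.
  transitivity (gauss_expect (fun z1 => gauss_expect (fun z2 =>
     F (\sum_i c i * w i
        + Num.sqrt (gauss_var (a * b / (a + b)) b c2) * z1 + c ord0 / r * z2)%R))).
    apply: eq_integral => z1 _; congr (_ * _)%E.
    apply: eq_integral => z2 _; congr (F (_ + _)%R * _)%E.
    rewrite addrA; congr (_ + _); rewrite big_ord_recl /K /c2.
    have -> : \sum_i (c' i - c ord0 * al) * w' i =
        \sum_i c' i * w' i - c ord0 * al * \sum_i w' i.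
      by rewrite mulr_sumr -sumrB; apply: eq_bigr => j _; rewrite mulrBl.
    by rewrite /c' /w'; ring.
  rewrite gauss_expect_conv//; congr gauss_expect; apply/funext => z; congr (F (_ + _ * _)).
  congr Num.sqrt; rewrite sqr_sqrtr ?(gauss_varS c b0 nab ab0)//.
  by apply: gauss_var_ge0 => //; exact: schur_gt0.
Qed.

Lemma lebesgue_space_exists n : lebesgue_space n.
Proof.
elim: n => [|n]; [exact: lebesgue_space0|exact: lebesgue_spaceS].
Qed.

End gauss_space.

(** * Laws with a density and Borel maps to column vectors *)

Section density.
Context d (T : measurableType d) (R : realType).
Variables (mu : {sigma_finite_measure set T -> \bar R}) (phi : T -> R).
Hypotheses (mphi : measurable_fun setT phi) (phi0 : forall t, 0 <= phi t).
Hypothesis phi1 : (\int[mu]_t (phi t)%:E = 1)%E.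

Definition density (A : set T) : \bar R := (\int[mu]_(t in A) (phi t)%:E)%E.

Let mphiE : measurable_fun setT (EFin \o phi).
Proof. exact/measurable_EFinP. Qed.

Let phi0E t : (0 <= (phi t)%:E)%E. Proof. by rewrite lee_fin. Qed.

Let density0 : density set0 = 0%E.
Proof. by rewrite /density integral_set0. Qed.

Let density_ge0 A : (0 <= density A)%E.
Proof. by apply: integral_ge0 => t _; exact: phi0E. Qed.

Let density_sigma_additive : semi_sigma_additive density.
Proof.
move=> A mA tA mUA; rewrite /density ge0_integral_bigcup//; last first.
  exact: (measurable_funS measurableT).
by apply: is_cvg_ereal_nneg_natsum_cond => n _ _; exact: density_ge0.
Qed.

HB.instance Definition _ :=
  isMeasure.Build _ _ _ density density0 density_ge0 density_sigma_additive.

Let densityT : density setT = 1%E. Proof. exact: phi1. Qed.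

HB.instance Definition _ := @Measure_isProbability.Build _ _ R density densityT.

Let density_dominated : (density : {measure set T -> \bar R}) `<< mu.
Proof.
apply/null_content_dominatesP => A mA A0.
by apply: null_set_integral => //; exact: (measurable_funS measurableT).
Qed.

(** The measure with density phi is dominated by mu, and its Radon-Nikodym
derivative has the same integrals as phi over all measurable sets, hence is
phi almost everywhere. *)
Lemma density_probability : exists P : probability T R,
  forall f : T -> \bar R, measurable_fun setT f -> (forall t, 0 <= f t)%E ->
  (\int[P]_t f t = \int[mu]_t (f t * (phi t)%:E))%E.
Proof.
exists (density : probability T R) => f mf f0.
rewrite -(@Radon_Nikodym_SigmaFinite.change_of_variables _ T R
  (density : {finite_measure set T -> \bar R}) mu density_dominated)//.
set g := Radon_Nikodym_SigmaFinite.f _ _.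
have ig : mu.-integrable setT g.
  exact: Radon_Nikodym_SigmaFinite.f_integrable.
apply: ge0_ae_eq_integral => //.
- by apply: emeasurable_funM => //; exact: measurable_int ig.
- exact: emeasurable_funM.
- move=> t _; rewrite mule_ge0//.
  exact: Radon_Nikodym_SigmaFinite.f_ge0.
- by move=> t _; rewrite mule_ge0.
have : ae_eq mu setT g (EFin \o phi).
  apply: integral_ae_eq => // A _ mA.
  by rewrite -(Radon_Nikodym_SigmaFinite.f_integral density_dominated mA).
by apply: filterS => t /[apply] /= ->.
Qed.

End density.

Section borel_vectors.
Variables (R : realType) (q : nat).

(** An open set is the union of the boxes with rational centre and radius
1 / (k + 1) that it contains, and there are countably many of these. *)
Lemma measurable_vector d (T : measurableType d) (Y : T -> 'cV[R]_q) :
  (forall r, measurable_fun setT (fun t => Y t r ord0)) ->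
  measurable_fun setT (Y : T -> borelV R q).
Proof.
move=> mY; apply: measurability; first by [].
move=> _ [U oU <-]; rewrite setTI.
pose box (cn : 'cV[rat]_q * nat) : set 'cV[R]_q :=
  [set x | forall r, `|x r ord0 - ratr (cn.1 r ord0)| < cn.2.+1%:R^-1].
pose F cn := Y @^-1` (box cn `&` [set _ | box cn `<=` U]).
have -> : Y @^-1` U = \bigcup_cn F cn.
  apply/seteqP; split => t /=; last by move=> [cn _ [Yt cnU]]; exact: cnU.
  move=> Ut.
  have : nbhs (Y t) U by exact: open_nbhs_nbhs.
  move=> /nbhs_ballP[e /= e0 eU].
  have [n ne] : exists n, n.+1%:R^-1 < e / 2 :> R.
    have e20 : 0 < e / 2 by rewrite divr_gt0.
    have [n _ Hn] := near_infty_natSinv_lt (PosNum e20).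
    by exists n; exact: (Hn n (leqnn n)).
  have cE (r : 'I_q) : exists c : rat, `|Y t r ord0 - ratr c| < n.+1%:R^-1.
    have [|c] := @rat_in_itvoo R (Y t r ord0 - n.+1%:R^-1) (Y t r ord0 + n.+1%:R^-1).
      by rewrite ltrD2l gtrN// invr_gt0.
    rewrite in_itv /= => /andP[c1 c2]; exists c.
    by rewrite ltr_distlC c1 c2.
  have [c cP] := choice cE.
  exists (\col_r c r, n) => //; split.
    by move=> r; rewrite /= mxE.
  move=> x xbox; apply: eU; split => // r k; rewrite ord1 /ball /=.
  have := xbox r; rewrite /= mxE => xr.
  have -> : Y t r ord0 - x r ord0 = (Y t r ord0 - ratr (c r)) - (x r ord0 - ratr (c r)).
    by ring.
  apply: le_lt_trans (ler_normB _ _) _.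
  rewrite [X in _ < X](splitr e); apply: ltrD; apply: lt_trans ne => //.
apply: countable_bigcupT_measurable; first exact: countableP.
move=> cn; rewrite /F preimage_setI; apply: measurableI; last first.
  have [bU|bU] := pselect (box cn `<=` U).
    rewrite (_ : _ @^-1` _ = setT); first exact: measurableT.
    by apply/seteqP; split.
  rewrite (_ : _ @^-1` _ = set0); first exact: measurable0.
  by apply/seteqP; split.
have -> : Y @^-1` box cn = \bigcap_(r in setT)
   (fun t => `|Y t r ord0 - ratr (cn.1 r ord0)|) @^-1` `]-oo, cn.2.+1%:R^-1[.
  apply/seteqP; split => t /= H.
    by move=> r _ /=; rewrite in_itv /=; exact: H.
  by move=> r; have := H r I; rewrite /= in_itv.
apply: fin_bigcap_measurable => // r _.
rewrite -[X in measurable X]setTI.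
suff: measurable_fun setT (fun t => `|Y t r ord0 - ratr (cn.1 r ord0)|) by exact.
by apply: measurableT_comp => //; exact: measurable_funB.
Qed.

Lemma measurable_continuous (g : 'cV[R]_q -> R) : continuous g ->
  measurable_fun setT (g : borelV R q -> R).
Proof.
move=> cg; apply: (measurability _ (RGenOpens.measurableE R)).
move=> _ [_ [x [y ->]] <-]; rewrite setTI; apply: sub_sigma_algebra.
by apply: open_comp; [move=> v _; exact: cg|exact: interval_open].
Qed.

End borel_vectors.

(** * Configurations with prescribed colour counts *)

Section counting.
Variable q : nat.
Local Open Scope nat_scope.

Definition count N (X : config q N) (r : 'I_q) : nat := \sum_(i < N) (X i == r).

Lemma countE N (X : config q N) r : count X r = #|[pred i | X i == r]|.
Proof.
rewrite /count -sum1_card [RHS]big_mkcond /=; apply: eq_bigr => i _.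
by rewrite inE; case: (X i == r).
Qed.

Lemma count_sum N (X : config q N) : \sum_r count X r = N.
Proof.
rewrite /count exchange_big /= -[RHS]card_ord -sum1_card; apply: eq_bigr => i _.
rewrite (bigD1 (X i)) //= eqxx big1 // => r rX.
by rewrite eq_sym (negbTE rX).
Qed.

Definition num_config N (k : 'I_q -> nat) : nat :=
  \sum_(X : config q N) [forall r, count X r == k r].

Definition cons_config N (rX : 'I_q * config q N) : config q N.+1 :=
  [ffun i => if unlift ord0 i is Some j then rX.2 j else rX.1].

Lemma cons_config_bij N : bijective (@cons_config N).
Proof.
exists (fun Y : config q N.+1 => (Y ord0, [ffun j => Y (lift ord0 j)])).
  move=> [r X]; rewrite /cons_config /= ffunE unlift_none; congr (_, _).
  by apply/ffunP => j; rewrite !ffunE liftK.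
move=> Y; apply/ffunP => i; rewrite /cons_config ffunE /=.
by case: unliftP => [j ->|->]; rewrite ?ffunE.
Qed.

Lemma count_cons N (rX : 'I_q * config q N) s :
  count (cons_config rX) s = (rX.1 == s) + count rX.2 s.
Proof.
rewrite /count big_ord_recl /cons_config ffunE unlift_none; congr addn.
by apply: eq_bigr => j _; rewrite ffunE liftK.
Qed.

Lemma num_configS N k : num_config N.+1 k =
  \sum_(r | 0 < k r) num_config N (fun s => k s - (r == s)).
Proof.
rewrite /num_config (reindex (@cons_config N)); last first.
  exact: onW_bij (cons_config_bij N).
rewrite -(pair_big xpredT xpredT
  (fun r X => nat_of_bool [forall s, count (cons_config (r, X)) s == k s])) /=.
rewrite [RHS]big_mkcond /=; apply: eq_bigr => r _.
have [k0|k0] := ltnP 0 (k r); last first.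
  rewrite big1 // => X _; apply/eqP; rewrite eqb0; apply/forallPn; exists r.
  rewrite count_cons eqxx /=; apply/eqP => E.
  by move: k0; rewrite -E.
apply: eq_bigr => X _; congr nat_of_bool; apply: eq_forallb => s.
rewrite count_cons /=; have [<-|rs] := eqVneq r s; last by rewrite add0n subn0.
by rewrite add1n subn1; apply/eqP/eqP => [<-//|->]; rewrite prednK.
Qed.

(** Induction on N, according to the colour of the first site. *)
Lemma multinomial_count N k : \sum_r k r = N ->
  num_config N k * \prod_r (k r)`! = N`!.
Proof.
elim: N k => [|N IH] k kN.
  have k0 r : k r = 0.
    by apply/eqP; rewrite -leqn0 -kN (bigD1 r) //= leq_addr.
  rewrite big1 => [|r _]; last by rewrite k0.
  rewrite muln1 /num_config (eq_bigr (fun=> 1)) => [|X _].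
    by rewrite sum1_card card_ffun !card_ord expn0 fact0.
  apply/eqP; rewrite eqb1; apply/forallP => r.
  by rewrite k0 /count big_ord0.
rewrite num_configS big_distrl /=.
transitivity (\sum_(r | 0 < k r) k r * N`!).
  apply: eq_bigr => r kr.
  have sumk : \sum_s (k s - (r == s)) = N.
    apply/eqP; rewrite -eqSS -kN -addn1 [X in X + 1](bigD1 r) //= [X in _ == X](bigD1 r) //=.
    rewrite eqxx addnAC subnK //; apply/eqP; congr addn.
    by apply: eq_bigr => s; rewrite eq_sym => /negbTE ->; rewrite subn0.
  rewrite -(IH _ sumk) mulnCA; congr muln.
  rewrite (bigD1 r) //= [in RHS](bigD1 r) //= eqxx subn1 mulnA; congr muln.
    by rewrite -{1}(prednK kr) factS prednK.
  by apply: eq_bigr => s; rewrite eq_sym => /negbTE ->; rewrite subn0.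
rewrite -big_distrl /= factS; congr muln.
rewrite -kN big_mkcond /=; apply: eq_bigr => r _.
by case: (k r).
Qed.

(** The multinomial identity has a nonzero right-hand side. *)
Lemma count_surj N k : \sum_r k r = N -> exists X : config q N, forall r, count X r = k r.
Proof.
move=> kN; have := multinomial_count kN.
have [/existsP[X /forallP XP] _|] :=
  boolP [exists X : config q N, [forall r, count X r == k r]].
  by exists X => r; apply/eqP.
rewrite negb_exists => /forallP nX.
rewrite /num_config big1 => [|X _]; last by apply/eqP; rewrite eqb0.
by rewrite mul0n => /esym/eqP; rewrite -leqn0 leqNgt fact_gt0.
Qed.

End counting.

(** * Derivatives on the line and Stirling's formula *)

Section stirling.
Variable R : realType.

Section real_derivatives.
Implicit Types (f g : R -> R) (x a b : R).

(** In the following rules the value of the derivative is produced by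
unification; drv_eq compares it with the intended one afterwards. *)
Lemma drv_eq f x a b : is_derive x 1 f a -> a = b -> is_derive x 1 f b.
Proof. by move=> + <-. Qed.

Lemma drv_cst (c : R) x : is_derive x 1 (fun=> c) 0.
Proof. exact: is_derive_cst. Qed.

Lemma drv_id x : is_derive x 1 (fun y : R => y) 1.
Proof. exact: is_derive_id. Qed.

Lemma drv_add f g x a b : is_derive x 1 f a -> is_derive x 1 g b ->
  is_derive x 1 (fun y => f y + g y) (a + b).
Proof. by move=> fa gb; exact: is_deriveD. Qed.

Lemma drv_sub f g x a b : is_derive x 1 f a -> is_derive x 1 g b ->
  is_derive x 1 (fun y => f y - g y) (a - b).
Proof. by move=> fa gb; exact: is_deriveB. Qed.

Lemma drv_mul f g x a b : is_derive x 1 f a -> is_derive x 1 g b ->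
  is_derive x 1 (fun y => f y * g y) (a * g x + f x * b).
Proof.
move=> fa gb; apply: (drv_eq (is_deriveM fa gb)).
by rewrite /GRing.scale /= addrC [g x * a]mulrC.
Qed.

Lemma drv_scale (c : R) f x a : is_derive x 1 f a ->
  is_derive x 1 (fun y => c * f y) (c * a).
Proof.
by move=> fa; apply: (drv_eq (drv_mul (drv_cst c x) fa)); rewrite mul0r add0r.
Qed.

Lemma drv_exp f x a n : is_derive x 1 f a ->
  is_derive x 1 (fun y => f y ^+ n) (n%:R * f x ^+ n.-1 * a).
Proof.
move=> fa; elim: n => [|n IH].
  by apply: (drv_eq (drv_cst 1 x)); rewrite !mul0r.
have -> : (fun y => f y ^+ n.+1) = (fun y => f y * f y ^+ n).
  by apply/funext => y; rewrite exprS.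
apply: (drv_eq (drv_mul fa IH)); case: n {IH} => [|n].
  by rewrite /= !expr0 !mul0r mulr0 addr0 !mulr1 !mul1r.
by rewrite /= -[n.+2%:R]natr1 exprS; ring.
Qed.

Lemma drv_inv f x a : is_derive x 1 f a -> f x != 0 ->
  is_derive x 1 (fun y => (f y)^-1) (- a / f x ^+ 2).
Proof.
move=> fa fx0; apply: (drv_eq (is_deriveV fx0 fa)).
by rewrite /GRing.scale /= !mulNr mulrC.
Qed.

Lemma drv_comp f g x a b : is_derive (g x) 1 f a -> is_derive x 1 g b ->
  is_derive x 1 (fun y => f (g y)) (a * b).
Proof. by move=> fa gb; exact: is_derive1_comp. Qed.

Lemma drv_ln x : 0 < x -> is_derive x 1 (@ln R) x^-1.
Proof. by move=> x0; exact: is_derive1_ln. Qed.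

End real_derivatives.

Lemma mean_value (f df : R -> R) (a b : R) : a <= b ->
  (forall x, a <= x <= b -> is_derive x 1 f (df x)) ->
  exists2 c, a <= c <= b & f b - f a = df c * (b - a).
Proof.
move=> ab fd.
have [||c cab E] := @MVT_segment R f df a b ab.
- by move=> x; rewrite in_itv /= => /andP[ax xb]; apply: fd; rewrite !ltW.
- apply: derivable_within_continuous => x; rewrite in_itv /= => xab.
  by have [] := fd x xab.
- by exists c => //; move: cab; rewrite in_itv.
Qed.

Lemma le_of_derive (f df : R -> R) (a b : R) : a <= b ->
  (forall x, a <= x <= b -> is_derive x 1 f (df x)) ->
  (forall x, a <= x <= b -> 0 <= df x) -> f a <= f b.
Proof.
move=> ab fd df0; have [c cab E] := mean_value ab fd.
by rewrite -subr_ge0 E mulr_ge0 ?df0// subr_ge0.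
Qed.

Lemma drv_ln1D (x : R) : 0 < 1 + x ->
  is_derive x 1 (fun y => ln (1 + y)) (1 + x)^-1.
Proof.
move=> x1; apply: drv_eq (drv_comp (drv_ln x1) (drv_add (drv_cst 1 x) (drv_id x))) _.
by rewrite add0r mulr1.
Qed.

(** The two sides agree at 0, and their difference has the derivative
t^2 / ((1 + t) (2 + t)^2). *)
Lemma ln1D_ge (t : R) : 0 <= t -> 2 * t / (2 + t) <= ln (1 + t).
Proof.
move=> t0.
pose f x : R := ln (1 + x) - 2 * x / (2 + x).
pose df x : R := x ^+ 2 / ((1 + x) * (2 + x) ^+ 2).
have f0 : f 0 = 0 by rewrite /f !addr0 ln1 mulr0 mul0r subr0.
suff : f 0 <= f t by rewrite f0 subr_ge0.
apply: (@le_of_derive f df) => // x /andP[x0 xt]; last first.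
  by rewrite divr_ge0 ?sqr_ge0// mulr_ge0 ?sqr_ge0// addr_ge0.
have x1 : 0 < 1 + x by rewrite ltr_pwDl.
have x2 : 2 + x != 0 by rewrite gt_eqF// ltr_pwDl.
apply: drv_eq (drv_sub (drv_ln1D x1) (drv_mul (drv_scale 2 (drv_id x))
  (drv_inv (drv_add (drv_cst 2 x) (drv_id x)) x2))) _.
by rewrite /df; field; rewrite x2 gt_eqF.
Qed.

(** The two sides agree at 0, and their difference has the derivative
t^2 / (2 (1 + t)^2). *)
Lemma ln1D_le (t : R) : 0 <= t -> ln (1 + t) <= t * (2 + t) / (2 * (1 + t)).
Proof.
move=> t0.
pose f x : R := (x * (2 + x)) / (2 * (1 + x)) - ln (1 + x).
pose df x : R := x ^+ 2 / (2 * (1 + x) ^+ 2).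
have f0 : f 0 = 0 by rewrite /f !addr0 ln1 subr0 !mul0r.
suff : f 0 <= f t by rewrite f0 subr_ge0.
apply: (@le_of_derive f df) => // x /andP[x0 xt]; last first.
  by rewrite divr_ge0 ?sqr_ge0// mulr_ge0 ?sqr_ge0.
have x1 : 0 < 1 + x by rewrite ltr_pwDl.
have x2 : 2 * (1 + x) != 0 by rewrite mulf_neq0// gt_eqF.
apply: drv_eq (drv_sub (drv_mul
  (drv_mul (drv_id x) (drv_add (drv_cst 2 x) (drv_id x)))
  (drv_inv (drv_scale 2 (drv_add (drv_cst 1 x) (drv_id x))) x2))
  (drv_ln1D x1)) _.
by rewrite /df; field; rewrite gt_eqF.
Qed.

(** The logarithm of n! / (sqrt n (n / e)^n). *)
Definition stirling n : R :=
  ln (n`!)%:R - (n%:R + 2^-1) * ln n%:R + n%:R.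

Lemma factE n : (0 < n)%N ->
  n`!%:R = expR (stirling n + (n%:R + 2^-1) * ln n%:R - n%:R) :> R.
Proof.
move=> n0; rewrite /stirling.
rewrite (_ : _ - n%:R = ln (n`!)%:R); last by ring.
by rewrite lnK// posrE ltr0n fact_gt0.
Qed.

Lemma stirling_step n : (0 < n)%N ->
  stirling n - stirling n.+1 = (n%:R + 2^-1) * ln (1 + n%:R^-1) - 1.
Proof.
move=> n0; rewrite /stirling factS natrM lnM ?posrE ?ltr0n ?fact_gt0//.
have -> : 1 + n%:R^-1 = n.+1%:R / n%:R :> R.
  by rewrite -natr1 mulrDl mul1r divff// pnatr_eq0 -lt0n.
rewrite ln_div ?posrE ?ltr0n// -natr1; ring.
Qed.

Lemma stirling_decr n : (0 < n)%N -> stirling n.+1 <= stirling n.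
Proof.
move=> n0; rewrite -subr_ge0 stirling_step// subr_ge0.
have n0' : 0 < n%:R :> R by rewrite ltr0n.
have := @ln1D_ge n%:R^-1; rewrite invr_ge0 ler0n => /(_ isT).
have -> : 2 * n%:R^-1 / (2 + n%:R^-1) = (n%:R + 2^-1)^-1 :> R.
  by field; rewrite !gt_eqF//= ?addr_gt0 ?mulr_gt0.
by rewrite -div1r ler_pdivrMr ?addr_gt0 ?invr_gt0// mulrC.
Qed.

(** The decrements are bounded by those of 1 / (4 n), which keeps the
decreasing sequence stirling bounded below. *)
Lemma stirling_gap n : (0 < n)%N ->
  stirling n - stirling n.+1 <= 4^-1 * (n%:R^-1 - n.+1%:R^-1).
Proof.
move=> n0; rewrite stirling_step//.
have n0' : 0 < n%:R :> R by rewrite ltr0n.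
have := @ln1D_le n%:R^-1; rewrite invr_ge0 ler0n => /(_ isT) H.
have : (n%:R + 2^-1) * ln (1 + n%:R^-1) <=
   (n%:R + 2^-1) * (n%:R^-1 * (2 + n%:R^-1) / (2 * (1 + n%:R^-1))) :> R.
  by rewrite ler_pM2l// addr_gt0// invr_gt0.
move=> {}H; apply: le_trans (lerB H (lexx 1)) _.
rewrite le_eqVlt; apply/orP; left; apply/eqP; rewrite -natr1; field.
by rewrite !gt_eqF//= ?addr_gt0.
Qed.

Lemma stirling1 : stirling 1 = 1.
Proof. by rewrite /stirling !ln1 mulr0 subr0 add0r. Qed.

Lemma stirling_bounds n : (0 < n)%N -> 0 <= stirling n <= 1.
Proof.
move=> n0.
(* Subtracting 1 / (4 n) makes the lower bound inductive; 3 / 4 is its value at 1. *)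
suff : 3 / 4 <= stirling n - 4^-1 * n%:R^-1 /\ stirling n <= 1.
  move=> [H1 ->]; rewrite andbT.
  have : 0 <= 4^-1 * n%:R^-1 :> R by rewrite mulr_ge0// invr_ge0.
  lra.
case: n n0 => // n _; elim: n => [|n [IH1 IH2]].
  by rewrite stirling1; split => //; lra.
have A := stirling_gap (ltn0Sn n); have B := stirling_decr (ltn0Sn n).
set x := n.+1%:R^-1 in A IH1; set y := n.+2%:R^-1 in A *.
by split; lra.
Qed.

(** The limit enters all weights through the same factor, which disappears
in the quotients. *)
Lemma stirling_cvg : exists l : R, stirling n @[n --> \oo] --> l.
Proof.
have : cvgn (fun n => stirling n.+1).
  apply: nonincreasing_is_cvgn.
    by apply/nonincreasing_seqP => n; exact: stirling_decr.
  by exists 0 => _ [n _ <-]; have /andP[] := stirling_bounds (ltn0Sn n).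
move=> /cvg_ex[l lP]; exists l.
by rewrite -cvg_shiftS.
Qed.

End stirling.

(** * Type classes of configurations *)

Section type_classes.
Variables (R : realType) (q N : nat).
Hypothesis N0 : (0 < N)%N.
Implicit Types X Y : config q N.

Let NR0 : 0 < N%:R :> R. Proof. by rewrite ltr0n. Qed.
Let NRn0 : N%:R != 0 :> R. Proof. by rewrite gt_eqF. Qed.

(** The negative of Shannon's entropy. Its opposite is the part of the energy
that counts configurations. *)
Definition neg_entropy n (t : 'cV[R]_n) : R := \sum_r t r ord0 * ln (t r ord0).

Lemma xbarE X r : xbar R X r ord0 = (count X r)%:R / N%:R.
Proof. by rewrite mxE countE. Qed.

Lemma xbar_count X r : (count X r)%:R = N%:R * xbar R X r ord0 :> R.
Proof. by rewrite xbarE mulrC divfK. Qed.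

Lemma xbar_simplex X : simplex (xbar R X).
Proof.
split=> [r|]; first by rewrite xbarE divr_ge0.
under eq_bigr do rewrite xbarE.
by rewrite -mulr_suml -natr_sum count_sum divff.
Qed.

Lemma xbar_eqP X Y : reflect (forall r, count Y r = count X r) (xbar R Y == xbar R X).
Proof.
apply: (iffP eqP) => [E r|E].
  have : xbar R Y r ord0 = xbar R X r ord0 by rewrite E.
  rewrite !xbarE => /(mulIf _) H; apply/eqP; rewrite -(eqr_nat R); apply/eqP.
  by apply: H; rewrite invr_eq0.
by apply/colP => r; rewrite !xbarE E.
Qed.

Definition type_size X : R := #|[pred Y : config q N | xbar R Y == xbar R X]|%:R.

Lemma type_size_num_config X : type_size X = (num_config N (count X))%:R.
Proof.
congr _%:R; rewrite /num_config -sum1_card [LHS]big_mkcond /=; apply: eq_bigr => Y _.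
rewrite inE; have -> : [forall r, count Y r == count X r] = (xbar R Y == xbar R X).
  by apply/forallP/xbar_eqP => H r; apply/eqP.
by case: (_ == _).
Qed.

(** Stirling's formula for the factorials of the multinomial coefficient. *)
Lemma type_sizeE X : (forall r, 0 < count X r)%N ->
  type_size X = expR (stirling R N - \sum_r stirling R (count X r)
    - N%:R * neg_entropy (xbar R X) - 2^-1 * \sum_r ln (xbar R X r ord0)
    - (q%:R - 1) / 2 * ln N%:R).
Proof.
move=> c0.
have := multinomial_count (count_sum X).
move=> /(congr1 (fun n : nat => n%:R : R)).
rewrite natrM -type_size_num_config natr_prod (factE R N0).
under eq_bigr do rewrite (factE R (c0 _)).
rewrite -expR_sum => E.
have -> : type_size X = expR (stirling R N + (N%:R + 2^-1) * ln N%:R - N%:R) /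
    expR (\sum_r (stirling R (count X r)
       + ((count X r)%:R + 2^-1) * ln (count X r)%:R - (count X r)%:R)).
  by rewrite -E mulfK// gt_eqF// expR_gt0.
rewrite -expRN -expRD; congr expR.
have lnc r : ln (count X r)%:R = ln N%:R + ln (xbar R X r ord0) :> R.
  rewrite xbar_count lnM// posrE// xbarE divr_gt0// ltr0n//.
have -> : \sum_r (stirling R (count X r)
       + ((count X r)%:R + 2^-1) * ln (count X r)%:R - (count X r)%:R) =
   \sum_r stirling R (count X r) + (N%:R * neg_entropy (xbar R X)
     + 2^-1 * \sum_r ln (xbar R X r ord0) + (N%:R + q%:R / 2) * ln N%:R) - N%:R.
  rewrite big_split /= big_split /=; congr (_ + _ + _); last first.
    by rewrite sumrN -natr_sum count_sum.
  have -> : (N%:R + q%:R / 2) * ln N%:R =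
      \sum_r ((count X r)%:R + 2^-1) * ln N%:R :> R.
    rewrite -mulr_suml big_split /= -natr_sum count_sum sumr_const card_ord.
    by rewrite -[_ *+ q]mulr_natl; ring.
  rewrite /neg_entropy !mulr_sumr -!big_split /=; apply: eq_bigr => r _.
  by rewrite lnc xbar_count; ring.
by field.
Qed.

(** When the sites are independent with law t = xbar X, each configuration of
composition t has probability exp (N neg_entropy t); these probabilities add
up to at most 1. *)
Lemma type_size_le X : type_size X <= expR (- N%:R * neg_entropy (xbar R X)).
Proof.
pose t := xbar R X.
have t0 r : 0 <= t r ord0 by have [] := xbar_simplex X.
have : (\sum_r t r ord0) ^+ N = \sum_(Y : config q N) \prod_i t (Y i) ord0.
  rewrite -(bigA_distr_bigA (fun=> fun r => t r ord0)) prodr_const card_ord //.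
have [_ ->] := xbar_simplex X; rewrite expr1n.
have prodE Y : xbar R Y == xbar R X ->
    \prod_i t (Y i) ord0 = expR (N%:R * neg_entropy t).
  move=> /xbar_eqP cE.
  have -> : \prod_i t (Y i) ord0 = \prod_r t r ord0 ^+ count X r.
    rewrite (partition_big Y xpredT) //=; apply: eq_bigr => r _.
    rewrite -cE countE -prodr_const; apply: eq_bigr => i.
    by move=> /eqP ->.
  rewrite /neg_entropy mulr_sumr expR_sum; apply: eq_bigr => r _.
  rewrite mulrA -xbar_count.
  have [c0|c0] := posnP (count X r); first by rewrite c0 expr0 mul0r expR0.
  have tr0 : 0 < t r ord0 by rewrite /t xbarE divr_gt0// ltr0n.
  by rewrite -[X in X ^+ _](lnK tr0) -expRM_natl.
move=> E; have : type_size X * expR (N%:R * neg_entropy t) <= 1.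
  rewrite [leRHS]E (bigID (fun Y => xbar R Y == xbar R X)) /= (eq_bigr _ prodE).
  rewrite sumr_const /type_size mulr_natl lerDl sumr_ge0// => Y _.
  by rewrite prodr_ge0.
by rewrite -ler_pdivlMr ?expR_gt0// div1r -expRN mulNr.
Qed.

(** A composition is given by q counts between 0 and N, so there are at most
(N + 1)^q of them. *)
Lemma sum_types_le (P : pred 'cV[R]_q) (G : 'cV[R]_q -> R) (b : R) :
  (forall t, 0 <= G t) -> 0 <= b ->
  (forall X, P (xbar R X) -> expR (- N%:R * neg_entropy (xbar R X)) * G (xbar R X) <= b) ->
  \sum_(X : config q N | P (xbar R X)) G (xbar R X) <= N.+1%:R ^+ q * b.
Proof.
move=> G0 b0 Gb.
pose c X : {ffun 'I_q -> 'I_N.+1} := [ffun r => inord (count X r)].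
have cE X Y : c Y = c X -> xbar R Y == xbar R X.
  move=> E; apply/xbar_eqP => r.
  have cN (Z : config q N) : (count Z r < N.+1)%N.
    rewrite ltnS.
    apply: leq_trans (eq_leq (count_sum Z)).
    by rewrite (bigD1 r) //= leq_addr.
  have : c Y r = c X r by rewrite E.
  by rewrite !ffunE => /(congr1 (@nat_of_ord _)); rewrite !inordK.
rewrite (partition_big c xpredT) //=.
apply: (@le_trans _ _ (\sum_(k : {ffun 'I_q -> 'I_N.+1}) b)); last first.
  by rewrite sumr_const card_ffun !card_ord -natrX mulr_natl.
apply: ler_sum => k _.
have [/existsP[X /andP[PX /eqP cX]]|] := boolP [exists X, P (xbar R X) && (c X == k)]; last first.
  rewrite negb_exists => /forallP nX; rewrite big_pred0// => X.
  exact: negbTE.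
apply: le_trans (Gb X PX).
apply: (@le_trans _ _ (type_size X * G (xbar R X))); last by rewrite ler_wpM2r// type_size_le.
rewrite /type_size mulr_natl -sumr_const.
rewrite (eq_bigr (fun=> G (xbar R X))); last first.
  by move=> Y /andP[_ /eqP cY]; rewrite (eqP (@cE X Y _))// cY cX.
rewrite [leLHS]big_mkcond [leRHS]big_mkcond /=; apply: ler_sum => Y _.
case: ifPn => [/andP[_ /eqP cY]|_]; last by case: ifP.
by rewrite inE cE// cY cX.
Qed.

End type_classes.

(** * Second order expansion of the energy *)

Section taylor2.
Variable R : realType.

(** A second derivative at the single point x suffices: differentiability of
f1 at x makes the derivative g1 of the remainder small compared with v, and
the mean value theorem passes this on to the remainder. *)
Lemma taylor2_peano (f f1 : R -> R) (x f2 : R) :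
  (\forall y \near x, is_derive (y : R) 1 f (f1 y)) -> is_derive x 1 f1 f2 ->
  forall e, 0 < e -> exists2 d, 0 < d & forall u, `|u| <= d ->
    `|f (x + u) - f x - f1 x * u - f2 / 2 * u ^+ 2| <= e * u ^+ 2.
Proof.
move=> df df1 e e0.
have /cvg_ballP/(_ _ e0) near1 : h^-1 *: (f1 (h *: 1 + x) - f1 x) @[h --> 0^'] --> f2.
  by have [d1 <-] := df1; exact: d1.
have [d1 /= d10 d1P] := near1.
have [d2 /= d20 d2P] := df.
pose d := Num.min (d1 / 2) (d2 / 2).
have d0 : 0 < d by rewrite lt_min !divr_gt0.
exists d => // u ud.
pose g v := f (x + v) - f1 x * v - f2 / 2 * v ^+ 2.
pose g1 v := f1 (x + v) - f1 x - f2 * v.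
have g1_le v : `|v| <= d -> `|g1 v| <= e * `|v|.
  move=> vd; have [->|v0] := eqVneq v 0.
    by rewrite /g1 addr0 subrr mulr0 subr0 normr0 mulr0.
  have /d1P/(_ v0) : ball 0 d1 v.
    rewrite /ball /= sub0r normrN (le_lt_trans vd)// gt_min.
    by rewrite ltr_pdivrMr// ltr_pMr// ltr1n.
  rewrite /ball /= => /ltW; rewrite /GRing.scale /= mulr1 => H.
  rewrite -ler_pdivrMr ?normr_gt0// -normf_div.
  rewrite (_ : g1 v / v = - (f2 - v^-1 * (f1 (v + x) - f1 x))) ?normrN//.
  by rewrite /g1 [v + x]addrC; field.
have dg (v : R) : `|v| <= d -> is_derive v 1 g (g1 v).
  move=> vd.
  have /d2P fv : ball x d2 (x + v).
    rewrite /ball /= opprD addNKr normrN (le_lt_trans vd)// gt_min orbC.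
    by rewrite ltr_pdivrMr// ltr_pMr// ltr1n.
  apply: drv_eq (drv_sub (drv_sub (drv_comp fv (drv_add (drv_cst x v) (drv_id v)))
    (drv_scale (f1 x) (drv_id v))) (drv_scale (f2 / 2) (drv_exp 2 (drv_id v)))) _.
  by rewrite /g1 /= expr1; field.
have -> : f (x + u) - f x - f1 x * u - f2 / 2 * u ^+ 2 = g u - g 0.
  by rewrite /g addr0; ring.
have [c cu ->] : exists2 c, `|c| <= `|u| & g u - g 0 = g1 c * u.
  have [u0|u0] := leP 0 u.
    have [y|c /andP[c0 cu] E] := @mean_value R g g1 0 u u0.
      move=> /andP[y0 yu]; apply: dg; rewrite ger0_norm//.
      by rewrite (le_trans yu)// (le_trans (ler_norm _)).
    by exists c; rewrite ?E ?subr0// !ger0_norm.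
  have [y|c /andP[uc c0] E] := @mean_value R g g1 u 0 (ltW u0).
    move=> /andP[uy y0]; apply: dg; rewrite ler0_norm//.
    by rewrite (le_trans _ ud)// ltr0_norm// lerN2.
  exists c; first by rewrite ler0_norm// ltr0_norm// lerN2.
  by rewrite -opprB E sub0r mulrN opprK.
rewrite normrM -[u ^+ 2]real_normK ?num_real// expr2 mulrA ler_wpM2r//.
by rewrite (le_trans (g1_le _ (le_trans cu ud)))// ler_wpM2l// ltW.
Qed.

Variables (p : nat) (beta : R).
Hypothesis p2 : (2 <= p)%N.

Definition kfun1 (x : R) : R := beta * p%:R * x ^+ (p - 1) - ln x - 1.
Definition kfun2 (x : R) : R := beta * p%:R * (p%:R - 1) * x ^+ (p - 2) - 1 / x.

Lemma drv_kfun (x : R) : 0 < x -> is_derive x 1 (kfun p beta) (kfun1 x).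
Proof.
move=> x0; apply: drv_eq (drv_sub (drv_scale beta (drv_exp p (drv_id x)))
  (drv_mul (drv_id x) (drv_ln x0))) _.
by rewrite /kfun1 subn1; field; rewrite gt_eqF.
Qed.

Lemma drv_kfun1 (x : R) : 0 < x -> is_derive x 1 kfun1 (kfun2 x).
Proof.
move=> x0; apply: drv_eq (drv_sub (drv_sub (drv_scale (beta * p%:R)
  (drv_exp (p - 1) (drv_id x))) (drv_ln x0)) (drv_cst 1 x)) _.
rewrite /kfun2 subr0 -subn1 -subnDA div1r mulr1; congr (_ - _).
by rewrite natrB ?(ltnW p2)// !mulrA.
Qed.

Lemma derive1_near (f g : R -> R) (x : R) :
  (\forall y \near x, is_derive (y : R) 1 f (g y)) -> {near x, (f^`())%classic =1 g}.
Proof.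
by apply: filterS => y [_ fy]; rewrite derive1E.
Qed.

Lemma derive2E (f g : R -> R) (x b : R) :
  (\forall y \near x, is_derive (y : R) 1 f (g y)) -> is_derive x 1 g b ->
  (f^`(2))%classic x = b.
Proof.
move=> df [_ <-]; rewrite /derive1n /= derive1E.
apply: near_eq_derive; exact: derive1_near.
Qed.

Lemma near_gt0 (x : R) : 0 < x -> \forall y \near x, 0 < y.
Proof. by move=> x0; exact: lt_nbhsr. Qed.

Lemma k''E (x : R) : 0 < x -> k'' p beta x = kfun2 x.
Proof.
move=> x0; apply: derive2E (drv_kfun1 x0).
by apply: filterS (near_gt0 x0) => y; exact: drv_kfun.
Qed.

End taylor2.

Section energy_expansion.
Variables (R : realType) (n p : nat) (beta h : R).
Hypothesis p2 : (2 <= p)%N.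
Implicit Types (m t v : 'cV[R]_n.+1).

Lemma dot_e1 t : dot e1 t = t ord0 ord0.
Proof.
rewrite /dot (bigD1 ord0)//= big1 => [|r r0]; first by rewrite mxE mul1r addr0.
by rewrite mxE (negbTE r0 : (r == 0 :> nat) = false) mul0r.
Qed.

Lemma energyE t :
  energy p beta h t = \sum_r kfun p beta (t r ord0) + h * t ord0 ord0.
Proof.
by rewrite /energy dot_e1 /kfun sumrB -mulr_sumr addrAC.
Qed.

(** The differential of the energy at m. *)
Definition denergy m v : R := \sum_r kfun1 p beta (m r ord0) * v r ord0 + h * v ord0 ord0.

Lemma QformE m v : Qform p beta m v = \sum_r kfun2 p beta (m r ord0) * v r ord0 ^+ 2.
Proof. by []. Qed.

(** The energy is, up to a linear term, a sum of functions of one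
coordinate. *)
Lemma energy_taylor m : (forall r, 0 < m r ord0) ->
  forall e, 0 < e -> exists2 d, 0 < d & forall v, (forall r, `|v r ord0| <= d) ->
  `|energy p beta h (m + v) - energy p beta h m - denergy m v - Qform p beta m v / 2|
    <= e * \sum_r v r ord0 ^+ 2.
Proof.
move=> m0 e e0.
have H r : exists d, 0 < d /\ forall u, `|u| <= d ->
    `|kfun p beta (m r ord0 + u) - kfun p beta (m r ord0)
      - kfun1 p beta (m r ord0) * u - kfun2 p beta (m r ord0) / 2 * u ^+ 2|
      <= e * u ^+ 2.
  have [|d d0 dP] := @taylor2_peano R (kfun p beta) (kfun1 p beta) (m r ord0)
    _ _ (drv_kfun1 beta p2 (m0 r)) e e0.
    by apply: filterS (near_gt0 (m0 r)) => y; exact: drv_kfun.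
  by exists d.
have [d dP] := choice H.
exists (\big[Order.min/1]_r d r).
  by apply: lt_bigmin => // r _; have [] := dP r.
move=> v vd.
have -> : energy p beta h (m + v) - energy p beta h m - denergy m v - Qform p beta m v / 2
  = \sum_r (kfun p beta (m r ord0 + v r ord0) - kfun p beta (m r ord0)
      - kfun1 p beta (m r ord0) * v r ord0
      - kfun2 p beta (m r ord0) / 2 * v r ord0 ^+ 2).
  rewrite !energyE QformE /denergy mulr_suml [_ ord0 ord0]mxE.
  have -> : \sum_r kfun p beta ((m + v) r ord0) =
      \sum_r kfun p beta (m r ord0 + v r ord0).
    by apply: eq_bigr => r _; rewrite mxE.
  move: (kfun p beta) => k; rewrite !sumrB.
  have -> : \sum_i kfun2 p beta (m i ord0) * v i ord0 ^+ 2 / 2 =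
     \sum_i kfun2 p beta (m i ord0) / 2 * v i ord0 ^+ 2.
    by apply: eq_bigr => r _; ring.
  ring.
rewrite mulr_sumr; apply: le_trans (ler_norm_sum _ _ _) _.
apply: ler_sum => r _; have [_] := dP r; apply.
by rewrite (le_trans (vd r))// bigmin_le_cond.
Qed.

Lemma denergyZ m u v : denergy m (u *: v) = u * denergy m v.
Proof.
rewrite /denergy mulrDr mulr_sumr mxE; congr (_ + _); last by ring.
by apply: eq_bigr => r _; rewrite mxE; ring.
Qed.

Lemma QformZ m u v : Qform p beta m (u *: v) = u ^+ 2 * Qform p beta m v.
Proof.
by rewrite !QformE mulr_sumr; apply: eq_bigr => r _; rewrite mxE; ring.
Qed.

(** Otherwise a small step u along v, which stays in the simplex because m is
interior, would increase the energy: the gain u (denergy m v) beats the second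
order terms, bounded by u^2 C. *)
Lemma denergy_le0 m v : global_max p beta h m -> (forall r, 0 < m r ord0) ->
  zero_sum v -> denergy m v <= 0.
Proof.
move=> [[_ m1] mmax] m0 v0; rewrite leNgt; apply/negP => gain.
have [d d0 dP] := energy_taylor m0 ltr01.
pose M := 1 + \sum_r `|v r ord0|.
have vM r : `|v r ord0| <= M.
  by rewrite /M (bigD1 r)//= addrCA ler_wpDr// addr_ge0// sumr_ge0.
have M0 : 0 < M by rewrite ltr_pwDl// sumr_ge0.
pose C := 1 + `|Qform p beta m v / 2| + \sum_r v r ord0 ^+ 2.
have C0 : 0 < C.
  by rewrite ltr_wpDr ?ltr_wpDr// sumr_ge0// => r _; exact: sqr_ge0.
pose mm := \big[Order.min/1]_r m r ord0.
have mm0 : 0 < mm by apply: lt_bigmin.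
(* Small enough for the expansion, for the simplex, and for the first order term
   to dominate. *)
pose u := Num.min (d / M) (Num.min (mm / M) (denergy m v / (2 * C))).
have u0 : 0 < u by rewrite !lt_min !divr_gt0// mulr_gt0.
have ud : u * M <= d by rewrite -ler_pdivlMr// ge_min lexx.
have um : u * M <= mm by rewrite -ler_pdivlMr// !ge_min lexx orbT.
have ul : u * (2 * C) <= denergy m v.
  by rewrite -ler_pdivlMr ?mulr_gt0// !ge_min lexx !orbT.
have uv r : `|(u *: v) r ord0| <= u * M.
  by rewrite mxE normrM gtr0_norm// ler_pM2l.
have := dP (u *: v) (fun r => le_trans (uv r) ud).
have simp : simplex (m + u *: v).
  split=> [r|].
    have : `|(u *: v) r ord0| <= m r ord0.
      by rewrite (le_trans (uv r))// (le_trans um)// bigmin_le_cond.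
    rewrite ler_norml [X in _ -> 0 <= X]mxE => /andP[]; set y := (u *: v) r ord0; lra.
  under eq_bigr do rewrite mxE [X in _ + X]mxE.
  by rewrite big_split /= m1 -mulr_sumr v0 mulr0 addr0.
have := mmax _ simp; rewrite denergyZ QformZ.
have -> : \sum_r (u *: v) r ord0 ^+ 2 = u ^+ 2 * \sum_r v r ord0 ^+ 2.
  by rewrite mulr_sumr; apply: eq_bigr => r _; rewrite mxE exprMn.
rewrite mul1r ler_norml => H1 /andP[H2 _].
have H3 : u * denergy m v <= u * (u * C).
  rewrite /C; have := ler_norm (- (Qform p beta m v / 2)); rewrite normrN => H4.
  have : u ^+ 2 * (- (Qform p beta m v / 2)) <= u ^+ 2 * `|Qform p beta m v / 2|.
    by rewrite ler_wpM2l ?sqr_ge0.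
  have : 0 <= u ^+ 2 by exact: sqr_ge0.
  by move: H1 H2; rewrite expr2; nra.
move: H3; rewrite ler_pM2l// => H3.
have := le_trans ul H3; rewrite ler_pM2l// => H5.
by have : 0 < C := C0; lra.
Qed.

(** First order condition, from denergy_le0 for v and - v. *)
Lemma denergy0 m v : global_max p beta h m -> (forall r, 0 < m r ord0) ->
  zero_sum v -> denergy m v = 0.
Proof.
move=> gm m0 v0; apply/eqP; rewrite eq_le denergy_le0//=.
have : denergy m (-1 *: v) <= 0.
  apply: denergy_le0 => //; rewrite /zero_sum /=.
  by under eq_bigr do rewrite mxE; rewrite -mulr_sumr v0 mulr0.
by rewrite denergyZ mulN1r oppr_le0.
Qed.

End energy_expansion.

(** * Quadratic form at a maximizer *)

Section maximizer.
Variables (R : realType) (n p : nat) (beta h s : R) (sigma : 'S_n.+1).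
Hypotheses (n0 : (0 < n)%N) (p2 : (2 <= p)%N) (beta0 : 0 < beta).
Hypothesis s01 : 0 <= s < 1.

Local Notation q := n.+1.

Definition top_entry (y : R) : R := (1 + (q%:R - 1) * y) / q%:R.
Definition low_entry (y : R) : R := (1 - y) / q%:R.

Let q0 : 0 < q%:R :> R. Proof. by rewrite ltr0n. Qed.
Let qE : q%:R - 1 = n%:R :> R. Proof. by rewrite -natr1 addrK. Qed.
Let nR : 0 < n%:R :> R. Proof. by rewrite ltr0n. Qed.

Lemma top_entry_gt0 : 0 < top_entry s.
Proof.
have /andP[s0 _] := s01.
by rewrite divr_gt0// ltr_pwDl// qE mulr_ge0.
Qed.

Lemma low_entry_gt0 : 0 < low_entry s.
Proof. by have /andP[_ s1] := s01; rewrite divr_gt0// subr_gt0. Qed.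

Lemma low_le_top_entry : low_entry s <= top_entry s.
Proof.
have /andP[s0 _] := s01.
rewrite ler_pM2r ?invr_gt0// qE lerD2l (le_trans (_ : _ <= 0)) ?oppr_le0//.
exact: mulr_ge0.
Qed.

(** The form - Qform at a permutation of xs s is diagonal, with the entry
top_curv at the distinguished coordinate and low_curv at the others. *)
Definition top_curv : R := - kfun2 p beta (top_entry s).
Definition low_curv : R := - kfun2 p beta (low_entry s).

(** The function kfun2 is nondecreasing on positive numbers. *)
Lemma top_le_low_curv : top_curv <= low_curv.
Proof.
rewrite lerN2 /kfun2 lerB//.
  rewrite ler_wpM2l//.
    apply: mulr_ge0; first exact: mulr_ge0 (ltW beta0) (ler0n _ _).
    by rewrite subr_ge0 ler1n ltnW.
  apply: lerXn2r; rewrite ?nnegrE; [exact: ltW low_entry_gt0|exact: ltW top_entry_gt0|].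
  exact: low_le_top_entry.
by rewrite ler_pM2l// lef_pV2 ?posrE ?low_entry_gt0 ?top_entry_gt0// low_le_top_entry.
Qed.

Definition perm_xs : 'cV[R]_q := perm_mx sigma *m xs q s.

Lemma perm_xsE r : perm_xs r ord0 = if sigma r == ord0 then top_entry s else low_entry s.
Proof. by rewrite /perm_xs -row_permE !mxE. Qed.

Lemma perm_xs_gt0 r : 0 < perm_xs r ord0.
Proof. by rewrite perm_xsE; case: ifP => _; [exact: top_entry_gt0|exact: low_entry_gt0]. Qed.

(** The distinguished entry of perm_xs sits at slot0, the equal ones at the
slots. *)
Definition slot0 : 'I_q := (sigma^-1)%g ord0.
Definition slot (j : 'I_n) : 'I_q := (sigma^-1)%g (lift ord0 j).

Lemma sum_slots (F : 'I_q -> R) : \sum_r F r = F slot0 + \sum_j F (slot j).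
Proof.
by rewrite (reindex_inj (@perm_inj _ (sigma^-1)%g)) big_ord_recl.
Qed.

Lemma perm_xs_slot0 : perm_xs slot0 ord0 = top_entry s.
Proof. by rewrite perm_xsE permKV eqxx. Qed.

Lemma perm_xs_slot j : perm_xs (slot j) ord0 = low_entry s.
Proof. by rewrite perm_xsE permKV. Qed.

(** Linear coordinates on the hyperplane of zero-sum vectors: the entries at
the slots are free and the entry at slot0 balances them. *)
Definition embed (x : 'I_n -> R) : 'cV[R]_q :=
  \col_r oapp x (- \sum_j x j) (unlift ord0 (sigma r)).

Lemma embed_slot0 x : embed x slot0 ord0 = - \sum_j x j.
Proof. by rewrite mxE permKV unlift_none. Qed.

Lemma embed_slot x j : embed x (slot j) ord0 = x j.
Proof. by rewrite mxE permKV liftK. Qed.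

Lemma slotP r : r = slot0 \/ exists j, r = slot j.
Proof.
have [j rj|r0] := unliftP ord0 (sigma r); [right|left].
  by exists j; rewrite /slot -rj permK.
by rewrite /slot0 -r0 permK.
Qed.

Lemma sum_embed (F : 'I_q -> R -> R) x :
  \sum_r F r (embed x r ord0) = F slot0 (- \sum_j x j) + \sum_j F (slot j) (x j).
Proof.
rewrite sum_slots embed_slot0; congr (_ + _).
by apply: eq_bigr => j _; rewrite embed_slot.
Qed.

Lemma embed_zero_sum x : zero_sum (embed x).
Proof.
by rewrite /zero_sum /= (sum_embed (fun _ y => y)) addNr.
Qed.

Lemma embedK v : zero_sum v -> embed (fun j => v (slot j) ord0) = v.
Proof.
rewrite /zero_sum /= sum_slots => v0; apply/colP => r.
have [->|[j ->]] := slotP r; last by rewrite embed_slot.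
by rewrite embed_slot0; apply/eqP; rewrite eq_sym -subr_eq0 opprK v0.
Qed.

(** The entry at slot0 contributes the square of the sum. *)
Lemma Qform_embed x : Qform p beta perm_xs (embed x) = - quad top_curv low_curv x.
Proof.
rewrite QformE (sum_embed (fun r y => kfun2 p beta (perm_xs r ord0) * y ^+ 2)).
have -> : \sum_j kfun2 p beta (perm_xs (slot j) ord0) * x j ^+ 2 =
    kfun2 p beta (low_entry s) * \sum_j x j ^+ 2.
  by rewrite mulr_sumr; apply: eq_bigr => j _; rewrite perm_xs_slot.
by rewrite perm_xs_slot0 sqrrN /quad /top_curv /low_curv; ring.
Qed.

Section definite.
Hypothesis negdef : forall t, zero_sum t -> t != 0 -> Qform p beta perm_xs t < 0.

(** The form is evaluated in the direction of the line xs. *)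
Lemma line_curv_gt0 : 0 < n%:R * top_curv + low_curv.
Proof.
have : Qform p beta perm_xs (embed (fun=> 1)) < 0.
  apply: negdef; first exact: embed_zero_sum.
  apply/negP => /eqP/colP/(_ (slot (Ordinal n0))).
  by rewrite embed_slot mxE; apply/eqP; rewrite oner_eq0.
rewrite Qform_embed oppr_lt0 /quad.
under [in X in _ + X]eq_bigr do rewrite expr1n.
rewrite sumr_const card_ord => H.
have : 0 < n%:R * (n%:R * top_curv + low_curv).
  by apply: lt_le_trans H _; rewrite le_eqVlt; apply/orP; left; apply/eqP; ring.
by rewrite pmulr_rgt0.
Qed.

(** If low_curv were at most 0, so would be top_curv, against line_curv_gt0.
Testing the form on a zero-sum vector that vanishes at slot0 would require
n > 1. *)
Lemma low_curv_gt0 : 0 < low_curv.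
Proof.
rewrite ltNge; apply/negP => B0; have := line_curv_gt0; rewrite ltNge => /negP; apply.
have A0 := le_trans top_le_low_curv B0.
by rewrite -[leRHS]addr0 lerD// pmulr_rle0.
Qed.

Lemma sqr_sum_le (x : 'I_n -> R) : (\sum_j x j) ^+ 2 <= n%:R * \sum_j x j ^+ 2.
Proof.
have : 0 <= \sum_i \sum_j (x i - x j) ^+ 2.
  by apply: sumr_ge0 => i _; apply: sumr_ge0 => j _; exact: sqr_ge0.
have -> : \sum_i \sum_j (x i - x j) ^+ 2 =
    2 * (n%:R * \sum_j x j ^+ 2) - 2 * (\sum_j x j) ^+ 2.
  transitivity (\sum_i (n%:R * x i ^+ 2 - 2 * x i * (\sum_j x j) + \sum_j x j ^+ 2)).
    apply: eq_bigr => i _.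
    have -> : n%:R * x i ^+ 2 = \sum_(j < n) x i ^+ 2.
      by rewrite sumr_const card_ord mulr_natl.
    rewrite mulr_sumr -sumrB -big_split /=; apply: eq_bigr => j _; ring.
  rewrite big_split /= sumrB -mulr_sumr -mulr_suml -mulr_sumr sumr_const card_ord.
  rewrite -[(\sum_j _) *+ n]mulr_natl; ring.
lra.
Qed.

(** The eigenvalues of quad are low_curv, on vectors of sum 0, and
n top_curv + low_curv, on constant vectors. *)
Lemma quad_coercive (x : 'I_n -> R) :
  Num.min low_curv (n%:R * top_curv + low_curv) * \sum_j x j ^+ 2 <= quad top_curv low_curv x.
Proof.
have S0 : 0 <= \sum_j x j ^+ 2 by apply: sumr_ge0 => j _; exact: sqr_ge0.
have T0 : 0 <= (\sum_j x j) ^+ 2 := sqr_ge0 _.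
have TS := sqr_sum_le x.
rewrite /quad; have [A0|A0] := leP 0 top_curv.
  apply: (@le_trans _ _ (low_curv * \sum_j x j ^+ 2)).
    by rewrite ler_wpM2r// ge_min lexx.
  by rewrite lerDr mulr_ge0.
apply: (@le_trans _ _ ((n%:R * top_curv + low_curv) * \sum_j x j ^+ 2)).
  by rewrite ler_wpM2r// ge_min lexx orbT.
rewrite mulrDl lerD2r -mulrA mulrCA ler_wnM2l// ltW//.
Qed.

Lemma Qform_coercive : exists2 c, 0 < c & forall v, zero_sum v ->
  Qform p beta perm_xs v <= - (c * \sum_r v r ord0 ^+ 2).
Proof.
pose c0 := Num.min low_curv (n%:R * top_curv + low_curv).
have c00 : 0 < c0 by rewrite lt_min low_curv_gt0 line_curv_gt0.
exists (c0 / q%:R); first exact: divr_gt0.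
move=> v v0; rewrite -(embedK v0); move: (fun j => _) => x {v v0}.
rewrite Qform_embed lerN2; apply: le_trans (quad_coercive x).
rewrite -mulrA ler_pM2l// ler_pdivrMl// (sum_embed (fun _ y => y ^+ 2)) sqrrN.
by have := sqr_sum_le x; rewrite -natr1 mulrDl mul1r lerD2r.
Qed.

(** Along the line xs the distinguished entry moves with speed n / q and the
n others with speed - 1 / q. *)
Lemma f''E : f'' p q beta h s = - (n%:R / q%:R ^+ 2 * (n%:R * top_curv + low_curv)).
Proof.
pose g y := n%:R / q%:R * kfun1 p beta (top_entry y) - n%:R / q%:R * kfun1 p beta (low_entry y)
  + h * (n%:R / q%:R).
have dbig (y : R) : is_derive y 1 top_entry (n%:R / q%:R).
  apply: drv_eq (drv_mul (drv_add (drv_cst 1 y) (drv_scale (q%:R - 1) (drv_id y)))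
    (drv_cst q%:R^-1 y)) _.
  by rewrite qE; ring.
have dsmall (y : R) : is_derive y 1 low_entry (- q%:R^-1).
  apply: drv_eq (drv_mul (drv_sub (drv_cst 1 y) (drv_id y)) (drv_cst q%:R^-1 y)) _.
  by ring.
apply: (@derive2E _ (fline p q beta h) g).
- have -> : fline p q beta h =
      fun y => kfun p beta (top_entry y) + n%:R * kfun p beta (low_entry y) + h * top_entry y.
    apply/funext => y; rewrite /fline energyE big_ord_recl mxE /=.
    congr (_ + _ + h * _).
    rewrite (eq_bigr (fun=> kfun p beta (low_entry y))); last by move=> j _; rewrite mxE.
    by rewrite sumr_const card_ord mulr_natl.
  have nb : \forall y \near s, 0 < top_entry y.
    have cbig : top_entry y @[y --> s] --> top_entry s.
      by apply/differentiable_continuous/derivable1_diffP; have [] := dbig s.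
    exact: (cvgr_gt _ cbig _ top_entry_gt0).
  have ns : \forall y \near s, 0 < low_entry y.
    have csmall : low_entry y @[y --> s] --> low_entry s.
      by apply/differentiable_continuous/derivable1_diffP; have [] := dsmall s.
    exact: (cvgr_gt _ csmall _ low_entry_gt0).
  near=> y.
  have b0 : 0 < top_entry y by near: y.
  have s0 : 0 < low_entry y by near: y.
  apply: drv_eq (drv_add (drv_add (drv_comp (drv_kfun p beta b0) (dbig y))
    (drv_scale n%:R (drv_comp (drv_kfun p beta s0) (dsmall y))))
    (drv_scale h (dbig y))) _.
  by rewrite /g; ring.
- apply: drv_eq (drv_add (drv_sub
    (drv_scale (n%:R / q%:R) (drv_comp (drv_kfun1 beta p2 top_entry_gt0) (dbig s)))
    (drv_scale (n%:R / q%:R) (drv_comp (drv_kfun1 beta p2 low_entry_gt0) (dsmall s))))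
    (drv_cst (h * (n%:R / q%:R)) s)) _.
  by rewrite /top_curv /low_curv; field; rewrite gt_eqF.
Unshelve. all: by end_near. Qed.

End definite.
End maximizer.

(** * Energy gap away from the maximizers *)

Section energy_gap.
Variables (R : realType).

Lemma cvg_sumr (T : Type) (F : set_system T) (FF : Filter F) (I : Type)
    (r : seq I) (f : I -> T -> R) (a : I -> R) :
  (forall i, f i x @[x --> F] --> a i) ->
  \sum_(i <- r) f i x @[x --> F] --> \sum_(i <- r) a i.
Proof.
move=> fa; elim: r => [|i r IH].
  rewrite big_nil; under eq_fun do rewrite big_nil; exact: cvg_cst.
rewrite big_cons; under eq_fun do rewrite big_cons.
exact: cvgD.
Qed.

Lemma continuous_sumr (T : topologicalType) (I : Type) (r : seq I)
    (f : I -> T -> R) : (forall i, continuous (f i)) ->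
  continuous (fun x => \sum_(i <- r) f i x).
Proof. by move=> cf x; apply: cvg_sumr => i; exact: cf. Qed.

(** At 0, for y = z^2 with 0 < z < 1, the inequality - ln z = ln (1 / z) <= 1 / z
gives |y ln y| <= 2 z. *)
Lemma continuous_xlnx : continuous (fun x : R => x * ln x).
Proof.
move=> x; have [x0|x0|->] := ltgtP x 0.
- have : (fun=> 0 : R) @ x --> x * ln x.
    by rewrite ln0 ?ltW// mulr0; exact: cvg_cst.
  apply: cvg_trans; apply: near_eq_cvg.
  have : \forall y \near x, y < 0 by exact: lt_nbhsl.
  by apply: filterS => y y0; rewrite ln0 ?ltW// mulr0.
- by apply: cvgM; [exact: cvg_id|exact: continuous_ln].
rewrite /continuous_at mul0r; apply/cvgr0Pnorm_le => e e0.
pose d := Num.min 1 ((e / 2) ^+ 2).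
have d0 : 0 < d by rewrite lt_min ltr01 exprn_gt0// divr_gt0.
have : \forall y \near (0 : R), `|0 - y| < d by exact: nbhsx_ballx.
apply: filterS => y; rewrite sub0r normrN => yd.
have [y0|y0] := leP y 0; first by rewrite ln0// mulr0 normr0 ltW.
rewrite gtr0_norm// in yd.
have y1 : y < 1 by rewrite (lt_le_trans yd)// ge_min lexx.
have ye : y < (e / 2) ^+ 2 by rewrite (lt_le_trans yd)// ge_min lexx orbT.
pose z := Num.sqrt y.
have z0 : 0 < z by rewrite sqrtr_gt0.
have zE : y = z ^+ 2 by rewrite sqr_sqrtr// ltW.
have ze : z < e / 2.
  rewrite -(@ltr_pXn2r _ 2)// ?nnegrE ?ltW// ?divr_gt0//; by rewrite -zE.
have lnz : - ln z <= z^-1.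
  by rewrite -lnV ?posrE// ltW// ln_sublinear// invr_gt0.
rewrite normrM gtr0_norm// ler0_norm; last by rewrite ln_le0// ltW.
rewrite zE lnXn// mulr2n opprD.
have : z ^+ 2 * (- ln z + - ln z) <= z ^+ 2 * (z^-1 + z^-1).
  by rewrite ler_pM2l ?exprn_gt0// lerD.
move=> /le_trans; apply.
have -> : z ^+ 2 * (z^-1 + z^-1) = z + z by field; rewrite gt_eqF.
by lra.
Qed.

Variables (n p : nat) (beta h : R).

Lemma continuous_energy : continuous (energy p beta h : 'cV[R]_n.+1 -> R).
Proof.
have -> : energy p beta h = (fun t : 'cV[R]_n.+1 =>
   \sum_r (beta * t r ord0 ^+ p - t r ord0 * ln (t r ord0)) + h * t ord0 ord0).
  by apply/funext => t; rewrite energyE.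
have cc (f : R -> R) r : continuous f -> continuous (fun t : 'cV[R]_n.+1 => f (t r ord0)).
  move=> cf t; apply: (@continuous_comp _ _ _ (fun M : 'cV[R]_n.+1 => M r ord0) f).
    exact: coord_continuous.
  exact: cf.
have c1 : continuous (fun t : 'cV[R]_n.+1 =>
    \sum_r (beta * t r ord0 ^+ p - t r ord0 * ln (t r ord0))).
  apply: continuous_sumr => r; apply: (cc (fun x => beta * x ^+ p - x * ln x)) => x.
  apply: cvgB; last exact: continuous_xlnx.
  by apply: cvgM; [exact: cvg_cst|exact: exprn_continuous].
have c2 : continuous (fun t : 'cV[R]_n.+1 => h * t ord0 ord0).
  by apply: (cc (fun x => h * x)) => x; exact: mulrl_continuous.
by move=> t; exact: (cvgD (c1 t) (c2 t)).
Qed.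

Lemma continuous_tr : continuous (fun x : 'rV[R]_n.+1 => x^T).
Proof.
move=> x s /= /(nbhs_ballP x^T) [e e0 es].
apply/nbhs_ballP; exists e => //= y [_ xy]; apply: es; split => // i j.
by rewrite !mxE.
Qed.

Lemma closed_simplex : closed [set t : 'cV[R]_n.+1 | simplex t].
Proof.
have -> : [set t : 'cV[R]_n.+1 | simplex t] =
    \bigcap_(r in [set: 'I_n.+1]) ((fun t : 'cV[R]_n.+1 => t r ord0) @^-1` [set y | 0 <= y])
    `&` ((fun t : 'cV[R]_n.+1 => \sum_r t r ord0) @^-1` [set 1]).
  apply/seteqP; split => t /= [t0 t1]; split => //.
  - by move=> r _; exact: t0.
  - by move=> r; exact: (t0 r I).
apply: closedI.
  apply: closed_bigI => r _; apply: closed_comp; last exact: closed_ge.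
  by move=> t _; exact: coord_continuous.
apply: closed_comp; last exact: closed_eq.
move=> t _; apply: (@continuous_sumr _ _ _ (fun r (t : 'cV[R]_n.+1) => t r ord0)) => r.
exact: coord_continuous.
Qed.

(** The continuous energy attains its maximum on the compact set of the
points of O in the simplex. *)
Lemma energy_gap (O : set 'cV[R]_n.+1) (m : 'cV[R]_n.+1) : closed O -> global_max p beta h m ->
  (forall t, O t -> ~ global_max p beta h t) ->
  exists2 eta, 0 < eta & forall t, O t -> simplex t ->
    energy p beta h t <= energy p beta h m - eta.
Proof.
move=> cO gm nO.
pose K : set 'rV[R]_n.+1 := (fun x => x^T) @^-1` (O `&` [set t | simplex t]).
have [[x0 Kx0]|K0] := pselect (K !=set0); last first.
  exists 1 => // t Ot st; exfalso; apply: K0; exists t^T.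
  by rewrite /K /preimage /= trmxK.
(* Boxes of row vectors are compact, hence the transposition. *)
have cK : compact K.
  have c01 : compact [set v : 'rV[R]_n.+1 | forall i, v ord0 i \in `[0, 1]].
    apply: (@rV_compact R n.+1 (fun=> `[(0 : R), 1]%classic)) => _.
    exact: segment_compact.
  apply: subclosed_compact c01 _.
    apply: closed_comp; first by move=> x _; exact: continuous_tr.
    by apply: closedI => //; exact: closed_simplex.
  move=> x [_ [xge xsum]] i /=; rewrite in_itv /=.
  have xE j : x ord0 j = x^T j ord0 by rewrite mxE.
  rewrite xE xge /= -xsum (bigD1 i)//= lerDl sumr_ge0// => j _.
have cf : {within K, continuous (fun x => energy p beta h x^T)}.
  apply: continuous_subspaceT => x.
  apply: (@continuous_comp _ _ _ (fun x : 'rV[R]_n.+1 => x^T) (energy p beta h)).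
    exact: continuous_tr.
  exact: continuous_energy.
have [c] := compact_EVT_max (ex_intro _ _ Kx0) cK cf.
rewrite inE => -[Oc sc] cmax.
have lt_c : energy p beta h c^T < energy p beta h m.
  rewrite ltNge; apply/negP => mc; apply: (nO _ Oc); split => // u su.
  by rewrite (le_trans _ mc)//; have [_] := gm; exact.
exists (energy p beta h m - energy p beta h c^T); first by rewrite subr_gt0.
move=> t Ot st; rewrite opprB addrCA subrr addr0.
have := cmax t^T; rewrite trmxK; apply.
by rewrite inE; split; rewrite /= trmxK.
Qed.

End energy_gap.

(** * Covariance matrix and mixture weights *)

Section covariance.
Variables (R : realType) (n p : nat) (beta h s : R) (sigma : 'S_n.+1).
Hypotheses (n0 : (0 < n)%N) (p2 : (2 <= p)%N) (beta0 : 0 < beta).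
Hypothesis s01 : 0 <= s < 1.
Local Notation q := n.+1.
Local Notation m := (perm_xs s sigma).
Local Notation A := (top_curv n p beta s).
Local Notation B := (low_curv n p beta s).
Hypothesis negdef : forall t, zero_sum t -> t != 0 -> Qform p beta m t < 0.

(** The adjoint of embed with respect to dot. *)
Definition embed_tr (a : 'cV[R]_q) (j : 'I_n) : R :=
  a (slot sigma j) ord0 - a (slot0 sigma) ord0.

(** The polarisation of gauss_var. *)
Definition gauss_cov (c u : 'I_n -> R) : R :=
  (\sum_j c j * u j + A / B * (n%:R * \sum_j c j * u j - (\sum_j c j) * \sum_j u j))
  / (n%:R * A + B).

Lemma gauss_var_cov c : gauss_var A B c = gauss_cov c c.
Proof.
rewrite /gauss_var /gauss_cov expr2.
by under eq_bigr do rewrite expr2.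
Qed.

Lemma dot_embed a x : dot a (embed sigma x) = \sum_j embed_tr a j * x j.
Proof.
rewrite /dot (sum_embed sigma (fun r y => a r ord0 * y)) /embed_tr.
rewrite mulrN mulr_sumr addrC -sumrB; apply: eq_bigr => j _; ring.
Qed.

(** The prefactor - q^2 / (q - 1) f'' of Sigma is n top_curv + low_curv, and
rho is top_curv / low_curv. *)
Lemma SigmaE : Sigma p q beta h s = (n%:R * A + B)^-1 *:
  \matrix_(i, j)
    (if (i == 0 :> nat) && (j == 0 :> nat) then n%:R
     else if (i == 0 :> nat) || (j == 0 :> nat) then - 1
     else if i == j then 1 + (n%:R - 1) * (A / B)
     else - (A / B)).
Proof.
have q0 : q%:R != 0 :> R by rewrite pnatr_eq0.
have nR0 : n%:R != 0 :> R by rewrite pnatr_eq0 -lt0n.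
have q1 : q%:R - 1 = n%:R :> R by rewrite -natr1 addrK.
have q2 : q%:R - 2 = n%:R - 1 :> R by rewrite -natr1; ring.
rewrite /Sigma (f''E n beta h p2 s01) q1 q2; congr (_ *: _).
  by congr GRing.inv; clear q1 q2; move: (q%:R) q0 => Q Q0; field; rewrite nR0 Q0.
have -> // : rho p q beta s = A / B.
rewrite /rho k''E//; last exact: top_entry_gt0.
by rewrite k''E ?low_entry_gt0// /top_curv /low_curv invrN mulrNN.
Qed.

(** P Sigma P^T is the covariance matrix of embed x, for x with density
proportional to exp (- quad top_curv low_curv x / 2): a vector a acts on embed x
as embed_tr a acts on x. *)
Lemma dot_permSigma (a b : 'cV[R]_q) :
  dot a (perm_mx sigma *m Sigma p q beta h s *m (perm_mx sigma)^T *m b) =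
  gauss_cov (embed_tr a) (embed_tr b).
Proof.
have dotP (M : 'M[R]_q) : dot a (perm_mx sigma *m M *m (perm_mx sigma)^T *m b) =
    \sum_i a ((sigma^-1)%g i) ord0 * \sum_k M i k * b ((sigma^-1)%g k) ord0.
  rewrite /dot (reindex_inj (@perm_inj _ (sigma^-1)%g)); apply: eq_bigr => i _.
  congr (_ * _); rewrite -!mulmxA -row_permE mxE permKV mxE.
  by apply: eq_bigr => k _; rewrite tr_perm_mx -row_permE mxE.
rewrite SigmaE dotP /gauss_cov [RHS]mulrC.
under eq_bigr => i _.
  under eq_bigr => k _ do rewrite mxE -mulrA.
  rewrite -mulr_sumr mulrCA.
  over.
rewrite -mulr_sumr; congr (_ * _).
rewrite big_ord_recl big_ord_recl /=.
pose a' j := a (slot sigma j) ord0; pose b' j := b (slot sigma j) ord0.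
pose Tb := \sum_j b' j.
pose a0 := a (slot0 sigma) ord0; pose b0 := b (slot0 sigma) ord0.
rewrite mxE /= -/(slot0 sigma) -/a0 -/b0.
have -> : \sum_(k < n) (\matrix_(i, j)
    (if (i == 0 :> nat) && (j == 0 :> nat) then n%:R
     else if (i == 0 :> nat) || (j == 0 :> nat) then - 1
     else if i == j then 1 + (n%:R - 1) * (A / B)
     else - (A / B)) : 'M[R]_q) ord0 (lift ord0 k) * b ((sigma^-1)%g (lift ord0 k)) ord0
    = - \sum_j b' j.
  by rewrite -sumrN; apply: eq_bigr => j _; rewrite mxE /= mulN1r.
rewrite [X in _ + X = _](eq_bigr (fun j =>
  a' j * (- b0 + (1 + n%:R * (A / B)) * b' j - A / B * Tb))); last first.
  move=> j _; congr (_ * _); rewrite big_ord_recl mxE /= -/(slot0 sigma) -/b0 mulN1r -addrA.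
  congr (_ + _).
  rewrite (bigD1 j)//= mxE /= eqxx -/(slot sigma j) -/(b' j).
  rewrite (eq_bigr (fun k => - (A / B) * b' k)); last first.
    move=> k kj; rewrite mxE /= (inj_eq (@lift_inj _ _)) eq_sym (negbTE kj).
    by [].
  by rewrite /Tb [in RHS](bigD1 j)//= -mulr_sumr; ring.
rewrite /embed_tr -/a0 -/b0.
have S1 (c : 'cV[R]_q) : \sum_j (c (slot sigma j) ord0 - c (slot0 sigma) ord0) =
   \sum_j c (slot sigma j) ord0 - n%:R * c (slot0 sigma) ord0.
  by rewrite sumrB sumr_const card_ord mulr_natl.
rewrite !S1 -/a0 -/b0.
have -> : \sum_j (a (slot sigma j) ord0 - a0) * (b (slot sigma j) ord0 - b0) =
   \sum_j a' j * b' j - a0 * \sum_j b' j - b0 * \sum_j a' j + n%:R * (a0 * b0).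
  rewrite !mulr_sumr.
  have -> : n%:R * (a0 * b0) = \sum_(j < n) a0 * b0.
    by rewrite sumr_const card_ord mulr_natl.
  by rewrite -!sumrB -big_split /=; apply: eq_bigr => j _; rewrite /a' /b'; ring.
have gen T : \sum_j a' j * (- b0 + (1 + n%:R * (A / B)) * b' j - A / B * T) =
   (1 + n%:R * (A / B)) * \sum_j a' j * b' j - b0 * \sum_j a' j
   - A / B * (\sum_j a' j) * T.
  rewrite -[in RHS]mulrA [(\sum_j a' j) * _]mulr_suml !mulr_sumr -!sumrB.
  by apply: eq_bigr => j _; ring.
rewrite gen.
rewrite -[\sum_j a (slot sigma j) ord0]/(\sum_j a' j).
rewrite -[\sum_j b (slot sigma j) ord0]/(\sum_j b' j).
by rewrite -/Tb; set x := \sum_j a' j; ring.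
Qed.

(** The left-hand side is the mass of the Gaussian limit times the factor of
Stirling's formula that depends on m. The constant on the right is the same for
all maximizers. The power 2 - q of - k'' arises as low_curv / low_curv^n. *)
Lemma tau_mass :
  gauss_mass n A B * (Num.sqrt (\prod_r m r ord0))^-1 =
  Num.sqrt ((pi *+ 2) ^+ n * n%:R / q%:R ^+ 2) * tau p beta h m s.
Proof.
have q0 : 0 < q%:R :> R by rewrite ltr0n.
have nR0 : 0 < n%:R :> R by rewrite ltr0n.
have piv := line_curv_gt0 n0 negdef; have Bp := low_curv_gt0 n0 p2 beta0 s01 negdef.
have mp : 0 < \prod_r m r ord0 by apply: prodr_gt0 => r _; exact: perm_xs_gt0.
have pi2 : 0 < pi *+ 2 :> R by rewrite mulrn_wgt0// pi_gt0.
have M0 : 0 <= (pi *+ 2) ^+ n * n%:R / q%:R ^+ 2 :> R.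
  by rewrite divr_ge0 ?mulr_ge0 ?exprn_ge0// ltW.
rewrite /gauss_mass /tau -sqrtrV ?(ltW mp)// -?sqrtrM//; last first.
  rewrite divr_ge0 ?exprn_ge0 ?ltW// mulr_gt0 ?exprn_gt0//.
  rewrite (_ : 1 + _ = (n%:R * A + B) / B) ?divr_gt0//.
  by field; rewrite gt_eqF.
congr Num.sqrt; rewrite (f''E n beta h p2 s01) k''E ?low_entry_gt0//.
rewrite -[- kfun2 _ _ _]/B.
have -> : B ^ (2%:Z - q%:Z) = B / B ^+ n.
  rewrite (_ : 2%:Z - q%:Z = 1 - n%:Z); last by rewrite -addn1 PoszD; ring.
  by rewrite expfzDr ?gt_eqF// expr1z -exprnN.
move: (B ^+ n) (expf_neq0 n (lt0r_neq0 Bp)) => Bn Bn0.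
move: (\prod_r m r ord0) mp => M mp.
move: ((pi *+ 2) ^+ n) => P; clear M0; move: q%:R q0 => Q q0.
have N0 : B + n%:R * A != 0 by rewrite addrC gt_eqF.
by field; rewrite ?Bn0 ?N0 ?[_ + B]addrC ?N0 !gt_eqF.
Qed.

End covariance.

(** * Perturbed Gibbs weights away from the maximizers *)

Section root_sequences.
Variable R : realType.

Lemma invn_cvg0 : (n%:R^-1 : R) @[n --> \oo] --> 0.
Proof.
rewrite -cvg_shiftS; exact: cvg_harmonic.
Qed.

Lemma inv_sqrtn_cvg0 : ((Num.sqrt n%:R)^-1 : R) @[n --> \oo] --> 0.
Proof.
have -> : (fun n : nat => (Num.sqrt n%:R)^-1 : R) = (fun n : nat => Num.sqrt (n%:R^-1)).
  by apply/funext => n; rewrite sqrtrV.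
rewrite -[X in _ --> X]sqrtr0.
by apply: continuous_cvg; [exact: sqrt_continuous|exact: invn_cvg0].
Qed.

(** With eta = 2 a, the term C sqrt N is absorbed by a N, up to a constant,
and exp (- a N) is bounded by (q + 1)! / (a N)^(q + 1). *)
Lemma poly_expR_cvg0 (q : nat) (eta C : R) : 0 < eta ->
  N.+1%:R ^+ q * expR (- eta * N%:R + C * Num.sqrt N%:R) @[N --> \oo] --> 0.
Proof.
move=> eta0; have [a a0 ->] : exists2 a, 0 < a & eta = 2 * a.
  by exists (eta / 2); [exact: divr_gt0|field].
pose K := expR (C ^+ 2 / (4 * a)) * q.+1`!%:R / a ^+ q.+1 * 2 ^+ q.
apply: (@squeeze_cvgr _ _ _ _ (fun=> 0) (fun N : nat => K * N%:R^-1)); first last.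
- by rewrite -[X in _ --> X](mulr0 K); apply: cvgM; [exact: cvg_cst|exact: invn_cvg0].
- exact: cvg_cst.
near=> N; rewrite mulr_ge0 ?exprn_ge0 ?expR_ge0//=.
have N0 : (0 < N)%N by near: N; exists 1.
have NR : 0 < N%:R :> R by rewrite ltr0n.
pose r := Num.sqrt N%:R : R.
have r2 : r ^+ 2 = N%:R by rewrite sqr_sqrtr.
have E1 : - (2 * a) * N%:R + C * r <= C ^+ 2 / (4 * a) - a * N%:R.
  rewrite -r2 -subr_ge0.
  have -> : C ^+ 2 / (4 * a) - a * r ^+ 2 - (- (2 * a) * r ^+ 2 + C * r) =
     a * (r - C / (2 * a)) ^+ 2 by field; rewrite gt_eqF.
  by rewrite mulr_ge0 ?sqr_ge0 ?ltW.
have E2 : expR (- (a * N%:R)) <= q.+1`!%:R / (a * N%:R) ^+ q.+1.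
  have aN : 0 < a * N%:R by rewrite mulr_gt0.
  rewrite expRN -invf_div lef_pV2 ?posrE ?expR_gt0 ?divr_gt0 ?exprn_gt0 ?ltr0n ?fact_gt0//.
  by apply: le_trans (expR_ge1Dxn q (ltW aN)); rewrite lerDr.
apply: (@le_trans _ _ ((2 * N%:R) ^+ q * (expR (C ^+ 2 / (4 * a)) *
   (q.+1`!%:R / (a * N%:R) ^+ q.+1)))).
  apply: ler_pM; rewrite ?exprn_ge0 ?expR_ge0//.
    by rewrite lerXn2r ?nnegrE ?mulr_ge0// -natrM ler_nat mul2n -addnn -addn1 leq_add2l.
  apply: le_trans (_ : expR (C ^+ 2 / (4 * a) - a * N%:R) <= _); first by rewrite ler_expR.
  by rewrite expRD ler_wpM2l ?expR_ge0.
rewrite le_eqVlt; apply/orP; left; apply/eqP.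
rewrite /K !exprMn !exprS.
have := expf_neq0 q (lt0r_neq0 a0); have := expf_neq0 q (lt0r_neq0 NR).
set u := N%:R ^+ q; set v := a ^+ q => u0 v0; field.
by rewrite u0 v0 !gt_eqF.
Unshelve. all: by end_near. Qed.

End root_sequences.

Section perturbation.
Variables (R : realType) (n p : nat) (bb hb : R).
Hypothesis p2 : (2 <= p)%N.
Implicit Types m t v : 'cV[R]_n.+1.

(** The coefficient of sqrt N in the exponent of a perturbed Gibbs weight,
when betabar = bb and hbar = hb. *)
Definition tilt t : R := bb * \sum_r t r ord0 ^+ p + hb * t ord0 ord0.

(** The gradient of tilt. *)
Definition slope m : 'cV[R]_n.+1 :=
  (bb * p%:R) *: (\col_r m r ord0 ^+ (p - 1)) + hb *: e1.

(** Writing tilt as a difference of energies makes the expansion of the energy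
available for it. *)
Lemma tiltE t : tilt t = energy p bb hb t - energy p 0 0 t.
Proof. by rewrite /energy /tilt dot_e1; ring. Qed.

Lemma dot_slope m v : dot (slope m) v = denergy p bb hb m v - denergy p 0 0 m v.
Proof.
have -> : dot (slope m) v = bb * p%:R * \sum_r m r ord0 ^+ (p - 1) * v r ord0
     + hb * v ord0 ord0.
  rewrite -dot_e1 /dot !mulr_sumr -big_split /=; apply: eq_bigr => r _.
  by rewrite !mxE; ring.
rewrite /denergy /kfun1 !mul0r addr0 addrAC -sumrB mulr_sumr; congr (_ + _).
by apply: eq_bigr => r _; ring.
Qed.

Lemma tilt_taylor m : (forall r, 0 < m r ord0) ->
  exists C d, [/\ 0 <= C, 0 < d & forall v, (forall r, `|v r ord0| <= d) ->
    `|tilt (m + v) - tilt m - dot (slope m) v| <= C * \sum_r v r ord0 ^+ 2].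
Proof.
move=> m0.
have [d1 d10 d1P] := energy_taylor bb hb p2 m0 ltr01.
have [d2 d20 d2P] := energy_taylor 0 0 p2 m0 ltr01.
pose k r := kfun2 p bb (m r ord0) - kfun2 p 0 (m r ord0).
pose C := 2 + \sum_r `|k r|.
exists C, (Num.min d1 d2); split.
- by rewrite addr_ge0// sumr_ge0.
- by rewrite lt_min d10.
move=> v vd.
have S0 : 0 <= \sum_r v r ord0 ^+ 2 by rewrite sumr_ge0// => r _; exact: sqr_ge0.
have H1 := d1P v (fun r => le_trans (vd r) (_ : Num.min d1 d2 <= d1)).
have {}H1 := H1 (ltac:(by rewrite ge_min lexx)).
have H2 := d2P v (fun r => le_trans (vd r) (_ : Num.min d1 d2 <= d2)).
have {}H2 := H2 (ltac:(by rewrite ge_min lexx orbT)).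
rewrite !tiltE dot_slope.
have HQ : `|(Qform p bb m v - Qform p 0 m v) / 2| <= (\sum_r `|k r|) * \sum_r v r ord0 ^+ 2.
  rewrite !QformE -sumrB.
  have -> : \sum_i (kfun2 p bb (m i ord0) * v i ord0 ^+ 2
       - kfun2 p 0 (m i ord0) * v i ord0 ^+ 2) = \sum_r k r * v r ord0 ^+ 2.
    by apply: eq_bigr => r _; rewrite /k; ring.
  rewrite normrM [`|2^-1|]ger0_norm// ler_pdivrMr//.
  apply: (@le_trans _ _ ((\sum_r `|k r|) * \sum_r v r ord0 ^+ 2)); last first.
    by rewrite ler_peMr ?ler1n// mulr_ge0// sumr_ge0.
  apply: le_trans (ler_norm_sum _ _ _) _; rewrite mulr_suml; apply: ler_sum => r _.
  rewrite normrM [`|_ ^+ 2|]ger0_norm ?sqr_ge0// ler_wpM2l//.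
  by rewrite (bigD1 r)//= lerDl sumr_ge0// => i _; exact: sqr_ge0.
move: H1 H2 HQ; rewrite /C mulrDl !ler_norml.
set S := \sum_r v r ord0 ^+ 2; set K := (\sum_r _) * _.
by move=> /andP[? ?] /andP[? ?] /andP[? ?]; apply/andP; split; lra.
Qed.

Lemma tilt_bounded : exists2 C, 0 <= C & forall t, simplex t -> `|tilt t| <= C.
Proof.
exists (`|bb| * n.+1%:R + `|hb|); first by rewrite addr_ge0// mulr_ge0.
move=> t [t0 t1].
have le1 r : t r ord0 <= 1 by rewrite -t1 (bigD1 r)//= lerDl sumr_ge0.
rewrite /tilt; apply: le_trans (ler_normD _ _) _; rewrite !normrM; apply: lerD.
  rewrite ler_wpM2l//; apply: le_trans (ler_norm_sum _ _ _) _.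
  have -> : n.+1%:R = \sum_(r < n.+1) 1 :> R by rewrite sumr_const card_ord.
  apply: ler_sum => r _.
  by rewrite ger0_norm ?exprn_ge0// exprn_ile1.
by rewrite ler_piMr// ger0_norm.
Qed.

End perturbation.

Section weights.
Variables (R : realType) (n p : nat) (beta h bb hb : R).
Implicit Types (t m : 'cV[R]_n.+1).

Definition weight N (X : config n.+1 N) : R :=
  gibbs_weight p (beta + bb / Num.sqrt N%:R) (h + hb / Num.sqrt N%:R) X.

(** The inverse of the total exponential weight of the composition m, its
entropy included. *)
Definition renorm m N : R :=
  expR (- (N%:R * energy p beta h m) - Num.sqrt N%:R * tilt p bb hb m).

Lemma energy_neg_entropy t :
  energy p beta h t + neg_entropy t = beta * \sum_r t r ord0 ^+ p + h * t ord0 ord0.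
Proof. by rewrite /energy /neg_entropy subrK dot_e1. Qed.

Lemma weightE N (X : config n.+1 N) : (0 < N)%N ->
  weight X = expR (N%:R * (energy p beta h (xbar R X) + neg_entropy (xbar R X))
                   + Num.sqrt N%:R * tilt p bb hb (xbar R X)).
Proof.
move=> N0; have NR : 0 < N%:R :> R by rewrite ltr0n.
have r0 : Num.sqrt N%:R != 0 :> R by rewrite gt_eqF// sqrtr_gt0.
have NE : N%:R = Num.sqrt N%:R ^+ 2 :> R by rewrite sqr_sqrtr.
rewrite /weight /gibbs_weight dot_e1 energy_neg_entropy /tilt; congr expR.
set S := \sum_(r < _) _; set x := xbar R X ord0 ord0.
move: (Num.sqrt N%:R) r0 NE => r r0 ->; by field.
Qed.

Lemma weight_gt0 N (X : config n.+1 N) : 0 < weight X.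
Proof. exact: expR_gt0. Qed.

Lemma renorm_gt0 m N : 0 < renorm m N. Proof. exact: expR_gt0. Qed.

(** There are at most (N + 1)^q compositions, and each of those in O has, in
total and relative to m, a weight at most exp (- eta N + 2 C sqrt N), where C
bounds tilt. *)
Lemma outer_negligible m (O : pred 'cV[R]_n.+1) eta : simplex m -> 0 < eta ->
  (forall t, O t -> simplex t -> energy p beta h t <= energy p beta h m - eta) ->
  renorm m N * \sum_(X : config n.+1 N | O (xbar R X)) weight X @[N --> \oo] --> 0.
Proof.
move=> sm eta0 Oeta.
have [C C0 CP] := tilt_bounded n p bb hb.
apply: (@squeeze_cvgr _ _ _ _ (fun=> 0)
  (fun N : nat => N.+1%:R ^+ n.+1 * expR (- eta * N%:R + (2 * C) * Num.sqrt N%:R)));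
  first last.
- exact: poly_expR_cvg0.
- exact: cvg_cst.
near=> N.
have N0 : (0 < N)%N by near: N; exists 1%N.
have NR : 0 < N%:R :> R by rewrite ltr0n.
apply/andP; split.
  apply: mulr_ge0; first exact: ltW (renorm_gt0 m N).
  by apply: sumr_ge0 => X _; exact: ltW (weight_gt0 X).
pose G t := expR (N%:R * (energy p beta h t + neg_entropy t) + Num.sqrt N%:R * tilt p bb hb t).
pose b := (renorm m N)^-1 * expR (- eta * N%:R + 2 * C * Num.sqrt N%:R).
have sc0 := renorm_gt0 m N.
have -> : N.+1%:R ^+ n.+1 * expR (- eta * N%:R + 2 * C * Num.sqrt N%:R) =
   renorm m N * (N.+1%:R ^+ n.+1 * b).
  by rewrite /b; field; rewrite gt_eqF.
rewrite ler_pM2l//; under eq_bigr do rewrite weightE//.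
apply: (@sum_types_le R n.+1 N N0 O G).
- by move=> t; exact: expR_ge0.
- by rewrite mulr_ge0 ?expR_ge0// invr_ge0 ltW.
move=> X OX; have sX := xbar_simplex R N0 X; set t := xbar R X in OX sX *.
rewrite /b /renorm -expRN -!expRD ler_expR.
have H1 := Oeta t OX sX; have H2 := CP t sX; have H3 := CP m sm.
have r0 : 0 <= Num.sqrt N%:R :> R by exact: sqrtr_ge0.
move: H2 H3; rewrite !ler_norml => /andP[_ H2] /andP[H3 _].
have H4 : N%:R * energy p beta h t <= N%:R * (energy p beta h m - eta).
  by rewrite ler_wpM2l// ltW.
have H5 : Num.sqrt N%:R * (tilt p bb hb t - tilt p bb hb m) <= Num.sqrt N%:R * (2 * C).
  by rewrite ler_wpM2l//; lra.
have -> : - N%:R * neg_entropy t = - (N%:R * neg_entropy t) by rewrite mulNr.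
have -> : - eta * N%:R = - (N%:R * eta) by rewrite mulNr mulrC.
have -> : 2 * C * Num.sqrt N%:R = Num.sqrt N%:R * (2 * C) by rewrite mulrC.
by move: H4 H5; rewrite !mulrBr !mulrDr; lra.
Unshelve. all: by end_near. Qed.

End weights.

(** * Sums over compositions as integrals *)

Section cells.
Variables (R : realType) (n : nat) (s : R) (sigma : 'S_n.+1).
Hypothesis s01 : 0 <= s < 1.
Variable L : lebesgue_space R n.
Local Notation T := (ls_sort L).
Local Notation mu := (ls_mu L).
Local Notation co := (@ls_co R n L).
Local Notation m := (perm_xs s sigma).
Local Notation slot := (slot sigma).
Local Notation slot0 := (slot0 sigma).

Definition corner N (X : config n.+1 N) (j : 'I_n) : R :=
  Num.sqrt N%:R * (xbar R X (slot j) ord0 - m (slot j) ord0).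

(** The cubes of side 1 / sqrt N with a corner at the rescaled composition
sqrt N (xbar X - m), read in the free coordinates. Configurations of the same
composition share their cube, those of different compositions have disjoint
cubes, and every point of R^n eventually lies in one. A sum over configurations
thus becomes the integral of a step function. *)
Definition in_cell N (X : config n.+1 N) (x : T) : bool :=
  [forall j, corner X j <= co x j < corner X j + (Num.sqrt N%:R)^-1].

Let side N (X : config n.+1 N) (j : 'I_n) (y : R) : R :=
  \1_(`[corner X j, corner X j + (Num.sqrt N%:R)^-1[%classic) y.

Lemma in_cellE N (X : config n.+1 N) x : (in_cell X x)%:R = \prod_j side X j (co x j).
Proof.
have sE j : side X j (co x j) =
    (corner X j <= co x j < corner X j + (Num.sqrt N%:R)^-1)%R%:R.
  by rewrite /side indicE; congr ((nat_of_bool _)%:R); rewrite mem_setE in_itv.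
have [/forallP H|] := boolP (in_cell X x).
  by rewrite big1// => j _; rewrite sE H.
move=> /forallPn[j /negbTE jN]; rewrite (bigD1 j)//= sE jN mul0r//.
Qed.

Lemma measurable_side N (X : config n.+1 N) j : measurable_fun setT (side X j).
Proof. by apply: measurable_indic; exact: measurable_itv. Qed.

Lemma measurable_in_cell N (X : config n.+1 N) :
  measurable_fun [set: T] (fun x => (in_cell X x)%:R : R).
Proof.
under eq_fun do rewrite in_cellE.
apply: measurable_prod => j _.
exact: (measurableT_comp (measurable_side X j) (ls_meas j)).
Qed.

Lemma integral_in_cell N (X : config n.+1 N) : (0 < N)%N ->
  (\int[mu]_x ((in_cell X x)%:R)%:E = ((Num.sqrt N%:R)^-1 ^+ n)%:E)%E.
Proof.
move=> N0.
have r0 : 0 < (Num.sqrt N%:R)^-1 :> R by rewrite invr_gt0 sqrtr_gt0 ltr0n.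
under eq_integral do rewrite in_cellE.
rewrite (ls_prod L (g := side X)); last 2 first.
- by move=> j y; rewrite /side indicE.
- exact: measurable_side.
rewrite (eq_bigr (fun=> ((Num.sqrt N%:R)^-1)%:E)).
  by rewrite prodEFin prodr_const card_ord.
move=> j _; rewrite /side integral_indic//= setIT lebesgue_measure_itv/=.
by rewrite lte_fin ltrDl r0 -EFinD addrAC subrr add0r.
Qed.

(** Counts are integers, so two rescaled compositions closer than the mesh
coincide. *)
Lemma corner_inj N (X Y : config n.+1 N) : (0 < N)%N ->
  (forall j, `|corner X j - corner Y j| < (Num.sqrt N%:R)^-1) -> xbar R X == xbar R Y.
Proof.
move=> N0 H; have NR : 0 < N%:R :> R by rewrite ltr0n.
have r0 : 0 < Num.sqrt N%:R :> R by rewrite sqrtr_gt0.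
have cE j : count X (slot j) = count Y (slot j).
  have := H j; rewrite /corner -mulrBr opprB addrA subrK !xbarE// -mulrBl normrM.
  rewrite gtr0_norm// normrM [`|_^-1|]gtr0_norm ?invr_gt0//.
  have E : Num.sqrt N%:R * N%:R^-1 = (Num.sqrt N%:R)^-1 :> R.
    rewrite -[X in X^-1](@sqr_sqrtr R)// expr2 invfM mulrA divff ?gt_eqF// mul1r//.
  rewrite mulrCA E -{2}[(Num.sqrt _)^-1]mul1r ltr_pM2r ?invr_gt0//.
  have -> : ((count X (slot j))%:R - (count Y (slot j))%:R : R) =
     ((count X (slot j))%:Z - (count Y (slot j))%:Z)%:~R by rewrite intrB.
  by rewrite -intr_norm -[X in _ < X]/(1%:~R) ltr_int => ?; lia.
apply/xbar_eqP => // r; have [->|[j ->]] := slotP sigma r; last by rewrite cE.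
have sumE (Z : config n.+1 N) : (count Z slot0 + \sum_j count Z (slot j) = N)%N.
  rewrite -[RHS](count_sum Z) (reindex_inj (@perm_inj _ (sigma^-1)%g)).
  by rewrite big_ord_recl.
have := etrans (sumE X) (esym (sumE Y)); under eq_bigr do rewrite cE.
by move=> /addIn.
Qed.

Lemma in_cell_unique N (X Y : config n.+1 N) x : (0 < N)%N ->
  in_cell X x -> in_cell Y x -> xbar R X == xbar R Y.
Proof.
move=> N0 /forallP HX /forallP HY; apply: corner_inj => // j.
have := HX j; have := HY j; set a := corner X j; set b := corner Y j.
move=> /andP[? ?] /andP[? ?]; rewrite ltr_norml; apply/andP; split; lra.
Qed.

Definition step_fun N (g : 'cV[R]_n.+1 -> R) (x : T) : R :=
  \sum_(X : config n.+1 N) g (xbar R X) * (in_cell X x)%:R.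

(** The nonzero terms are those of the configurations with the composition
of X. *)
Lemma step_funE N g x (X : config n.+1 N) : (0 < N)%N -> in_cell X x ->
  step_fun N g x = g (xbar R X) * type_size R X.
Proof.
move=> N0 Xx; rewrite /step_fun /type_size mulr_natr -sumr_const.
rewrite [RHS]big_mkcond /=; apply: eq_bigr => Y _; rewrite inE.
case: ifPn => [YX|].
  have -> : in_cell Y x.
    move: Xx; rewrite /in_cell /corner => /forallP H; apply/forallP => j.
    by have := H j; rewrite (eqP YX).
  by rewrite mulr1 (eqP YX).
by apply: contraNeq; rewrite mulf_eq0 negb_or pnatr_eq0 eqb0 negbK =>
  /andP[_ Yx]; exact: in_cell_unique Yx Xx.
Qed.

Lemma step_fun0 N g x : (forall X : config n.+1 N, ~~ in_cell X x) -> step_fun N g x = 0.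
Proof. by move=> H; rewrite /step_fun big1// => X _; rewrite (negbTE (H X)) mulr0. Qed.

Lemma measurable_step_fun N g : measurable_fun [set: T] (step_fun N g).
Proof.
apply: measurable_sum => X; apply: measurable_funM => //; exact: measurable_in_cell.
Qed.

Lemma integral_step_fun N g : (0 < N)%N ->
  (\int[mu]_x (step_fun N g x)%:E =
   (\sum_(X : config n.+1 N) g (xbar R X) * (Num.sqrt N%:R)^-1 ^+ n)%:E)%E.
Proof.
move=> N0; rewrite -sumEFin.
under eq_integral do rewrite -sumEFin.
have ic (X : config n.+1 N) : mu.-integrable setT (fun x => ((in_cell X x)%:R : R)%:E).
  apply/integrableP; split; first exact/measurable_EFinP/measurable_in_cell.
  under eq_integral do rewrite /= ger0_norm//.
  by rewrite integral_in_cell// ltry.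
rewrite integral_sum//; last first.
  by move=> X; under eq_fun do rewrite EFinM; exact: integrableZl.
apply: eq_bigr => X _; under eq_integral do rewrite EFinM.
by rewrite integralZl// integral_in_cell// EFinM.
Qed.

(** The counts are N m + sqrt N x rounded down at the slots, and slot0
receives the remaining sites. This is possible as soon as sqrt N m dominates x,
because the entries of m are positive. *)
Lemma cell_exists x : simplex m -> exists N0, forall N, (N0 <= N)%N ->
  exists X : config n.+1 N, in_cell X x.
Proof.
move=> gm; have m0 r : 0 < m r ord0 by exact: perm_xs_gt0.
pose Sx := \sum_j `|co x j|.
pose mm := \big[Order.min/1]_r m r ord0.
have mm0 : 0 < mm by apply: lt_bigmin => // r _; exact: m0.
have : \forall N \near \oo, (Num.sqrt N%:R)^-1 * (1 + Sx) <= mm.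
  have : (Num.sqrt (n%:R : R))^-1 * (1 + Sx) @[n --> \oo] --> 0.
    rewrite -[X in _ --> X](mul0r (1 + Sx)); apply: cvgM; last exact: cvg_cst.
    exact: inv_sqrtn_cvg0.
  by move=> /cvgr_le; exact.
move=> [N0 _ HN]; exists (maxn 1 N0) => N; rewrite geq_max => /andP[N1 NN0].
have NR : 0 < N%:R :> R by rewrite ltr0n.
have [r [rE r0 NE]] : exists r : R, [/\ Num.sqrt N%:R = r, 0 < r & N%:R = r * r].
  exists (Num.sqrt N%:R); split; rewrite ?sqrtr_gt0//.
  by rewrite -expr2 sqr_sqrtr.
have Sx0 : 0 <= Sx by exact: sumr_ge0.
have HS : Sx <= r * mm.
  have := HN N NN0; rewrite /= rE ler_pdivrMl// => H; apply: le_trans H.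
  by rewrite lerDr.
have mle i : mm <= m i ord0 by exact: bigmin_le_cond.
have rmle i : r * mm <= r * m i ord0 by rewrite ler_pM2l.
have jSx j : `|co x j| <= Sx by rewrite /Sx (bigD1 j)//= lerDl sumr_ge0.
pose z j := N%:R * m (slot j) ord0 + r * co x j.
have z0 j : 0 <= z j.
  rewrite /z NE -mulrA -mulrDr mulr_ge0 ?(ltW r0)//.
  have := rmle (slot j); have := jSx j; rewrite ler_norml => /andP[+ _].
  by lra.
pose k j := Num.truncn (z j).
have kP j : (k j)%:R <= z j < (k j).+1%:R by apply: truncn_itv.
have sumk : (\sum_j k j <= N)%N.
  rewrite -(ler_nat R) natr_sum.
  apply: (@le_trans _ _ (\sum_j z j)); first by apply: ler_sum => j _; have /andP[] := kP j.
  rewrite big_split /= -!mulr_sumr.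
  have m1 : m slot0 ord0 + \sum_j m (slot j) ord0 = 1.
    by have [_ <-] := gm; rewrite (sum_slots sigma).
  have -> : \sum_j m (slot j) ord0 = 1 - m slot0 ord0 by rewrite -m1; ring.
  have : r * \sum_i co x i <= N%:R * m slot0 ord0.
    rewrite NE -mulrA ler_pM2l//.
    have := rmle slot0.
    have : \sum_i co x i <= Sx by apply: ler_sum => j _; exact: ler_norm.
    by lra.
  by lra.
pose kk r : nat := if unlift ord0 (sigma r) is Some j then k j else (N - \sum_j k j)%N.
have kk0 : kk slot0 = (N - \sum_j k j)%N by rewrite /kk permKV unlift_none.
have kkj j : kk (slot j) = k j by rewrite /kk permKV liftK.
have sumkk : (\sum_r kk r = N)%N.
  rewrite (reindex_inj (@perm_inj _ (sigma^-1)%g)) big_ord_recl.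
  transitivity (kk slot0 + \sum_j kk (slot j))%N => //.
  have -> : (\sum_j kk (slot j) = \sum_j k j)%N by apply: eq_bigr => j _; exact: kkj.
  by rewrite kk0 subnK.
have [X XP] := count_surj sumkk.
exists X; apply/forallP => j; rewrite /corner xbarE// XP kkj.
have /andP[k1 k2] := kP j.
rewrite rE.
have -> : r * ((k j)%:R / N%:R - m (slot j) ord0) =
   ((k j)%:R - N%:R * m (slot j) ord0) / r.
  by rewrite NE; field; rewrite gt_eqF.
have -> : ((k j)%:R - N%:R * m (slot j) ord0) / r + r^-1 =
   ((k j)%:R - N%:R * m (slot j) ord0 + 1) / r by ring.
apply/andP; split.
  by rewrite ler_pdivrMr// lerBlDl [_ * r]mulrC.
rewrite ltr_pdivlMr// -natr1 in k2 *.
by move: k2; rewrite /z; lra.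
Qed.

End cells.

(** * Gibbs weights at distance of order 1 / sqrt N from a maximizer *)

Section euclid.
Variables (R : realType) (q : nat).
Implicit Types t u : 'cV[R]_q.

Lemma le_eucl_dist t u r : `|t r ord0 - u r ord0| <= eucl_dist t u.
Proof.
rewrite -sqrtr_sqr ler_wsqrtr// (bigD1 r)//= lerDl sumr_ge0// => i _.
exact: sqr_ge0.
Qed.

Lemma eucl_dist_cvg0 (y : nat -> 'cV[R]_q) u :
  (forall r, y N r ord0 @[N --> \oo] --> u r ord0) ->
  eucl_dist (y N) u @[N --> \oo] --> 0.
Proof.
move=> yu; rewrite -[X in _ --> X]sqrtr0 /eucl_dist.
apply: continuous_cvg; first exact: sqrt_continuous.
have E : 0 = \sum_(r < q) (u r ord0 - u r ord0) ^+ 2 :> R.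
  by rewrite big1// => r _; rewrite subrr expr0n.
rewrite [X in _ --> X]E.
apply: cvg_sumr => r.
have H : y N r ord0 - u r ord0 @[N --> \oo] --> u r ord0 - u r ord0.
  by apply: cvgB => //; exact: cvg_cst.
by rewrite expr2; under eq_fun do rewrite expr2; exact: cvgM.
Qed.

End euclid.

Section local_expansion.
Variables (R : realType) (n p : nat) (beta h bb hb s : R) (sigma : 'S_n.+1).
Hypotheses (n0 : (0 < n)%N) (p2 : (2 <= p)%N) (beta0 : 0 < beta).
Hypothesis s01 : 0 <= s < 1.
Local Notation q := n.+1.
Local Notation m := (perm_xs s sigma).
Local Notation en := (energy p beta h).
Local Notation pt := (tilt p bb hb).
Hypothesis gm : global_max p beta h m.
Hypothesis negdef : forall t, zero_sum t -> t != 0 -> Qform p beta m t < 0.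

Let m0 r : 0 < m r ord0. Proof. exact: perm_xs_gt0. Qed.

(** The estimates behind the domination: a quadratic decay of the energy and
a Lipschitz bound for tilt. *)
Lemma local_bounds : exists d c C, [/\ 0 < d, 0 < c, 0 <= C &
  forall v, zero_sum v -> (forall r, `|v r ord0| <= d) ->
  [/\ en (m + v) - en m <= - (c * \sum_r v r ord0 ^+ 2),
      `|pt (m + v) - pt m| <= C * \sum_r `|v r ord0| &
      forall r, m r ord0 / 2 <= (m + v) r ord0]].
Proof.
have [c0 c00 c0P] := Qform_coercive n0 p2 beta0 s01 negdef.
have c04 : 0 < c0 / 4 by rewrite divr_gt0.
have [d1 d10 d1P] := energy_taylor beta h p2 m0 c04.
have [C0 [d2 [C00 d20 d2P]]] := tilt_taylor bb hb p2 m0.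
pose mm := \big[Order.min/1]_r (m r ord0 / 2).
have mm0 : 0 < mm by apply: lt_bigmin => // r _; rewrite divr_gt0.
pose C := C0 + \sum_r `|slope p bb hb m r ord0|.
pose d := Num.min (Num.min d1 d2) (Num.min 1 mm).
have dd1 : d <= d1 by rewrite !ge_min lexx.
have dd2 : d <= d2 by rewrite !ge_min lexx orbT.
have d1' : d <= 1 by rewrite !ge_min lexx !orbT.
have dmm : d <= mm by rewrite !ge_min lexx !orbT.
exists d, (c0 / 4), C; split => //.
- by rewrite !lt_min d10 d20 ltr01.
- by rewrite addr_ge0// sumr_ge0.
move=> v v0 vd; split.
- have := d1P v (fun r => le_trans (vd r) dd1).
  rewrite (denergy0 p2 gm m0 v0) subr0 ler_norml => /andP[_ H].
  have := c0P v v0; set Q := Qform _ _ _ _ in H *; set S := \sum_r _ in H *.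
  lra.
- have H := d2P v (fun r => le_trans (vd r) dd2).
  have H1 : `|dot (slope p bb hb m) v| <=
      (\sum_r `|slope p bb hb m r ord0|) * \sum_r `|v r ord0|.
    rewrite /dot; apply: le_trans (ler_norm_sum _ _ _) _.
    rewrite mulr_suml; apply: ler_sum => r _; rewrite normrM ler_wpM2l//.
    by rewrite (bigD1 r)//= lerDl sumr_ge0.
  have H2 : C0 * \sum_r v r ord0 ^+ 2 <= C0 * \sum_r `|v r ord0|.
    rewrite ler_wpM2l//; apply: ler_sum => r _.
    rewrite -real_normK ?num_real// expr2 ler_piMr//.
    exact: le_trans (vd r) d1'.
  rewrite /C mulrDl.
  have := ler_normD (pt (m + v) - pt m - dot (slope p bb hb m) v) (dot (slope p bb hb m) v).
  by rewrite subrK; lra.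
- move=> r; rewrite [leRHS]mxE; have : mm <= m r ord0 / 2 by exact: bigmin_le_cond.
  by have := vd r; rewrite ler_norml => /andP[+ _]; lra.
Qed.

(** The logarithm of the total weight of the composition of X, multiplied by
renorm and by sqrt N ^ n. *)
Definition local_exponent N (X : config q N) : R :=
  N%:R * (en (xbar R X) - en m) + Num.sqrt N%:R * (pt (xbar R X) - pt m)
  + (stirling R N - \sum_r stirling R (count X r)) - 2^-1 * \sum_r ln (xbar R X r ord0).

(** The factor sqrt N ^ n, the inverse volume of a cell, cancels the term
- (q - 1) / 2 ln N of Stirling's formula. *)
Lemma weight_type_size N (X : config q N) : (0 < N)%N -> (forall r, 0 < count X r)%N ->
  Num.sqrt N%:R ^+ n * renorm p beta h bb hb m N * weight p beta h bb hb X * type_size R X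
  = expR (local_exponent X).
Proof.
move=> N0 c0; have NR : 0 < N%:R :> R by rewrite ltr0n.
rewrite weightE// type_sizeE// /renorm.
have -> : Num.sqrt N%:R ^+ n = expR (n%:R / 2 * ln N%:R) :> R.
  have {1}-> : Num.sqrt N%:R = expR (2^-1 * ln N%:R) :> R.
    apply/eqP; rewrite -(@eqrXn2 _ 2)// ?sqrtr_ge0 ?expR_ge0// sqr_sqrtr ?ltW//.
    by rewrite -expRM_natl mulrA divff// mul1r lnK.
  by rewrite -expRM_natl mulrA.
rewrite -!expRD; congr expR.
have -> : q%:R - 1 = n%:R :> R by rewrite -natr1 addrK.
rewrite /local_exponent; ring.
Qed.

Lemma simplex_diff t : simplex t -> zero_sum (t - m).
Proof.
move=> [_ t1]; have [[_ m1] _] := gm; rewrite /zero_sum /=.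
under eq_bigr do rewrite mxE [X in _ + X]mxE.
by rewrite sumrB t1 m1 subrr.
Qed.

End local_expansion.

Lemma cvg_close (R : realType) (a b c : nat -> R) (l : R) :
  (\forall N \near \oo, `|a N - b N| <= c N) -> c N @[N --> \oo] --> 0 ->
  b N @[N --> \oo] --> l -> a N @[N --> \oo] --> l.
Proof.
move=> ab c0 bl.
have ab0 : a N - b N @[N --> \oo] --> 0.
  apply: (@squeeze_cvgr _ _ _ _ (fun N => - c N) c); last exact: c0.
    by apply: filterS ab => N; rewrite ler_norml.
  by rewrite -[X in _ --> X]oppr0; exact: cvgN.
have -> : a = (fun N => (a N - b N) + b N) by apply/funext => N; rewrite subrK.
by rewrite -[X in _ --> X]add0r; exact: cvgD.
Qed.

Section pointwise.
Variables (R : realType) (n p : nat) (beta h bb hb s : R) (sigma : 'S_n.+1).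
Hypotheses (n0 : (0 < n)%N) (p2 : (2 <= p)%N) (beta0 : 0 < beta).
Hypothesis s01 : 0 <= s < 1.
Local Notation q := n.+1.
Local Notation m := (perm_xs s sigma).
Local Notation en := (energy p beta h).
Local Notation pt := (tilt p bb hb).
Hypothesis gm : global_max p beta h m.
Variables (lS : R).
Hypothesis stirling_lim : stirling R N @[N --> \oo] --> lS.

Let m0 r : 0 < m r ord0. Proof. exact: perm_xs_gt0. Qed.

(** The second order expansion of the energy at scale 1 / sqrt N gives the
quadratic form, the first order expansion of tilt gives the linear one. The
multinomial coefficient contains one factorial in the numerator and q in the
denominator, whence lS - q lS = - n lS. *)
Lemma local_exponent_cvg (X : forall N, config q N) (z : 'cV[R]_q) : zero_sum z ->
  (forall r, Num.sqrt N%:R * (xbar R (X N) r ord0 - m r ord0) @[N --> \oo] --> z r ord0) ->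
  (forall r, xbar R (X N) r ord0 @[N --> \oo] --> m r ord0) /\
  local_exponent p beta h bb hb s sigma (X N) @[N --> \oo] -->
    Qform p beta m z / 2 + dot (slope p bb hb m) z
    - n%:R * lS - 2^-1 * \sum_r ln (m r ord0).
Proof.
move=> z0 Xz.
pose y N : 'cV[R]_q := Num.sqrt N%:R *: (xbar R (X N) - m).
have yE N r : y N r ord0 = Num.sqrt N%:R * (xbar R (X N) r ord0 - m r ord0).
  rewrite /y [LHS]mxE; congr (_ * _); rewrite [LHS]mxE; congr (_ + _).
  by rewrite [LHS]mxE.
have yz r : y N r ord0 @[N --> \oo] --> z r ord0.
  by under eq_fun do rewrite yE; exact: Xz.
pose ri N : R := (Num.sqrt N%:R)^-1.
have ri0 : ri N @[N --> \oo] --> 0 by exact: inv_sqrtn_cvg0.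
have Npos : \forall N \near \oo, (0 < N)%N by exists 1%N.
have vE N : (0 < N)%N -> xbar R (X N) = m + ri N *: y N.
  move=> N0; rewrite /y scalerA mulVf ?scale1r; first by rewrite addrC subrK.
  by rewrite gt_eqF// sqrtr_gt0 ltr0n.
have ry0 r : ri N * y N r ord0 @[N --> \oo] --> 0.
  by rewrite -[X in _ --> X](mul0r (z r ord0)); exact: cvgM.
have tm r : xbar R (X N) r ord0 @[N --> \oo] --> m r ord0.
  apply: (@cvg_close _ _ (fun N => m r ord0 + ri N * y N r ord0) (fun=> 0)).
  - near=> N; rewrite vE; last by near: N.
    by rewrite !mxE subrr normr0.
  - exact: cvg_cst.
  - by rewrite -[X in _ --> X]addr0; apply: cvgD => //; exact: cvg_cst.
split => //.
pose S N := \sum_r y N r ord0 ^+ 2.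
have ySq r : y N r ord0 ^+ 2 @[N --> \oo] --> z r ord0 ^+ 2.
  by rewrite expr2; under eq_fun do rewrite expr2; exact: cvgM.
have Scvg : S N @[N --> \oo] --> \sum_r z r ord0 ^+ 2.
  by apply: cvg_sumr => r; exact: ySq.
have small_v d : 0 < d -> \forall N \near \oo, forall r, `|ri N * y N r ord0| <= d.
  move=> d0; apply: filter_forall => r.
  have := ry0 r; move=> /cvgr0Pnorm_le; exact.
have vS N : (0 < N)%N -> N%:R * \sum_r (ri N *: y N) r ord0 ^+ 2 = S N.
  move=> N0; rewrite mulr_sumr; apply: eq_bigr => r _.
  rewrite mxE exprMn /ri exprVn sqr_sqrtr// mulrA divff ?mul1r//.
  by rewrite pnatr_eq0 -lt0n.
have z1 N : (0 < N)%N -> zero_sum (ri N *: y N).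
  move=> N0; have := simplex_diff gm (xbar_simplex R N0 (X N)).
  by rewrite vE// addrAC subrr add0r.
have en_cvg : N%:R * (en (xbar R (X N)) - en m) @[N --> \oo] --> Qform p beta m z / 2.
  have Qcvg : Qform p beta m (y N) / 2 @[N --> \oo] --> Qform p beta m z / 2.
    apply: cvgM; last exact: cvg_cst.
    rewrite QformE; under eq_fun do rewrite QformE.
    by apply: cvg_sumr => r; apply: cvgM; [exact: cvg_cst|exact: ySq].
  pose D N := N%:R * (en (xbar R (X N)) - en m) - Qform p beta m (y N) / 2.
  have D0 : D N @[N --> \oo] --> 0.
    apply/cvgr0Pnorm_le => e e0.
    have S1 : 0 < \sum_r z r ord0 ^+ 2 + 1 :> R.
      by rewrite ltr_wpDl// sumr_ge0// => r _; exact: sqr_ge0.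
    have e1 : 0 < e / (\sum_r z r ord0 ^+ 2 + 1) by rewrite divr_gt0.
    have [d d0 dP] := energy_taylor beta h p2 m0 e1.
    have Slt : \forall N \near \oo, S N < \sum_r z r ord0 ^+ 2 + 1.
      by apply: (cvgr_lt _ Scvg); rewrite ltrDl.
    near=> N.
    have N0 : (0 < N)%N by near: N.
    have vd : forall r, `|ri N * y N r ord0| <= d by near: N; exact: small_v.
    have := dP (ri N *: y N); rewrite (denergy0 p2 gm m0 (z1 N N0)) subr0 -vE// => H.
    have {}H := H (fun r => ltac:(by rewrite mxE; exact: vd)).
    have -> : D N = N%:R * (en (xbar R (X N)) - en m - Qform p beta m (ri N *: y N) / 2).
      rewrite /D QformZ /ri exprVn sqr_sqrtr// [RHS]mulrBr; congr (_ - _).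
      by field; rewrite pnatr_eq0 -lt0n.
    rewrite normrM ger0_norm//; apply: (@le_trans _ _ (e / (\sum_r z r ord0 ^+ 2 + 1) * S N)).
      by rewrite -(vS N N0) mulrCA ler_wpM2l.
    rewrite mulrAC ler_pdivrMr// ler_wpM2l ?ltW//.
    by near: N.
  have -> : (fun N => N%:R * (en (xbar R (X N)) - en m)) =
      (fun N => D N + Qform p beta m (y N) / 2).
    by apply/funext => N; rewrite /D subrK.
  by rewrite -[X in _ --> X]add0r; exact: cvgD.
have pt_cvg : Num.sqrt N%:R * (pt (xbar R (X N)) - pt m) @[N --> \oo] -->
    dot (slope p bb hb m) z.
  have [C [d [C0 d0 dP]]] := tilt_taylor bb hb p2 m0.
  apply: (@cvg_close _ _ (fun N => dot (slope p bb hb m) (y N)) (fun N => C * S N * ri N)).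
  - near=> N.
    have N0 : (0 < N)%N by near: N.
    have NR : 0 < N%:R :> R by rewrite ltr0n.
    have r0 : 0 < Num.sqrt N%:R :> R by rewrite sqrtr_gt0.
    have vd : forall r, `|ri N * y N r ord0| <= d by near: N; exact: small_v.
    have := dP (ri N *: y N) (fun r => ltac:(by rewrite mxE; exact: vd)).
    rewrite -vE// => H.
    have -> : dot (slope p bb hb m) (y N) =
        Num.sqrt N%:R * dot (slope p bb hb m) (ri N *: y N).
      rewrite /dot mulr_sumr; apply: eq_bigr => r _.
      by rewrite [(ri N *: y N) r ord0]mxE /ri; field; rewrite gt_eqF.
    rewrite -mulrBr normrM gtr0_norm// -ler_pdivlMl//.
    apply: le_trans H _; rewrite -(vS N N0) le_eqVlt; apply/orP; left; apply/eqP.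
    have E : N%:R = (ri N)^-1 * (ri N)^-1 :> R.
      by rewrite /ri invrK -expr2 sqr_sqrtr.
    have ri_n0 : ri N != 0 by rewrite invr_eq0 gt_eqF.
    rewrite -/(ri N) E; move: (\sum_r _) => T.
    by move: (ri N) ri_n0 => u u0; field.
  - rewrite -[X in _ --> X](mulr0 (C * \sum_r z r ord0 ^+ 2)); apply: cvgM => //.
    by apply: cvgM => //; exact: cvg_cst.
  - rewrite /dot; apply: cvg_sumr => r; apply: cvgM => //; exact: cvg_cst.
have st_cvg r : stirling R (count (X N) r) @[N --> \oo] --> lS.
  apply: cvg_comp stirling_lim; apply/cvgnyPge => M.
  have m2 : 0 < m r ord0 / 2 by rewrite divr_gt0.
  have H1 : \forall N \near \oo, m r ord0 / 2 <= xbar R (X N) r ord0.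
    by apply: (cvgr_ge _ (tm r)); have := m0 r; lra.
  have H2 : \forall N \near \oo, M%:R * N%:R^-1 <= m r ord0 / 2 :> R.
    have : M%:R * (k%:R^-1 : R) @[k --> \oo] --> (M%:R * 0 : R).
      by apply: cvgM; [exact: cvg_cst|exact: invn_cvg0].
    by rewrite mulr0 => /cvgr_le; exact.
  near=> N.
  have N0 : (0 < N)%N by near: N.
  have NR : 0 < N%:R :> R by rewrite ltr0n.
  rewrite -(ler_nat R) xbar_count// mulrC -ler_pdivrMr//.
  by apply: (@le_trans _ _ (m r ord0 / 2)); near: N.
have ln_cvg r : ln (xbar R (X N) r ord0) @[N --> \oo] --> ln (m r ord0).
  by apply: continuous_cvg => //; exact: continuous_ln.
apply: cvgB; last first.
  by apply: cvgM; [exact: cvg_cst|apply: cvg_sumr => r].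
have -> : Qform p beta m z / 2 + dot (slope p bb hb m) z - n%:R * lS =
   Qform p beta m z / 2 + dot (slope p bb hb m) z + (lS - \sum_(r < q) lS).
  by rewrite sumr_const card_ord -[lS *+ _]mulr_natl -natr1; ring.
apply: cvgD; first exact: cvgD.
apply: cvgB => //; apply: cvg_sumr => r; exact: st_cvg.
Unshelve. all: by end_near. Qed.

End pointwise.

Section inner.
Variables (R : realType) (n p : nat) (beta h bb hb s : R) (sigma : 'S_n.+1).
Hypotheses (n0 : (0 < n)%N) (p2 : (2 <= p)%N) (beta0 : 0 < beta).
Hypothesis s01 : 0 <= s < 1.
Local Notation q := n.+1.
Local Notation m := (perm_xs s sigma).
Local Notation slot := (slot sigma).
Local Notation slot0 := (slot0 sigma).
Local Notation en := (energy p beta h).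
Local Notation pt := (tilt p bb hb).
Hypothesis gm : global_max p beta h m.
Hypothesis negdef : forall t, zero_sum t -> t != 0 -> Qform p beta m t < 0.
Variable L : lebesgue_space R n.
Local Notation T := (ls_sort L).
Local Notation co := (@ls_co R n L).

Let m0 r : 0 < m r ord0. Proof. exact: perm_xs_gt0. Qed.

Definition weight_fun N (t : 'cV[R]_q) : R :=
  expR ((beta + bb / Num.sqrt N%:R) * N%:R * \sum_r t r ord0 ^+ p
        + N%:R * (h + hb / Num.sqrt N%:R) * dot e1 t).

Definition local_term (d : R) (phi : nat -> 'cV[R]_q -> R) N (t : 'cV[R]_q) : R :=
  Num.sqrt N%:R ^+ n * renorm p beta h bb hb m N * weight_fun N t *
  ((eucl_dist t m < d)%R%:R * phi N (Num.sqrt N%:R *: (t - m))).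

Lemma step_local_term d phi N (X : config q N) (x : T) : (0 < N)%N ->
  (forall r, 0 < count X r)%N -> in_cell s sigma X x ->
  step_fun s sigma N (local_term d phi N) x =
  expR (local_exponent p beta h bb hb s sigma X) *
   ((eucl_dist (xbar R X) m < d)%R%:R * phi N (Num.sqrt N%:R *: (xbar R X - m))).
Proof.
move=> N0 c0 Xx; rewrite (step_funE s01 (local_term d phi N) N0 Xx).
rewrite -(weight_type_size p beta h bb hb s sigma N0 c0).
by rewrite mulrAC.
Qed.

(** On the support of the step function the exponent is at most a constant
plus - c |y|^2 + 2 C |y|_1, for y the corner of the cell of x. The quadratic
term wins, and replacing y by x, at distance at most 1 in each coordinate, costs
a constant; both costs are collected in k. *)
Lemma domination : exists d0 K k w, [/\ 0 < d0, 0 < w & forall d phi M N x,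
  d <= d0 -> (forall y, `|phi N y| <= M) -> (0 < N)%N ->
  `|step_fun s sigma N (local_term d phi N) x| <=
    M * (K * \prod_(j < n) (expR k * bell ((co x j - 0) / w)))].
Proof.
have [d0 [c [C [d00 c0 C0 bd]]]] := local_bounds bb hb n0 p2 beta0 s01 gm negdef.
pose k2 : R := - (2^-1 * \sum_r ln (m r ord0 / 2)).
pose k := c / 2 + 2 * C ^+ 2 / c.
pose w := Num.sqrt (2 / c).
have w0 : 0 < w by rewrite sqrtr_gt0 divr_gt0.
exists d0, (expR (1 + k2)), k, w; split => // d phi M N x dd0 phiM N0.
have NR : 0 < N%:R :> R by rewrite ltr0n.
have r0 : 0 < Num.sqrt N%:R :> R by rewrite sqrtr_gt0.
have M0 : 0 <= M by apply: le_trans (phiM 0); exact: normr_ge0.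
have rhs0 : 0 <= expR (1 + k2) * \prod_(j < n) (expR k * bell ((co x j - 0) / w)).
  by rewrite mulr_ge0 ?expR_ge0// prodr_ge0// => j _; rewrite mulr_ge0 ?expR_ge0.
have [/existsP[X Xx]|] := boolP [exists X : config q N, in_cell s sigma X x]; last first.
  rewrite negb_exists => /forallP nX; rewrite step_fun0//.
  by rewrite normr0 mulr_ge0.
have [Xd|Xd] := ltP (eucl_dist (xbar R X) m) d; last first.
  rewrite (step_funE s01 (local_term d phi N) N0 Xx) /local_term ltNge Xd/= mul0r mulr0 mul0r normr0.
  by rewrite mulr_ge0.
pose v := xbar R X - m.
have tE : xbar R X = m + v by rewrite /v addrC subrK.
have v0 : zero_sum v := simplex_diff gm (xbar_simplex R N0 X).
have vE r : v r ord0 = xbar R X r ord0 - m r ord0.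
  by rewrite /v [LHS]mxE; congr (_ + _); rewrite [LHS]mxE.
have vd r : `|v r ord0| <= d0.
  by rewrite vE (le_trans (le_eucl_dist _ _ _))// (le_trans (ltW Xd)).
have [b1 b2 b3] := bd v v0 vd; rewrite -tE in b1 b2 b3.
have tpos r : 0 < xbar R X r ord0 by rewrite (lt_le_trans _ (b3 r))// divr_gt0.
have cpos r : (0 < count X r)%N.
  by rewrite -(ltr_nat R) xbar_count// mulr_gt0.
rewrite (step_local_term _ _ N0 cpos Xx) Xd mul1r normrM [X in X * _]ger0_norm ?expR_ge0// mulrC.
apply: ler_pM => //.
have prodE : \prod_(j < n) (expR k * bell ((co x j - 0) / w)) =
    expR (\sum_(j < n) (k - c / 4 * co x j ^+ 2)).
  rewrite expR_sum; apply: eq_bigr => j _; rewrite /bell -expRD; congr expR.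
  rewrite subr0 expr_div_n /w sqr_sqrtr ?divr_ge0 ?ltW//.
  by field; rewrite gt_eqF.
rewrite prodE -expRD ler_expR /local_exponent.
have st1 : stirling R N - \sum_r stirling R (count X r) <= 1.
  have /andP[_ sN] := stirling_bounds R N0.
  have : 0 <= \sum_r stirling R (count X r).
    by apply: sumr_ge0 => r _; have /andP[] := stirling_bounds R (cpos r).
  lra.
have ln1 : - (2^-1 * \sum_r ln (xbar R X r ord0)) <= k2.
  rewrite /k2 lerN2 ler_pM2l ?invr_gt0//; apply: ler_sum => r _.
  by rewrite ler_ln ?posrE// divr_gt0.
pose y j := corner s sigma X j.
have yE j : y j = Num.sqrt N%:R * v (slot j) ord0 by rewrite /y /corner vE.
have S2 : N%:R * (en (xbar R X) - en m) <= - (c * \sum_j y j ^+ 2).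
  apply: le_trans (ler_wpM2l (ltW NR) b1) _; rewrite mulrN lerN2 mulrCA ler_pM2l//.
  rewrite (sum_slots sigma) mulrDr.
  have -> : N%:R * \sum_j v (slot j) ord0 ^+ 2 = \sum_j y j ^+ 2.
    by rewrite mulr_sumr; apply: eq_bigr => j _; rewrite yE exprMn sqr_sqrtr ?ltW.
  by rewrite lerDr mulr_ge0 ?sqr_ge0 ?ltW.
have S1 : Num.sqrt N%:R * (pt (xbar R X) - pt m) <= \sum_j 2 * C * `|y j|.
  have : Num.sqrt N%:R * (pt (xbar R X) - pt m) <=
      Num.sqrt N%:R * (C * \sum_r `|v r ord0|).
    by rewrite ler_pM2l// (le_trans (ler_norm _)).
  move=> /le_trans; apply; rewrite (sum_slots sigma) mulrCA -mulr_sumr -mulrA.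
  rewrite [leRHS]mulrCA ler_wpM2l//.
  have -> : \sum_j `|y j| = Num.sqrt N%:R * \sum_j `|v (slot j) ord0|.
    by rewrite mulr_sumr; apply: eq_bigr => j _; rewrite yE normrM gtr0_norm.
  rewrite mulrCA ler_pM2l// mulr_natl mulr2n lerD2r.
  have -> : v slot0 ord0 = - \sum_j v (slot j) ord0.
    by apply/eqP; rewrite -subr_eq0 opprK -(sum_slots sigma (fun r => v r ord0)); apply/eqP.
  by rewrite normrN; exact: ler_norm_sum.
have S3 : - (c * \sum_j y j ^+ 2) + \sum_j 2 * C * `|y j| <=
    \sum_(j < n) (k - c / 4 * co x j ^+ 2).
  rewrite mulr_sumr -sumrN -big_split /=; apply: ler_sum => j _.
  have := forallP Xx j; rewrite -/(y j) => /andP[x1 x2].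
  have ri1 : (Num.sqrt N%:R)^-1 <= 1 :> R.
    rewrite invf_le1//; have : Num.sqrt 1 <= Num.sqrt N%:R :> R.
      by rewrite ler_wsqrtr// ler1n.
    by rewrite sqrtr1.
  have a1 : co x j ^+ 2 <= 2 * y j ^+ 2 + 2.
    have [e [-> e0 e1]] : exists e, [/\ co x j = y j + e, 0 <= e & e <= 1].
      by exists (co x j - y j); split; [ring|rewrite subr_ge0|lra].
    rewrite -subr_ge0; move: (y j) => yj.
    rewrite (_ : _ - _ = (yj - e) ^+ 2 + 2 * (1 - e ^+ 2)); last by ring.
    by rewrite addr_ge0 ?sqr_ge0// mulr_ge0// subr_ge0 expr_le1.
  have a2 : 2 * C * `|y j| <= c / 2 * y j ^+ 2 + 2 * C ^+ 2 / c.
    rewrite -[y j ^+ 2]real_normK ?num_real//.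
    rewrite -subr_ge0; set z := `|y j|.
    have -> : c / 2 * z ^+ 2 + 2 * C ^+ 2 / c - 2 * C * z = c / 2 * (z - 2 * C / c) ^+ 2.
      by field; rewrite gt_eqF.
    by rewrite mulr_ge0 ?sqr_ge0// divr_ge0 ?ltW.
  have a3 : c / 4 * co x j ^+ 2 <= c / 4 * (2 * y j ^+ 2 + 2).
    by rewrite ler_pM2l// divr_gt0.
  rewrite /k; move: a2 a3; set Y := y j ^+ 2; set Z := co x j ^+ 2.
  set W := 2 * C ^+ 2 / c; set V := 2 * C * `|y j|.
  have -> : c / 4 * (2 * Y + 2) = c / 2 * Y + c / 2 by field.
  have -> : c * Y = c / 2 * Y + c / 2 * Y by field.
  by lra.
lra.
Qed.

End inner.

(** * Laplace's method near a maximizer *)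

Section inner_limit.
Variables (R : realType) (n p : nat) (beta h bb hb s : R) (sigma : 'S_n.+1).
Hypotheses (n0 : (0 < n)%N) (p2 : (2 <= p)%N) (beta0 : 0 < beta).
Hypothesis s01 : 0 <= s < 1.
Local Notation q := n.+1.
Local Notation m := (perm_xs s sigma).
Local Notation slot := (slot sigma).
Local Notation slot0 := (slot0 sigma).
Local Notation A := (top_curv n p beta s).
Local Notation B := (low_curv n p beta s).
Hypothesis gm : global_max p beta h m.
Hypothesis negdef : forall t, zero_sum t -> t != 0 -> Qform p beta m t < 0.
Variables (lS : R).
Hypothesis stirling_lim : stirling R N @[N --> \oo] --> lS.
Variable L : lebesgue_space R n.
Local Notation T := (ls_sort L).
Local Notation mu := (ls_mu L).
Local Notation co := (@ls_co R n L).

Let m0 r : 0 < m r ord0. Proof. exact: perm_xs_gt0. Qed.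

Definition gauss_density (x : T) : R :=
  expR (- quad A B (co x) / 2 + dot (slope p bb hb m) (embed sigma (co x))).

(** The limit of the part of local_exponent that is constant in the rescaled
composition, exponentiated. *)
Definition amplitude : R := expR (- n%:R * lS - 2^-1 * \sum_r ln (m r ord0)).

(** Continuous convergence: phi N is evaluated at the rescaled composition,
which moves with N. *)
Definition cvg_along (phi : nat -> 'cV[R]_q -> R) (psi : 'cV[R]_q -> R) : Prop :=
  forall (y : nat -> 'cV[R]_q) (z : 'cV[R]_q), (forall r, y N r ord0 @[N --> \oo] --> z r ord0) ->
    phi N (y N) @[N --> \oo] --> psi z.

Definition inner_sum d (phi : nat -> 'cV[R]_q -> R) N : R :=
  renorm p beta h bb hb m N * \sum_(X : config q N)
    weight p beta h bb hb X *
    ((eucl_dist (xbar R X) m < d)%R%:R * phi N (Num.sqrt N%:R *: (xbar R X - m))).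

Lemma integrable_bells (k w : R) : 0 < w -> mu.-integrable setT
  (fun x => (\prod_(j < n) (expR k * bell ((co x j - 0) / w)))%:E).
Proof.
move=> w0.
have g0 (i : 'I_n) (y : R) : 0 <= expR k * bell ((y - 0) / w).
  by rewrite mulr_ge0 ?expR_ge0.
have mg (i : 'I_n) : measurable_fun [set: R] (fun y => expR k * bell ((y - 0) / w)).
  by apply: measurable_funM => //; exact: measurable_bell_aff.
apply/integrableP; split.
  apply/measurable_EFinP; apply: measurable_prod => j _.
  exact: (measurableT_comp (mg j) (ls_meas j)).
under eq_integral => x _.
  rewrite /= ger0_norm; last by apply: prodr_ge0 => j _; exact: g0.
  over.
rewrite (ls_prod L (g := fun _ y => expR k * bell ((y - 0) / w)))//.
have -> : (\int[lebesgue_measure]_y (expR k * bell ((y - 0) / w))%:E =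
   (expR k * (w / (Num.sqrt (pi *+ 2))^-1))%:E)%E.
  under eq_integral do rewrite EFinM.
  rewrite ge0_integralZl//=; first last.
  - by move=> y _; rewrite lee_fin bell_ge0.
  - by apply/measurable_EFinP; exact: measurable_bell_aff.
  have := @integral_bell R 0 w (fun=> 1%E) w0.
  under eq_integral do rewrite mul1e.
  by move=> ->//; rewrite gauss_expect1 mule1 EFinM.
by rewrite prodEFin ltry.
Qed.

(** The compositions whose cells contain x converge to embed x after
rescaling. *)
Lemma step_local_term_cvg d phi psi x : 0 < d -> cvg_along phi psi ->
  step_fun s sigma N (local_term p beta h bb hb s sigma d phi N) x @[N --> \oo] -->
  amplitude * psi (embed sigma (co x)) * gauss_density x.
Proof.
move=> d0 phipsi.
have [N0 HN0] := cell_exists s01 (L := L) x gm.1.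
(* A configuration whose cell contains x; the default value occurs for small N. *)
pose Xs N : config q N := if pselect (exists X : config q N, in_cell s sigma X x)
  is left e then sval (cid e) else [ffun=> ord0].
have XsP N : (N0 <= N)%N -> in_cell s sigma (Xs N) x.
  move=> NN; rewrite /Xs; case: pselect => [e|ne]; last by have := HN0 N NN.
  by case: cid.
pose z := embed sigma (co x).
have z0 : zero_sum z := embed_zero_sum sigma (co x).
pose y N : 'cV[R]_q := Num.sqrt N%:R *: (xbar R (Xs N) - m).
have yE N r : y N r ord0 = Num.sqrt N%:R * (xbar R (Xs N) r ord0 - m r ord0).
  rewrite /y [LHS]mxE; congr (_ * _); rewrite [LHS]mxE; congr (_ + _).
  by rewrite [LHS]mxE.
have yslot j : y N (slot j) ord0 @[N --> \oo] --> z (slot j) ord0.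
  rewrite /z embed_slot.
  apply: (@cvg_close _ _ (fun=> co x j) (fun N => (Num.sqrt N%:R)^-1)).
  - near=> N.
    have NN : (N0 <= N)%N by near: N; exists N0.
    have := forallP (XsP N NN) j; rewrite /corner -yE => /andP[H1 H2].
    rewrite ler_norml; apply/andP; split; last first.
      by apply: (@le_trans _ _ 0); rewrite ?subr_le0// invr_ge0.
    lra.
  - exact: inv_sqrtn_cvg0.
  - exact: cvg_cst.
have y0 N : (0 < N)%N -> zero_sum (y N).
  move=> NP; have := simplex_diff gm (xbar_simplex R NP (Xs N)).
  rewrite /zero_sum /= => H; under eq_bigr do rewrite [(y N) _ _]mxE.
  by rewrite -mulr_sumr H mulr0.
have yz r : y N r ord0 @[N --> \oo] --> z r ord0.
  have [->|[j ->]] := slotP sigma r; last exact: yslot.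
  have zsum (v : 'cV[R]_q) : zero_sum v -> v slot0 ord0 = - \sum_j v (slot j) ord0.
    move=> v0; apply/eqP; rewrite -subr_eq0 opprK.
    by rewrite -(sum_slots sigma (fun r => v r ord0)); apply/eqP.
  apply: (@cvg_close _ _ (fun N => - \sum_j y N (slot j) ord0) (fun=> 0)).
  - near=> N; rewrite (zsum (y N)); first by rewrite subrr normr0.
    by apply: y0; near: N; exists 1%N.
  - exact: cvg_cst.
  - by rewrite (zsum z z0); apply: cvgN; apply: cvg_sumr => j; exact: yslot.
have Xz r : Num.sqrt N%:R * (xbar R (Xs N) r ord0 - m r ord0) @[N --> \oo] --> z r ord0.
  by under eq_fun do rewrite -yE; exact: yz.
have [tm ex] := local_exponent_cvg bb hb p2 s01 gm stirling_lim z0 Xz.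
have dist0 := eucl_dist_cvg0 tm.
have dlt : \forall N \near \oo, eucl_dist (xbar R (Xs N)) m < d.
  by apply: (cvgr_lt _ dist0).
apply: (@cvg_close _ _ (fun N => expR (local_exponent p beta h bb hb s sigma (Xs N)) * phi N (y N))
  (fun=> 0)).
- have tpos r : \forall N \near \oo, 0 < xbar R (Xs N) r ord0.
    exact: (cvgr_gt _ (tm r) _ (m0 r)).
  have tposA : \forall N \near \oo, forall r, 0 < xbar R (Xs N) r ord0.
    exact: filter_forall.
  near=> N.
  have NP : (0 < N)%N by near: N; exists 1%N.
  have NN : (N0 <= N)%N by near: N; exists N0.
  have cpos r : (0 < count (Xs N) r)%N.
    rewrite -(ltr_nat R) xbar_count// mulr_gt0 ?ltr0n//.
    by move: r; near: N.
  rewrite (step_local_term p beta h bb hb s01 d phi NP cpos (XsP N NN)).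
  have -> : eucl_dist (xbar R (Xs N)) m < d by near: N.
  by rewrite mul1r subrr normr0.
- exact: cvg_cst.
have -> : amplitude * psi z * gauss_density x =
  expR (Qform p beta m z / 2 + dot (slope p bb hb m) z
        - n%:R * lS - 2^-1 * \sum_r ln (m r ord0)) * psi z.
  rewrite mulrAC /amplitude /gauss_density -expRD; congr (expR _ * _).
  by rewrite Qform_embed; ring.
apply: cvgM; last exact: phipsi.
by apply: continuous_cvg => //; exact: continuous_expR.
Unshelve. all: by end_near. Qed.

(** Dominated convergence for the step functions; d0 is the radius of
domination, independent of phi. *)
Lemma inner_laplace : exists2 d0, 0 < d0 & forall d phi psi M,
  0 < d -> d <= d0 -> (forall N y, `|phi N y| <= M) -> cvg_along phi psi ->
  mu.-integrable setT
    (fun x => (amplitude * psi (embed sigma (co x)) * gauss_density x)%:E) /\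
  ((inner_sum d phi N)%:E @[N --> \oo] -->
    \int[mu]_x (amplitude * psi (embed sigma (co x)) * gauss_density x)%:E)%E.
Proof.
have [d0 [K [k [w [d00 w0 dom]]]]] := domination bb hb n0 p2 beta0 s01 gm negdef L.
exists d0 => // d phi psi M dp dd0 phiM phipsi.
pose F N (x : T) := step_fun s sigma N.+1 (local_term p beta h bb hb s sigma d phi N.+1) x.
pose G (x : T) := M * (K * \prod_(j < n) (expR k * bell ((co x j - 0) / w))).
pose lim (x : T) := amplitude * psi (embed sigma (co x)) * gauss_density x.
have Flim x : F N x @[N --> \oo] --> lim x.
  by have := @step_local_term_cvg d phi psi x dp phipsi; rewrite -cvg_shiftS.
have mF N : measurable_fun [set: T] (F N) by exact: measurable_step_fun.
have mlim : measurable_fun [set: T] lim.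
  by apply: (measurable_fun_cvg mF) => x _; exact: Flim.
have iG : mu.-integrable setT (EFin \o G).
  have -> : EFin \o G = (fun x => (M * K)%:E *
      (\prod_(j < n) (expR k * bell ((co x j - 0) / w)))%:E)%E.
    by apply/funext => x; rewrite /G /= mulrA EFinM.
  by apply: integrableZl => //; exact: integrable_bells.
have [i1 _ i3] := @dominated_convergence _ T R mu setT measurableT
  (fun N => EFin \o F N) (EFin \o lim) (EFin \o G)
  (fun N => (measurable_EFinP _ _).2 (mF N)) ((measurable_EFinP _ _).2 mlim)
  ltac:(apply: aeW => x _; apply: cvg_EFin; [by apply: nearW|exact: Flim]) iG
  ltac:(by apply: aeW => x N _ /=; rewrite lee_fin; exact: dom).
split; first exact: i1.
rewrite -cvg_shiftS; apply: cvg_trans i3; apply: near_eq_cvg; apply: nearW => N /=.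
rewrite /F integral_step_fun//; congr EFin.
rewrite /inner_sum mulr_sumr; apply: eq_bigr => X _.
have NR : 0 < Num.sqrt N.+1%:R :> R by rewrite sqrtr_gt0.
have -> : weight p beta h bb hb X = weight_fun p beta h bb hb N.+1 (xbar R X) by [].
rewrite /local_term exprVn.
have := expf_neq0 n (lt0r_neq0 NR); set u := Num.sqrt _ ^+ n => u0.
by field.
Qed.

End inner_limit.

(** * The Gaussian limit law *)

Section density_signed.
Context d (T : measurableType d) (R : realType).
Variables (mu : {measure set T -> \bar R}) (P : probability T R) (phi : T -> R).
Hypothesis phi0 : forall t, 0 <= phi t.
Hypothesis Pphi : forall f : T -> \bar R, measurable_fun setT f ->
  (forall t, 0 <= f t)%E -> (\int[P]_t f t = \int[mu]_t (f t * (phi t)%:E))%E.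

Lemma density_integral (f : T -> R) : measurable_fun setT f ->
  (\int[P]_t (f t)%:E = \int[mu]_t (f t * phi t)%:E)%E.
Proof.
move=> mf; rewrite [LHS]integralE [in RHS]integralE.
have mfE : measurable_fun setT (EFin \o f) by exact/measurable_EFinP.
rewrite !Pphi//; last 2 first.
- exact: measurable_funeneg.
- exact: measurable_funepos.
congr (_ - _)%E; apply: eq_integral => t _.
  by rewrite !funeposE /= -!EFin_max -EFinM maxr_pMl// mul0r.
by rewrite !funenegE /= -!EFin_max -EFinM maxr_pMl// mul0r mulNr.
Qed.

End density_signed.

Section square.
Variables (R : realType) (n : nat) (a b : R) (u : 'I_n -> R).
Hypotheses (b0 : 0 < b) (nab : 0 < n%:R * a + b).

(** The maximiser of - quad a b x / 2 + <u, x>, that is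
(a J + b I)^-1 u with J the all-ones matrix. *)
Definition gauss_center (j : 'I_n) : R :=
  (u j - a / (n%:R * a + b) * \sum_i u i) / b.

Lemma sum_gauss_center : \sum_j gauss_center j = (\sum_j u j) / (n%:R * a + b).
Proof.
rewrite /gauss_center -mulr_suml sumrB sumr_const card_ord -[_ *+ n]mulr_natl.
set S := \sum_i u i; field.
by rewrite !gt_eqF.
Qed.

Lemma complete_square (x : 'I_n -> R) :
  - quad a b x / 2 + \sum_j u j * x j =
  - quad a b (fun j => x j - gauss_center j) / 2 + quad a b gauss_center / 2.
Proof.
have uE j : u j = a * \sum_i gauss_center i + b * gauss_center j.
  by rewrite sum_gauss_center /gauss_center; field; rewrite !gt_eqF.
have H C : (forall j, u j = a * C + b * gauss_center j) -> \sum_j u j * x j =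
    a * C * \sum_j x j + b * \sum_j x j * gauss_center j.
  move=> uC; rewrite !mulr_sumr -big_split /=; apply: eq_bigr => j _.
  by rewrite [in LHS]uC; ring.
rewrite (H _ uE) {H uE}.
rewrite /quad sumrB.
have -> : \sum_i (x i - gauss_center i) ^+ 2 =
    \sum_i x i ^+ 2 - 2 * \sum_i x i * gauss_center i + \sum_i gauss_center i ^+ 2.
  rewrite mulr_sumr -sumrB -big_split /=; apply: eq_bigr => j _; ring.
by set X := \sum_i x i; set C := \sum_i gauss_center i; field.
Qed.

End square.

Section gauss_laws.
Variable R : realType.

Lemma gauss_expect_indic (mean var : R) (S : set R) : 0 <= var -> measurable S ->
  gauss_expect (fun z => (\1_S (mean + Num.sqrt var * z))%:E) = Defs.normal1 mean var S.
Proof.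
move=> var0 mS; rewrite /Defs.normal1; case: eqP => [->|/eqP var_n0].
  rewrite sqrtr0 diracE; rewrite -[RHS]gauss_expect_cst.
    by apply: eq_integral => z _; rewrite mul0r addr0 indicE.
  by rewrite lee_fin.
have var_gt0 : 0 < var by rewrite lt_neqAle eq_sym var_n0.
have s0 : 0 < Num.sqrt var by rewrite sqrtr_gt0.
have mI : measurable_fun [set: R] (fun x => (\1_S x : R)%:E).
  by apply/measurable_EFinP; exact: measurable_indic.
have k0 : 0 < (Num.sqrt (pi *+ 2))^-1 :> R by rewrite invr_gt0 sqrtr_gt0 mulrn_wgt0// pi_gt0.
have H := @integral_bell R mean (Num.sqrt var) (fun x => (\1_S x)%:E) s0 mI.
have {}H := H (fun x => ltac:(by rewrite lee_fin indicE)).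
rewrite /normal_prob integral_mkcond.
have -> : (\int[lebesgue_measure]_x
   ((fun x => (normal_pdf mean (Num.sqrt var) x)%:E) \_ S) x)%E =
   (((Num.sqrt (pi *+ 2))^-1 / Num.sqrt var)%:E *
    \int[lebesgue_measure]_x ((\1_S x)%:E * (bell ((x - mean) / Num.sqrt var))%:E))%E.
  rewrite -ge0_integralZl//=.
  - apply: eq_integral => x _; rewrite patchE indicE.
    case: ifPn => xS; last by rewrite mul0e mule0.
    rewrite mul1e -EFinM normal_pdfE ?gt_eqF//; congr EFin.
    have -> : normal_peak (Num.sqrt var) = (Num.sqrt (pi *+ 2))^-1 / Num.sqrt var :> R.
      rewrite /normal_peak -mulrnAr sqrtrM ?sqr_ge0// sqrtr_sqr gtr0_norm//.
      by rewrite invfM mulrC.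
    congr (_ * expR _); rewrite expr_div_n -[_ *+ 2]mulr_natr.
    by field; rewrite gt_eqF.
  - apply: emeasurable_funM => //; apply/measurable_EFinP.
    exact: measurable_bell_aff.
  - by move=> x _; rewrite mule_ge0// lee_fin ?indicE// bell_ge0.
rewrite H muleA -EFinM.
rewrite (_ : _ * _ = 1) ?mul1e//.
by field; rewrite !gt_eqF// -invr_gt0.
Qed.

End gauss_laws.

Section limit_law.
Variables (R : realType) (n p : nat) (beta h bb hb s : R) (sigma : 'S_n.+1).
Hypotheses (n0 : (0 < n)%N) (p2 : (2 <= p)%N) (beta0 : 0 < beta).
Hypothesis s01 : 0 <= s < 1.
Local Notation q := n.+1.
Local Notation m := (perm_xs s sigma).
Local Notation A := (top_curv n p beta s).
Local Notation B := (low_curv n p beta s).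
Hypothesis negdef : forall t, zero_sum t -> t != 0 -> Qform p beta m t < 0.
Variable L : lebesgue_space R n.
Local Notation T := (ls_sort L).
Local Notation mu := (ls_mu L).
Local Notation co := (@ls_co R n L).
Local Notation slp := (slope p bb hb m).
Local Notation V := (perm_mx sigma *m Sigma p q beta h s *m (perm_mx sigma)^T).
Local Notation dens := (gauss_density p beta bb hb s sigma (L := L)).
Local Notation w := (gauss_center A B (embed_tr sigma slp)).

Let piv : 0 < n%:R * A + B. Proof. exact: line_curv_gt0 n0 negdef. Qed.
Let B0 : 0 < B. Proof. exact: low_curv_gt0 n0 p2 beta0 s01 negdef. Qed.

(** The integral of gauss_density. *)
Definition gauss_total : R := expR (quad A B w / 2) * gauss_mass n A B.

Lemma gauss_mass_gt0 : 0 < gauss_mass n A B.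
Proof.
have pi2 : 0 < pi *+ 2 :> R by rewrite mulrn_wgt0// pi_gt0.
rewrite /gauss_mass sqrtr_gt0 divr_gt0 ?exprn_gt0// mulr_gt0 ?exprn_gt0//.
rewrite (_ : 1 + _ = (n%:R * A + B) / B) ?divr_gt0//.
by field; rewrite gt_eqF.
Qed.

Lemma gauss_total_gt0 : 0 < gauss_total.
Proof. by rewrite mulr_gt0 ?expR_gt0// gauss_mass_gt0. Qed.

Lemma gauss_densityE x : dens x =
  expR (quad A B w / 2) * expR (- quad A B (fun j => co x j - w j) / 2).
Proof.
rewrite /gauss_density dot_embed complete_square// -expRD.
by congr expR; rewrite addrC.
Qed.

Lemma measurable_gauss_density : measurable_fun [set: T] dens.
Proof.
have -> : dens = fun x => expR (- quad A B (co x) / 2 + \sum_j embed_tr sigma slp j * co x j).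
  by apply/funext => x; rewrite /gauss_density dot_embed.
apply: (measurableT_comp (@measurable_expR R)).
have mco j : measurable_fun [set: T] (co ^~ j) by exact: ls_meas.
have msum (f : 'I_n -> T -> R) : (forall j, measurable_fun setT (f j)) ->
    measurable_fun [set: T] (fun x => \sum_j f j x).
  by move=> mf; exact: measurable_sum.
apply: measurable_funD; last by apply: msum => j; exact: measurable_funM.
apply: measurable_funM => //; apply: measurableT_comp => //.
apply: measurable_funD; apply: measurable_funM => //.
  by apply: measurable_funX; apply: msum.
by apply: msum => j; exact: measurable_funX.
Qed.

Lemma integral_gauss_density (c : 'I_n -> R) (F : R -> \bar R) :
  measurable_fun setT F -> (forall x, 0 <= F x)%E ->
  (\int[mu]_x (F (\sum_i c i * co x i)%R * (dens x)%:E) =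
   gauss_total%:E * gauss_expect (fun z => F (\sum_i c i * w i + Num.sqrt (gauss_var A B c) * z)%R))%E.
Proof.
move=> mF F0.
rewrite /gauss_total EFinM -muleA -(ls_gauss L)// -ge0_integralZl//=.
- by apply: eq_integral => x _; rewrite gauss_densityE EFinM muleCA.
- apply: emeasurable_funM.
    apply: (measurableT_comp mF); apply: measurable_sum => j.
    by apply: measurable_funM => //; exact: ls_meas.
  have -> : (fun x : T => (expR (- quad A B (fun i => co x i - w i) / 2))%:E) =
    EFin \o (fun x => (expR (quad A B w / 2))^-1 * dens x).
    apply/funext => x /=; rewrite gauss_densityE mulrA mulVf ?mul1r//.
    by rewrite gt_eqF// expR_gt0.
  apply/measurable_EFinP; apply: measurable_funM => //.
  exact: measurable_gauss_density.
- by move=> x _; apply: mule_ge0; rewrite ?lee_fin ?expR_ge0.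
Qed.

(** The law is the image under embed of the normalised gauss_density. A linear
form on it is a linear form in the free coordinates, hence normal: its variance
is gauss_var, and its mean, the value of the form at gauss_center, is its
gauss_cov with the slope. *)
Lemma limit_law : exists2 nu : probability (borelV R q) R,
  is_normal (V *m slp) V nu &
  forall (k : R) (g : 'cV[R]_q -> R), continuous g -> (exists M, forall x, `|g x| <= M) ->
    nu.-integrable setT (EFin \o g) /\
    (\int[mu]_x (k * g (embed sigma (co x)) * dens x)%R%:E =
     (k * gauss_total)%R%:E * \int[nu]_x (g x)%:E)%E.
Proof.
have G0 := gauss_total_gt0.
pose phi x := gauss_total^-1 * dens x.
have phi0 x : 0 <= phi x by rewrite mulr_ge0 ?expR_ge0// invr_ge0 ltW.
have mphi : measurable_fun [set: T] phi.
  by apply: measurable_funM => //; exact: measurable_gauss_density.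
have intphi (c : 'I_n -> R) (F : R -> \bar R) :
  measurable_fun setT F -> (forall x, 0 <= F x)%E ->
  (\int[mu]_x (F (\sum_i c i * co x i)%R * (phi x)%:E) =
   gauss_expect (fun z => F (\sum_i c i * w i + Num.sqrt (gauss_var A B c) * z)%R))%E.
  move=> mF F0; under eq_integral do rewrite /phi EFinM muleCA.
  rewrite ge0_integralZl//=.
  - rewrite integral_gauss_density// muleA -EFinM mulVf ?mul1e//.
    by rewrite gt_eqF.
  - apply: emeasurable_funM.
      apply: (measurableT_comp mF); apply: measurable_sum => j.
      by apply: measurable_funM => //; exact: ls_meas.
    by apply/measurable_EFinP; exact: measurable_gauss_density.
  - by move=> x _; apply: mule_ge0; rewrite ?lee_fin ?expR_ge0.
  - by rewrite lee_fin invr_ge0 ltW.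
have phi1 : (\int[mu]_x (phi x)%:E = 1)%E.
  have := intphi (fun=> 0) (fun=> 1%E) (measurable_cst _) (fun _ => lee01).
  by under eq_integral do rewrite mul1e; rewrite gauss_expect1.
have [P PE] := density_probability mphi phi0 phi1.
have mY : measurable_fun setT ((fun x => embed sigma (co x)) : T -> borelV R q).
  apply: measurable_vector => r; have [->|[j ->]] := slotP sigma r.
    under eq_fun do rewrite embed_slot0.
    by apply: measurableT_comp => //; apply: measurable_sum => j; exact: ls_meas.
  by under eq_fun do rewrite embed_slot; exact: ls_meas.
pose Y : {mfun T >-> borelV R q} :=
  HB.pack (_ : T -> borelV R q) (isMeasurableFun.Build _ _ _ _ _ mY).
exists (distribution P Y).
  move=> a; rewrite (dot_permSigma beta h sigma n0 p2 s01 a a) -gauss_var_cov.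
  rewrite (dot_permSigma beta h sigma n0 p2 s01 a slp).
  split; first exact: gauss_var_ge0.
  move=> S mS; rewrite -gauss_expect_indic//; last exact: gauss_var_ge0.
  have mI : measurable_fun [set: R] (fun x => (\1_S x : R)%:E).
    by apply/measurable_EFinP; exact: measurable_indic.
  have -> : gauss_cov p beta s (embed_tr sigma a) (embed_tr sigma slp) =
      \sum_i embed_tr sigma a i * w i.
    rewrite /gauss_cov; set c := embed_tr sigma a; set u := embed_tr sigma slp.
    have -> : \sum_i c i * gauss_center A B u i =
        (\sum_i c i * u i - (\sum_i c i) * (A / (n%:R * A + B) * \sum_i u i)) / B.
      rewrite /gauss_center; under eq_bigr do rewrite mulrA mulrBr.
      by rewrite -mulr_suml sumrB -mulr_suml.
    set S1 := \sum_i _ * _; set S2 := \sum_i c i; set S3 := \sum_i u i.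
    by field; rewrite !gt_eqF.
  rewrite -(intphi (embed_tr sigma a) (fun x => (\1_S x)%:E))//.
  have mlin : measurable_fun setT (fun x : T => \sum_i embed_tr sigma a i * co x i).
    apply: measurable_sum => j.
    by apply: measurable_funM => //; exact: ls_meas.
  rewrite -(PE (fun x => (\1_S (\sum_i embed_tr sigma a i * co x i))%:E)) //.
  - transitivity (\int[P]_x (\1_((fun x : T => \sum_i embed_tr sigma a i * co x i) @^-1` S) x)%:E)%E.
      rewrite integral_indic//; last by rewrite -[X in measurable X]setTI; exact: mlin.
      rewrite setIT; congr (P _); apply/seteqP; split => x /=; by rewrite dot_embed.
    by [].
  - exact: (measurableT_comp mI mlin).
move=> k g cg [M gM].
have mg := measurable_continuous cg.
have ig : (distribution P Y).-integrable setT (EFin \o g).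
  apply: measurable_bounded_integrable => //.
    by apply: le_lt_trans (probability_le1 _ measurableT) (ltry 1).
  exists M; split; rewrite ?num_real // => x Mx y _ /=.
  by rewrite (le_trans _ (ltW Mx)).
split=> //.
have mgY : measurable_fun setT (fun x => g (embed sigma (co x))).
  exact: (measurableT_comp mg mY).
have igP : P.-integrable setT (fun x => (g (embed sigma (co x)))%:E).
  apply: measurable_bounded_integrable => //.
    by apply: le_lt_trans (probability_le1 _ measurableT) (ltry 1).
  exists M; split; rewrite ?num_real // => x Mx y _ /=.
  by rewrite (le_trans _ (ltW Mx)).
rewrite integral_distribution//; last exact: (measurable_EFinP _ _).2 mg.
transitivity ((k * gauss_total)%:E * \int[P]_x (g (embed sigma (co x)))%:E)%E; last by [].
rewrite -integralZl//.
transitivity (\int[P]_x (k * gauss_total * g (embed sigma (co x)))%:E)%E; last first.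
  by apply: eq_integral => x _; rewrite EFinM.
rewrite (density_integral phi0 PE); last exact: measurable_funM.
by apply: eq_integral => x _; congr EFin; rewrite /phi; field; rewrite gt_eqF.
Qed.
End limit_law.

(** * Conditional central limit theorem *)

Section column_topology.
Variables (R : realType) (q : nat).

Lemma cvg_col (y : nat -> 'cV[R]_q) (z : 'cV[R]_q) :
  (forall r, y N r ord0 @[N --> \oo] --> z r ord0) -> y N @[N --> \oo] --> z.
Proof.
move=> yz; apply/cvg_ballP => e e0.
have H : \forall N \near \oo, forall r : 'I_q, ball (z r ord0) e (y N r ord0).
  by apply: filter_forall => r; exact: (cvg_ball (yz r)).
by near=> N; split => // r k; rewrite ord1; move: r; near: N.
Unshelve. all: by end_near. Qed.

Lemma continuous_eucl_dist (u : 'cV[R]_q) : continuous (fun t : 'cV[R]_q => eucl_dist t u).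
Proof.
have cS : continuous (fun t : 'cV[R]_q => \sum_(r < q) (t r ord0 - u r ord0) ^+ 2).
  apply: continuous_sumr => r t.
  have H : x r ord0 - u r ord0 @[x --> t] --> t r ord0 - u r ord0.
    by apply: cvgB; [exact: coord_continuous|exact: cvg_cst].
  exact: (cvgM H H).
move=> t; rewrite /eucl_dist.
by apply: (continuous_comp (cS t)); exact: sqrt_continuous.
Qed.

End column_topology.

Lemma integral_probability_cst d (T : measurableType d) (R : realType)
  (P : probability T R) (c : R) : (\int[P]_x c%:E = c%:E)%E.
Proof.
rewrite -[LHS]/((\int[P]_x cst c%:E x)%E) integral_cst; last exact: measurableT.
by rewrite [X in (_ * X)%E](probability_setT P) mule1.
Qed.

Section local_limit.
Variables (R : realType) (n p : nat) (beta h bb hb s : R) (sigma : 'S_n.+1).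
Hypotheses (n0 : (0 < n)%N) (p2 : (2 <= p)%N) (beta0 : 0 < beta).
Hypothesis s01 : 0 <= s < 1.
Local Notation q := n.+1.
Local Notation m := (perm_xs s sigma).
Hypothesis gm : global_max p beta h m.
Hypothesis negdef : forall t, zero_sum t -> t != 0 -> Qform p beta m t < 0.
Variables (lS : R).
Hypothesis stirling_lim : stirling R N @[N --> \oo] --> lS.
Local Notation slp := (slope p bb hb m).
Local Notation V := (perm_mx sigma *m Sigma p q beta h s *m (perm_mx sigma)^T).
Local Notation W := (weight p beta h bb hb).

Definition local_mass : R :=
  amplitude s sigma lS * gauss_total p beta bb hb s sigma.

Lemma local_mass_gt0 : 0 < local_mass.
Proof. by rewrite mulr_gt0 ?expR_gt0//; exact: gauss_total_gt0. Qed.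

(** The values of inner_laplace, expressed by the limit law. *)
Lemma inner_cvg : exists2 nu : probability (borelV R q) R,
  is_normal (V *m slp) V nu &
  \forall d \near 0^'+, forall (phi : nat -> 'cV[R]_q -> R) (psi : 'cV[R]_q -> R) (M : R),
    (forall N y, `|phi N y| <= M) ->
    (forall y, `|psi y| <= M) -> continuous psi ->
    cvg_along phi psi ->
    nu.-integrable setT (EFin \o psi) /\
    inner_sum p beta h bb hb s sigma d phi N @[N --> \oo] -->
      local_mass * fine (\int[nu]_x (psi x)%:E)%E.
Proof.
have L := lebesgue_space_exists R n.
have [nu nuN nuI] := limit_law h bb hb n0 p2 beta0 s01 negdef L.
have [d0 d00 inner] := inner_laplace bb hb n0 p2 beta0 s01 gm negdef stirling_lim L.
exists nu => //.
near=> d.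
have dp : 0 < d by near: d; exact: nbhs_right_gt.
have dd0 : d <= d0 by near: d; exact: nbhs_right_le.
move=> phi psi M phiM psiM cpsi phipsi.
have [ipsi EQ] := nuI (amplitude s sigma lS) psi cpsi (ex_intro _ M psiM).
split=> //.
have [_] := inner d phi psi M dp dd0 phiM phipsi.
rewrite EQ -[X in (_ * X)%E]fineK; last exact: integrable_fin_num.
by rewrite -EFinM => /fine_cvgP[].
Unshelve. all: by end_near. Qed.

Lemma outer_cvg (O : pred 'cV[R]_q) (phi : nat -> 'cV[R]_q -> R) M :
  closed [set t | O t] -> (forall t, O t -> ~ global_max p beta h t) ->
  (forall N y, `|phi N y| <= M) ->
  renorm p beta h bb hb m N * \sum_(X : config q N)
    W X * ((O (xbar R X))%:R * phi N (xbar R X)) @[N --> \oo] --> 0.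
Proof.
move=> cO O_gm phiM.
have [eta eta0 Oeta] := energy_gap cO gm O_gm.
have H := outer_negligible bb hb gm.1 eta0 Oeta.
have M0 : 0 <= M by apply: le_trans (phiM 0%N 0); rewrite normr_ge0.
apply/norm_cvg0P.
apply: (@squeeze_cvgr _ _ _ _ (fun=> 0) (fun N => (renorm p beta h bb hb m N *
  \sum_(X : config q N | O (xbar R X)) W X) * M)); first last.
- by rewrite -[X in _ --> X](mul0r M); apply: cvgMl.
- exact: cvg_cst.
apply: nearW => N; rewrite normr_ge0 /= normrM gtr0_norm ?renorm_gt0// -mulrA.
rewrite ler_pM2l ?renorm_gt0// mulr_suml [X in _ <= X]big_mkcond /=.
apply: le_trans (ler_norm_sum _ _ _) _; apply: ler_sum => X _.
rewrite normrM gtr0_norm ?weight_gt0//; case: ifP => OX; last by rewrite mul0r normr0 mulr0.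
by rewrite mul1r ler_pM2l ?weight_gt0.
Qed.

Lemma expect_cond N (I : pred (config q N)) (Y : config q N -> R) :
  expect (cond (gibbs p (beta + bb / Num.sqrt N%:R) (h + hb / Num.sqrt N%:R)) I) Y =
  (\sum_(X : config q N) W X * ((I X)%:R * Y X)) / \sum_(X : config q N) W X * (I X)%:R.
Proof.
rewrite /expect /cond /gibbs mulr_suml.
set Z := \sum_Y gibbs_weight _ _ _ _.
have Z0 : 0 < Z.
  rewrite /Z (bigD1 [ffun=> ord0])//= ltr_wpDr ?expR_gt0//.
  by apply: sumr_ge0 => X _; exact: expR_ge0.
have -> : \sum_(j | I j) gibbs_weight p (beta + bb / Num.sqrt N%:R) (h + hb / Num.sqrt N%:R) j / Z
   = (\sum_(X : config q N) W X * (I X)%:R) / Z.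
  rewrite mulr_suml big_mkcond; apply: eq_bigr => X _.
  by case: ifP => _; rewrite ?mulr1// mulr0 mul0r.
apply: eq_bigr => X _; case: ifP => _; last by rewrite !mul0r mulr0 mul0r.
rewrite -/(weight p beta h bb hb X) mul1r invfM invrK.
by rewrite [_ * Z]mulrC mulrA mulfVK ?gt_eqF// mulrAC.
Qed.

Lemma inner_cvg_cst : \forall d \near 0^'+,
  forall (phi : nat -> 'cV[R]_q -> R) (c M : R), (forall N y, `|phi N y| <= M) ->
    cvg_along phi (fun=> c) ->
    inner_sum p beta h bb hb s sigma d phi N @[N --> \oo] --> local_mass * c.
Proof.
have [nu _] := inner_cvg; apply: filterS => d inner phi c M phiM phic.
have cM : `|c| <= Num.max M `|c| by rewrite le_max lexx orbT.
have cc : continuous ((fun _ => c) : 'cV[R]_q -> R).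
  by move=> x; apply: (@cvg_cst R); exact: nbhs_filter.
have [|_] := inner phi (fun=> c) (Num.max M `|c|) _ (fun=> cM) cc phic.
  by move=> N y; rewrite le_max phiM.
by rewrite integral_probability_cst.
Qed.

(** The partition function cancels in the conditional law, and the
expectation is a quotient of two sums over the ball of radius eps. Such a sum
splits into a ball small enough for Laplace's method and a closed shell without
maximizers, which is negligible. *)
Lemma conditional_limit eps : 0 < eps ->
  (forall t, eucl_dist t m <= eps -> global_max p beta h t -> t = m) ->
  exists2 nu : probability (borelV R q) R,
     is_normal (V *m slp) V nu
   & cvg_dist
       (fun N => cond (gibbs p (beta + bb / Num.sqrt N%:R) (h + hb / Num.sqrt N%:R))
                      (fun X : config q N => eucl_dist (xbar R X) m < eps))
       (fun N (X : config q N) => Num.sqrt N%:R *: (xbar R X - m)) nu.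
Proof.
move=> eps0 only_m.
have [nu nuN inner] := inner_cvg.
exists nu => // g cg [M gM].
have [d [d0 deps innerd]] : exists d, [/\ 0 < d, d <= eps &
  forall (phi : nat -> 'cV[R]_q -> R) (psi : 'cV[R]_q -> R) (M : R),
    (forall N y, `|phi N y| <= M) ->
    (forall y, `|psi y| <= M) -> continuous psi ->
    cvg_along phi psi ->
    nu.-integrable setT (EFin \o psi) /\
    inner_sum p beta h bb hb s sigma d phi N @[N --> \oo] -->
      local_mass * fine (\int[nu]_x (psi x)%:E)%E].
  near (0:R)^'+ => d; exists d; split.
  - by near: d; exact: nbhs_right_gt.
  - by near: d; exact: nbhs_right_le.
  - by near: d.
have full (f : 'cV[R]_q -> R) (C : R) : continuous f -> (forall y, `|f y| <= C) ->
   nu.-integrable setT (EFin \o f) /\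
   renorm p beta h bb hb m N * (\sum_(X : config q N) W X *
     ((eucl_dist (xbar R X) m < eps)%R%:R * f (Num.sqrt N%:R *: (xbar R X - m)))) @[N --> \oo]
   --> local_mass * fine (\int[nu]_x (f x)%:E)%E.
  move=> cf fC.
  have al : cvg_along (fun=> f) f.
    by move=> y z yz; apply: continuous_cvg; [exact: cf|exact: cvg_col].
  have [if_ H1] := innerd (fun=> f) f C (fun=> fC) fC cf al; split=> //.
  pose O := [pred t : 'cV[R]_q | d <= eucl_dist t m <= eps].
  pose phi N (t : 'cV[R]_q) := (eucl_dist t m < eps)%R%:R * f (Num.sqrt N%:R *: (t - m)).
  have cO : closed [set t | O t].
    have -> : [set t | O t] = (fun t : 'cV[R]_q => eucl_dist t m) @^-1` `[d, eps].
      by apply/seteqP; split => t /=; rewrite in_itv.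
    by apply: closed_comp => [t _|]; [exact: continuous_eucl_dist|exact: interval_closed].
  have Om t : O t -> ~ global_max p beta h t.
    move=> /andP[dt te] /(only_m t te) tm; move: dt; rewrite tm.
    rewrite /eucl_dist big1 ?sqrtr0 ?leNgt ?d0// => r _.
    by rewrite subrr expr0n.
  have phiC N y : `|phi N y| <= C.
    rewrite /phi; case: ltP => _; first by rewrite mul1r.
    by rewrite mul0r normr0; exact: le_trans (fC 0).
  have H2 := @outer_cvg O phi C cO Om phiC.
  rewrite -[X in _ --> X]addr0.
  apply: cvg_trans (cvgD H1 H2); apply: near_eq_cvg.
  apply: nearW => N; transitivity (inner_sum p beta h bb hb s sigma d (fun=> f) N +
    renorm p beta h bb hb m N * \sum_X W X * ((O (@xbar R q N X))%:R * phi N (xbar R X))) => //.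
  rewrite /inner_sum -mulrDr -big_split /=; congr (_ * _).
  apply: eq_bigr => X _; rewrite -mulrDr; congr (_ * _); rewrite /phi mulrA -mulrDl.
  congr (_ * _); have := deps; set e := eucl_dist _ _ => de.
  case: (ltP e d) => ed /=; last by rewrite add0r; case: (leP e eps) => ee; rewrite ?mul1r ?mul0r// ltNge ltW.
  by rewrite (lt_le_trans ed de) mul0r addr0.
have [ig H1] := full g M cg gM.
have c1 : continuous ((fun _ => 1) : 'cV[R]_q -> R).
  by move=> x; apply: (@cvg_cst R); exact: nbhs_filter.
have [_ H2] := full (fun=> 1) 1 c1 ltac:(by move=> ?; rewrite /= normr1).
have lm := local_mass_gt0.
have E1 : (\int[nu]_x (1 : R)%:E = 1)%E.
  exact: integral_probability_cst.
move: H2; rewrite E1 mulr1 => H2.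
rewrite -[X in _ --> X]fineK; last exact: integrable_fin_num.
apply: cvg_EFin; first by apply: nearW.
have : local_mass * fine (\int[nu]_x (g x)%:E) / local_mass = fine (\int[nu]_x (g x)%:E).
  by rewrite mulrAC mulfV ?mul1r// gt_eqF.
move=> <-; apply: cvg_trans (cvgM H1 (cvgV (lt0r_neq0 lm) H2)).
apply: near_eq_cvg; apply: nearW => N /=.
rewrite expect_cond; have sc := renorm_gt0 p beta h bb hb m N.
set num := \sum_X _ * (_ * g _); transitivity ((renorm p beta h bb hb m N * num) /
  (renorm p beta h bb hb m N *
     \sum_(X : config q N) W X * ((eucl_dist (xbar R X) m < eps)%R%:R * 1))) => //.
by under eq_bigr do rewrite mulr1; rewrite -mulf_div mulfV ?mul1r// gt_eqF.
Unshelve. all: by end_near. Qed.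

End local_limit.

(** * Convergence to the mixture *)

Section mixture.
Context d (T : measurableType d) (R : realType).
Variables (K : nat) (w : 'I_K -> R) (a : 'I_K -> T).
Hypotheses (w0 : forall k, 0 <= w k) (w1 : \sum_k w k = 1).

(** Finite sums of measures run over natural numbers, hence the value 0 beyond
K. *)
Let wt (j : nat) : {nonneg R} :=
  if insub j is Some k then NngNum (w0 k) else 0%:nng.

Let dirac_summand (j : nat) : {measure set T -> \bar R} :=
  mscale (wt j) (if insub j is Some k then \d_(a k) : {measure set T -> \bar R} else mzero).

Definition mixture : set T -> \bar R := msum dirac_summand K.

HB.instance Definition _ := Measure.on mixture.

Let mixtureE A : mixture A = (\sum_(k < K) (w k)%:E * \d_(a k) A)%E.
Proof.
rewrite /mixture /msum; apply: eq_bigr => k _.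
by rewrite /dirac_summand /mscale /= /wt valK.
Qed.

Let mixtureT : mixture setT = 1%E.
Proof.
rewrite mixtureE; under eq_bigr do rewrite diracT mule1.
by rewrite sumEFin w1.
Qed.

HB.instance Definition _ := @Measure_isProbability.Build _ _ R mixture mixtureT.

Lemma mixture_probability : exists mu : probability T R,
  (forall A, mu A = (\sum_(k < K) (w k)%:E * \d_(a k) A)%E) /\
  forall g : T -> R, measurable_fun setT g ->
    (\int[mu]_x (g x)%:E = (\sum_k w k * g (a k))%:E)%E.
Proof.
exists mixture; split; first exact: mixtureE.
have ge0 (f : T -> R) : measurable_fun setT f -> (forall x, 0 <= f x) ->
    (\int[mixture]_x (f x)%:E = (\sum_k w k * f (a k))%:E)%E.
  move=> mf f0; have mfE : measurable_fun setT (EFin \o f) by exact/measurable_EFinP.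
  rewrite ge0_integral_measure_sum//=; last by move=> x _; rewrite lee_fin.
  rewrite -sumEFin; apply: eq_bigr => k _.
  rewrite ge0_integral_mscale//=; last by move=> x _; rewrite lee_fin.
  by rewrite /wt valK /= integral_dirac// diracT mul1e.
move=> g mg; rewrite integralE.
have gp : (fun x => (EFin \o g)^\+%E x) = (fun x => (Num.max (g x) 0)%:E).
  by apply/funext => x; rewrite funeposE /= EFin_max.
have gn : (fun x => (EFin \o g)^\-%E x) = (fun x => (Num.max (- g x) 0)%:E).
  by apply/funext => x; rewrite funenegE /= EFin_max.
rewrite gp gn !ge0; first last.
- by move=> x; rewrite le_max lexx orbT.
- exact: measurable_maxr.
- by move=> x; rewrite le_max lexx orbT.
- by apply: measurable_maxr => //; exact: measurableT_comp.
rewrite -EFinB -sumrB; congr EFin; apply: eq_bigr => k _.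
rewrite -mulrBr; congr (_ * _).
by do 2 case: leP => ?; lra.
Qed.

End mixture.

Section equilibrium.
Variables (R : realType) (n p : nat) (beta h : R).
Hypotheses (n0 : (0 < n)%N) (p2 : (2 <= p)%N) (beta0 : 0 < beta).
Local Notation q := n.+1.

Lemma tilt00 (t : 'cV[R]_q) : tilt p 0 0 t = 0 :> R.
Proof. by rewrite /tilt !mul0r addr0. Qed.

Lemma weight00 N (X : config q N) : weight p beta h 0 0 X = gibbs_weight p beta h X.
Proof. by rewrite /weight !mul0r !addr0. Qed.

Lemma renorm00_max (m m' : 'cV[R]_q) N : global_max p beta h m -> global_max p beta h m' ->
  renorm p beta h 0 0 m N = renorm p beta h 0 0 m' N.
Proof.
move=> [sm mm] [sm' mm']; rewrite /renorm !tilt00.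
have -> // : energy p beta h m = energy p beta h m'.
by apply/le_anti; rewrite mm' ?mm.
Qed.

Lemma expect_gibbs N (Y : config q N -> R) :
  expect (gibbs p beta h (N := N)) Y =
  (\sum_(X : config q N) weight p beta h 0 0 X * Y X) /
  \sum_(X : config q N) weight p beta h 0 0 X.
Proof.
rewrite /expect mulr_suml; under [in RHS]eq_bigr do rewrite weight00.
by rewrite (eq_bigr _ (fun X _ => weight00 X)); apply: eq_bigr => X _; rewrite mulrAC.
Qed.

(** Without perturbation the slope is 0, so that the mass is gauss_mass times
amplitude. *)
Lemma local_mass00 s (sigma : 'S_q) lS : 0 <= s < 1 ->
  (forall t, zero_sum t -> t != 0 -> Qform p beta (perm_xs s sigma) t < 0) ->
  local_mass p beta 0 0 s sigma lS =
  expR (- n%:R * lS) * Num.sqrt ((pi *+ 2) ^+ n * n%:R / q%:R ^+ 2) *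
  tau p beta h (perm_xs s sigma) s.
Proof.
move=> s01 negdef; set m := perm_xs s sigma.
have m0 r : 0 < m r ord0 by exact: perm_xs_gt0.
have u0 j : embed_tr sigma (slope p 0 0 m) j = 0.
  by rewrite /embed_tr /slope mul0r !scale0r addr0 !mxE subrr.
have w0 : gauss_center (top_curv n p beta s) (low_curv n p beta s) (embed_tr sigma (slope p 0 0 m)) = fun=> 0.
  apply/funext => j; rewrite /gauss_center u0 big1 ?mulr0 ?subrr ?mul0r// => i _.
rewrite /local_mass /gauss_total w0 /quad !big1//; last by move=> i _; rewrite expr0n.
rewrite expr0n /= !mulr0 addr0 mul0r expR0 mul1r.
have ampE : amplitude s sigma lS = expR (- n%:R * lS) * (Num.sqrt (\prod_r m r ord0))^-1.
  have -> : \prod_r m r ord0 = expR (2^-1 * \sum_r ln (m r ord0)) ^+ 2.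
    rewrite -expRM_natl mulrA mulfV// mul1r expR_sum.
    by apply: eq_bigr => r _; rewrite lnK// posrE.
  by rewrite sqrtr_sqr gtr0_norm ?expR_gt0// -expRN -expRD.
by rewrite -[RHS]mulrA -(tau_mass h n0 p2 beta0 s01 negdef) -/m ampE; ring.
Qed.

(** Squared, this is the inequality (b - c)^2 <= 2 (a - b)^2 + 2 (a - c)^2
in each coordinate. *)
Lemma eucl_dist_double (t u v : 'cV[R]_q) d : 0 < d ->
  eucl_dist t u < d -> eucl_dist t v < d -> eucl_dist u v < 2 * d.
Proof.
move=> d0 tu tv.
have sq (x y : 'cV[R]_q) : \sum_r (x r ord0 - y r ord0) ^+ 2 = eucl_dist x y ^+ 2.
  by rewrite sqr_sqrtr// sumr_ge0// => r _; exact: sqr_ge0.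
have dge (x y : 'cV[R]_q) : 0 <= eucl_dist x y by exact: sqrtr_ge0.
rewrite -(@ltr_pXn2r _ 2)// ?nnegrE ?dge ?mulr_ge0 ?ltW// -sq.
apply: (@le_lt_trans _ _ (2 * eucl_dist t u ^+ 2 + 2 * eucl_dist t v ^+ 2)).
  rewrite -!sq !mulr_sumr -big_split /=; apply: ler_sum => r _.
  rewrite -subr_ge0; set a := t r ord0; set b := u r ord0; set c := v r ord0.
  have -> : 2 * (a - b) ^+ 2 + 2 * (a - c) ^+ 2 - (b - c) ^+ 2 = (2 * a - b - c) ^+ 2.
    ring.
  exact: sqr_ge0.
have sqlt (x : R) : 0 <= x -> x < d -> x ^+ 2 < d ^+ 2.
  by move=> x0 xd; rewrite ltr_pXn2r// nnegrE ltW.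
have := sqlt _ (dge t u) tu; have := sqlt _ (dge t v) tv.
rewrite exprMn; set D := d ^+ 2; lra.
Qed.

Lemma eucl_dist_gt0 (u v : 'cV[R]_q) : u <> v -> 0 < eucl_dist u v.
Proof.
move=> uv; rewrite lt_neqAle sqrtr_ge0 andbT; apply/eqP => D0; apply: uv.
apply/matrixP => r k; rewrite ord1; apply/eqP; rewrite -subr_eq0 -normr_le0.
by rewrite D0 le_eucl_dist.
Qed.

Variables (K : nat) (s : 'I_K -> R) (sg : 'I_K -> 'S_q).
Hypothesis s01 : forall i, 0 <= s i < 1.
Local Notation m := (fun i => perm_xs (s i) (sg i)).
Hypothesis K0 : 'I_K.
Hypothesis m_inj : injective m.
Hypothesis m_max : forall t, global_max p beta h t <-> exists i, t = m i.
Hypothesis negdef : forall i t, zero_sum t -> t != 0 -> Qform p beta (m i) t < 0.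
Variables (lS : R).
Hypothesis stirling_lim : stirling R N @[N --> \oo] --> lS.

Let gm i : global_max p beta h (m i). Proof. by apply/m_max; exists i. Qed.

Let tau_i i := tau p beta h (m i) (s i).
Let C := expR (- n%:R * lS) * Num.sqrt ((pi *+ 2) ^+ n * n%:R / q%:R ^+ 2) : R.

Let C_gt0 : 0 < C.
Proof.
rewrite /C mulr_gt0 ?expR_gt0// sqrtr_gt0.
by rewrite divr_gt0 ?mulr_gt0 ?exprn_gt0 ?ltr0n// mulrn_wgt0// pi_gt0.
Qed.

Lemma tau_gt0 i : 0 < tau_i i.
Proof.
rewrite -(pmulr_rgt0 _ C_gt0) /tau_i /C -(local_mass00 lS (s01 i) (@negdef i)).
exact: local_mass_gt0 (s01 i) (@negdef i) _.
Qed.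

(** For d small, the balls of radius d around the maximizers are disjoint, and
what lies outside is negligible. Inside the ball around m i the rescaled
fluctuation y enters through g (m i + y / sqrt N), which tends to g (m i). *)
Lemma total_cvg (g : 'cV[R]_q -> R) M : continuous g -> (forall x, `|g x| <= M) ->
  renorm p beta h 0 0 (m K0) N * (\sum_(X : config q N) weight p beta h 0 0 X * g (xbar R X))
    @[N --> \oo] --> \sum_i C * tau_i i * g (m i).
Proof.
move=> cg gM.
have [d [d0 dm inner]] : exists d, [/\ 0 < d,
    forall i j, i != j -> 2 * d <= eucl_dist (m i) (m j) &
    forall i (phi : nat -> 'cV[R]_q -> R) (c M : R), (forall N y, `|phi N y| <= M) ->
    cvg_along phi (fun=> c) ->
    inner_sum p beta h 0 0 (s i) (sg i) d phi N @[N --> \oo] --> C * tau_i i * c].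
  near (0:R)^'+ => d; exists d; split.
  - by near: d; exact: nbhs_right_gt.
  - near: d; apply: filter_forall => i; apply: filter_forall => j.
    case: (eqVneq i j) => [->|ij]; first by apply: nearW.
    have D0 : 0 < eucl_dist (m i) (m j).
      by apply: eucl_dist_gt0 => mij; move/eqP: ij; apply; exact: m_inj.
    near=> d => _; rewrite -ler_pdivlMl//.
    by near: d; apply: nbhs_right_le; rewrite mulr_gt0.
  - near: d; apply: filter_forall => i.
    rewrite /C /tau_i -(local_mass00 lS (s01 i) (@negdef i)).
    exact: (inner_cvg_cst 0 0 n0 p2 beta0 (s01 i) (gm i) (@negdef i) stirling_lim).
pose phi i N (y : 'cV[R]_q) := g (m i + (Num.sqrt N%:R)^-1 *: y).
pose O := [pred t : 'cV[R]_q | [forall i, d <= eucl_dist t (m i)]].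
have cO : closed [set t | O t].
  have -> : [set t | O t] =
      \bigcap_(i in setT) ((fun t : 'cV[R]_q => eucl_dist t (m i)) @^-1` `[d, +oo[).
    apply/seteqP; split => t /=.
      by move=> /forallP H i _; rewrite /= in_itv /= andbT.
    by move=> H; apply/forallP => i; have := H i I; rewrite /= in_itv /= andbT.
  apply: closed_bigI => i _.
  by apply: closed_comp => [t _|]; [exact: continuous_eucl_dist|exact: interval_closed].
have dist0 u : eucl_dist u u = 0 :> R.
  by rewrite /eucl_dist big1 ?sqrtr0// => r _; rewrite subrr expr0n.
have Om t : O t -> ~ global_max p beta h t.
  by move=> /forallP Ot /m_max[i ti]; have := Ot i; rewrite ti dist0 leNgt d0.
have H2 := outer_cvg 0 0 (gm K0) cO Om (fun _ : nat => gM).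
have H1 i : inner_sum p beta h 0 0 (s i) (sg i) d (phi i) N @[N --> \oo] --> C * tau_i i * g (m i).
  apply: (inner i (phi i) _ M); first by move=> N y; exact: gM.
  move=> y z yz; apply: continuous_cvg; first exact: cg.
  apply: cvg_col => r; rewrite -[X in _ --> X]addr0.
  have E N : (m i + (Num.sqrt N%:R)^-1 *: y N) r ord0 =
      m i r ord0 + (Num.sqrt N%:R)^-1 * y N r ord0.
    by rewrite [LHS]mxE [X in _ + X]mxE.
  under eq_fun do rewrite E.
  apply: cvgD; first exact: cvg_cst.
  by rewrite -[X in _ --> X](mul0r (z r ord0)); apply: cvgM => //; exact: inv_sqrtn_cvg0.
have H3 := @cvg_sumr R _ _ _ _ (index_enum _) _ _ H1.
rewrite -[X in _ --> X]addr0.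
apply: cvg_trans (cvgD (H3 _) H2); apply: near_eq_cvg.
near=> N.
have NR : 0 < Num.sqrt N%:R :> R.
  by rewrite sqrtr_gt0 ltr0n; near: N; exists 1%N.
transitivity (\sum_i inner_sum p beta h 0 0 (s i) (sg i) d (phi i) N +
  renorm p beta h 0 0 (m K0) N *
  \sum_(X : config q N) weight p beta h 0 0 X * ((O (xbar R X))%:R * g (xbar R X))) => //.
rewrite /inner_sum; under eq_bigr => i _ do rewrite (renorm00_max N (gm i) (gm K0)).
rewrite -mulr_sumr -mulrDr; congr (_ * _).
rewrite exchange_big -big_split /=; apply: eq_bigr => X _.
rewrite -mulr_sumr -mulrDr; congr (_ * _).
set t := xbar R X.
have phiE i : phi i N (Num.sqrt N%:R *: (t - m i)) = g t.
  by rewrite /phi scalerA mulVf ?gt_eqF// scale1r addrC subrK.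
under eq_bigr do rewrite phiE.
rewrite -mulr_suml -mulrDl -[RHS]mul1r; congr (_ * _).
have [Ot|/forallPn[i0 ti0]] := boolP [forall i, d <= eucl_dist t (m i)].
  rewrite big1 ?add0r// => i _; have := forallP Ot i.
  by rewrite leNgt => /negbTE ->.
rewrite -ltNge in ti0.
rewrite addr0 (bigD1 i0)//= ti0 big1 ?addr0// => i ii0.
case: ltP => // ti.
have := eucl_dist_double d0 ti ti0; rewrite ltNge dm//.
Unshelve. all: by end_near. Qed.

(** The constant C and the factor renorm cancel in the quotient of total_cvg
for g and for 1. *)
Lemma mixture_limit : exists2 mu : probability (borelV R q) R,
     is_mixture (fun k => tau p beta h (m k) (s k)
                          / \sum_(i < K) tau p beta h (m i) (s i)) m mu
   & cvg_dist (fun N (X : config q N) => gibbs p beta h X)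
              (fun N (X : config q N) => xbar R X) mu.
Proof.
have tau0 : 0 < \sum_i tau_i i.
  rewrite (bigD1 K0)//= ltr_wpDr ?tau_gt0// sumr_ge0// => i _.
  by rewrite ltW ?tau_gt0.
have w0 k : 0 <= tau_i k / \sum_i tau_i i by rewrite divr_ge0 ?ltW ?tau_gt0.
have w1 : \sum_k tau_i k / \sum_i tau_i i = 1.
  by rewrite -mulr_suml mulfV ?gt_eqF.
have [mu [muE muI]] := @mixture_probability _ (borelV R q) R K _ m w0 w1.
exists mu; first by move=> A _; rewrite muE.
move=> g cg [M gM]; rewrite muI; last exact: measurable_continuous.
apply: cvg_EFin; first by apply: nearW.
have H1 := total_cvg cg gM.
have c1 : continuous ((fun _ => 1) : 'cV[R]_q -> R).
  by move=> x; apply: (@cvg_cst R); exact: nbhs_filter.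
have H2 := total_cvg c1 (fun _ => ltac:(by rewrite normr1)).
have C0 : 0 < \sum_i C * tau_i i * 1.
  by under eq_bigr do rewrite mulr1; rewrite -mulr_sumr mulr_gt0 ?C_gt0.
have <- : (\sum_i C * tau_i i * g (m i)) / \sum_i C * tau_i i * 1 =
    \sum_k tau_i k / (\sum_i tau_i i) * g (m k).
  rewrite (eq_bigr (fun i => C * (tau_i i * g (m i)))); last by move=> i _; rewrite mulrA.
  rewrite [X in _ / X](eq_bigr (fun i => C * tau_i i)); last by move=> i _; rewrite mulr1.
  rewrite -!mulr_sumr -mulf_div mulfV ?gt_eqF ?C_gt0// mul1r mulr_suml.
  by apply: eq_bigr => i _; rewrite mulrAC.
apply: cvg_trans (cvgM H1 (cvgV (lt0r_neq0 C0) H2)).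
apply: near_eq_cvg; apply: nearW => N /=.
rewrite expect_gibbs; have sc := renorm_gt0 p beta h 0 0 (m K0) N.
set num := \sum_X _ * g _; transitivity ((renorm p beta h 0 0 (m K0) N * num) /
  (renorm p beta h 0 0 (m K0) N * \sum_(X : config q N) weight p beta h 0 0 X * 1)) => //.
by under eq_bigr do rewrite mulr1; rewrite -mulf_div mulfV ?mul1r// gt_eqF.
Qed.

End equilibrium.

Theorem theorem2p5 (R : realType) (p q : nat) (hp : (2 <= p)%N) (hq : (2 <= q)%N)
  (beta h : R) (hbeta : 0 < beta) (hh : 0 <= h) (hcrit : critical p q beta h)
  (K : nat) (m : 'I_K -> 'cV[R]_q) (m_inj : injective m)
  (m_max : forall t, global_max p beta h t <-> exists i, t = m i)
  (s : 'I_K -> R) (hs : forall i, 0 <= s i < 1)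
  (hms : forall i, exists sigma : 'S_q, m i = perm_mx sigma *m xs q (s i)) :
  (exists2 mu : probability (borelV R q) R,
     is_mixture (fun k => tau p beta h (m k) (s k)
                          / \sum_(i < K) tau p beta h (m i) (s i)) m mu
   & cvg_dist (fun N (X : config q N) => gibbs p beta h X)
              (fun N (X : config q N) => xbar R X) mu)
  /\
  (forall (betabar hbar eps : R), 0 < eps ->
     (forall i j, i != j -> eps < eucl_dist (m i) (m j)) ->
   forall (i : 'I_K) (sigma : 'S_q), m i = perm_mx sigma *m xs q (s i) ->
   let P : 'M[R]_q := perm_mx sigma in
   let V := P *m Sigma p q beta h (s i) *m P^T in
   exists2 nu : probability (borelV R q) R,
     is_normal (V *m ((betabar * p%:R) *: (\col_r m i r ord0 ^+ (p - 1))
                      + hbar *: e1)) V nu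
   & cvg_dist
       (fun N => cond (gibbs p (beta + betabar / Num.sqrt N%:R)
                               (h + hbar / Num.sqrt N%:R))
                      (fun X : config q N => eucl_dist (xbar R X) (m i) < eps))
       (fun N (X : config q N) => Num.sqrt N%:R *: (xbar R X - m i)) nu).
Proof.
case: q hq hcrit m m_inj m_max hms => [|[|n]]// hq' hcrit' m' m_inj' m_max' hms'.
have [sg msg] := choice hms'.
have mE : m' = fun i => perm_xs (s i) (sg i) by apply/funext => i; rewrite msg.
have gm i : global_max p beta h (m' i) by apply/m_max'; exists i.
have negdef i t := hcrit'.2 _ (gm i) t.
have [lS stirling_lim] := stirling_cvg R.
split.
  have [m1 [_ [/m_max'[K0 _] _ _]]] := hcrit'.1.
  move: m_inj' m_max' negdef {msg gm hms'}; rewrite mE => m_inj' m_max' negdef.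
  exact: (@mixture_limit R n.+1 p beta h isT hp hbeta K s sg hs K0 m_inj' m_max' negdef lS stirling_lim).
move=> bb hb eps eps0 sep i sigma mi P V.
have perm_xsE : m' i = perm_xs (s i) sigma by [].
rewrite /V /P perm_xsE.
have gmi : global_max p beta h (perm_xs (s i) sigma) by rewrite -perm_xsE.
have ndi t : zero_sum t -> t != 0 -> Qform p beta (perm_xs (s i) sigma) t < 0.
  by rewrite -perm_xsE; exact: negdef.
apply: (@conditional_limit R n.+1 p beta h bb hb (s i) sigma isT hp hbeta (hs i) gmi ndi
  lS stirling_lim eps eps0).
move=> t; rewrite -perm_xsE => te /m_max'[j tj]; move: te; rewrite tj.
by case: (eqVneq j i) => [->//|ji]; rewrite leNgt sep.
Qed.
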